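(* Let $(M,d,\mu_M)$ be a proper complete metric space with a positive Radon measure $\mu_M$ satisfying the volume growth assumption with constant $h_M>0$ and base point $o\in M$. Let $\Pi$ be a point process on $M$ satisfying the small variance assumption and with first intensity measure $\mu_M$. Let $\mathscr{H}$ be a Hilbert space and $f\in\mathrm{MVP}(\mu_M;\mathscr{H})$. Fix $z\in M$ and any sequence $(s_n)_{n\ge1}$ in $(h_M,\infty)$ converging to $h_M$ and satisfying $$\sum_{n=1}^\infty\frac{\displaystyle\int_Me^{-2s_nd(x,o)}\|f(x)\|_{\mathscr{H}}^2\,d\mu_M(x)}{\displaystyle\Big[\int_Me^{-s_nd(x,o)}\,d\mu_M(x)\Big]^2}<\infty.$$ Then $\Pi$-almost every $X$ satisfies: (1) For any $n\in\mathbb{N}$, $$\sum_{k=0}^\infty\Big\|\sum_{x\in X,\ k\le d(x,z)<k+1}e^{-s_nd(x,z)}f(x)\Big\|_{\mathscr{H}}<\infty.$$ (2) The following limit equality holds in the norm topology of $\mathscr{H}$: $$f(z)=\lim_{n\to\infty}\frac{\displaystyle\sum_{k=0}^\infty\ \sum_{x\in X,\ k\le d(x,z)<k+1}e^{-s_nd(x,z)}f(x)}{\displaystyle\sum_{x\in X}e^{-s_nd(x,z)}}.$$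
   Context: $B(z,r)$ denotes the ball $\{x: d(x,z)<r\}$. A non-negative function $\Lambda$ on $\mathbb{R}^+$ (or $\mathbb{N}$) is sub-exponential if $\lim_{t\to+\infty}\Lambda(t)e^{-\alpha t}=0$ for every $\alpha>0$. A pair $(L,U)$, $L\le U$, of continuous non-negative functions on $[0,\infty)$ is controllable if $\liminf_{r\to\infty}L(r)>0$ and the functions $L$, $U$ and $r\mapsto\sup_{k\in\mathbb{N}}\frac{U(kr)}{L((k+1)r)}$ are all sub-exponential. Volume growth assumption: there exist $h_M>0$ and a controllable pair $(L,U)$ such that $L(r)e^{rh_M}\le\mu_M(B(o,r))\le U(r)e^{rh_M}$ for all $r>0$. For a Hilbert space $\mathscr{H}$ over $\mathbb{R}$ or $\mathbb{C}$, $\mathrm{MVP}(\mu_M;\mathscr{H})$ is the set of locally square-integrable $f:M\to\mathscr{H}$ such that: (i) for any $z\in M$ and $r>0$, $f(z)=\frac{1}{\mu_M(B(z,r))}\int_{B(z,r)}f\,d\mu_M$; (ii) there is a non-decreasing sub-exponential function $\Lambda:\mathbb{N}\to\mathbb{R}^+$, depending on $f$, with $\int_{A_k(o)}\|f(x)\|_{\mathscr{H}}^2d\mu_M(x)\le\Lambda(k)e^{2kh_M}$ for all $k\in\mathbb{N}$, where $A_k(o)=\{x\in M:k\le d(x,o)<k+1\}$; (iii) $$\lim_{s\to h_M^+}\frac{\int_Me^{-2sd(x,o)}\|f(x)\|_{\mathscr{H}}^2d\mu_M(x)}{\big[\int_Me^{-sd(x,o)}d\mu_M(x)\big]^2}=0.$$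 A configuration on $M$ is a collection of points of $M$ (possibly with multiplicities) with finitely many points in each relatively compact set; $\mathrm{Conf}(M)$ is the space of configurations with the usual Borel structure. Sums over $x\in X$ are taken with multiplicity. A point process on $M$ is a Borel probability measure $\Pi$ on $\mathrm{Conf}(M)$; its first intensity measure is $B\mapsto\mathbb{E}_\Pi(\#_B(\mathscr{X}))$, with $\mathscr{X}$ the random configuration and $\#_B$ the number of points in $B$. Small variance assumption: there is a constant $C>0$ depending only on $\Pi$ such that for every $f:M\to\mathbb{C}$ with $\mathbb{E}_\Pi[\sum_{x\in\mathscr{X}}(|f(x)|+|f(x)|^2)]<\infty$, $$\mathrm{Var}_\Pi\Big(\sum_{x\in\mathscr{X}}f(x)\Big)\le C\,\mathbb{E}_\Pi\Big(\sum_{x\in\mathscr{X}}|f(x)|^2\Big).$$ *)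

(* Defs.v *)
From HB Require Import structures.
From mathcomp Require Import all_boot all_order all_algebra.
From mathcomp Require Import complex.
From mathcomp Require Import all_classical all_reals all_analysis.

Set Implicit Arguments.
Unset Strict Implicit.
Unset Printing Implicit Defensive.

Import Order.TTheory GRing.Theory Num.Theory.
Import numFieldNormedType.Exports.

Local Open Scope classical_set_scope.
Local Open Scope ring_scope.

(* Hilbert spaces are taken over [R] or over [R[i]]. The norm of a
   [normedModType K] is [K]-valued; [rnorm] is the same norm read in [R]. *)
Inductive scalar_kind := RealScalars | ComplexScalars.

Definition scalar_field (R : realType) (b : scalar_kind) : numFieldType :=
  match b with RealScalars => R | ComplexScalars => R[i] end.

Definition of_real (R : realType) (b : scalar_kind) : R -> scalar_field R b :=
  match b with
  | RealScalars => fun x => x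
  | ComplexScalars => fun x => Complex x 0
  end.

Definition to_real (R : realType) (b : scalar_kind) : scalar_field R b -> R :=
  match b with
  | RealScalars => fun x => x
  | ComplexScalars => fun x => complex.Re x
  end.

Definition scalar_conj (R : realType) (b : scalar_kind) :
    scalar_field R b -> scalar_field R b :=
  match b with
  | RealScalars => fun x => x
  | ComplexScalars => fun x => conjc x
  end.

Definition rnorm (R : realType) (b : scalar_kind)
    (V : normedModType (scalar_field R b)) (v : V) : R :=
  to_real `|v|.

Definition is_hilbert (R : realType) (b : scalar_kind)
    (H : completeNormedModType (scalar_field R b)) : Prop :=
  exists dot : {dot H for @scalar_conj R b},
    forall v : H, `|v| ^+ 2 = dot v v.

Definition simple_function (R : realType) (b : scalar_kind)
    (d : measure_display) (T : measurableType d)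
    (H : normedModType (scalar_field R b)) (phi : T -> H) : Prop :=
  finite_set (range phi) /\
  forall v : H, measurable (phi @^-1` [set v]).

Definition strongly_measurable (R : realType) (b : scalar_kind)
    (d : measure_display) (T : measurableType d)
    (H : normedModType (scalar_field R b)) (f : T -> H) : Prop :=
  exists phi : nat -> T -> H,
    (forall n, simple_function (phi n)) /\
    (forall x, phi n x @[n --> \oo] --> f x).

Definition integrable_simple (R : realType) (b : scalar_kind)
    (d : measure_display) (T : measurableType d)
    (H : normedModType (scalar_field R b))
    (mu : set T -> \bar R) (D : set T) (phi : T -> H) : Prop :=
  simple_function phi /\
  forall v : H, v != 0 -> (mu (D `&` phi @^-1` [set v]) < +oo)%E.

Definition simple_integral (R : realType) (b : scalar_kind)
    (d : measure_display) (T : measurableType d)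
    (H : normedModType (scalar_field R b))
    (mu : set T -> \bar R) (D : set T) (phi : T -> H) : H :=
  \sum_(v \in range phi)
    (of_real b (fine (mu (D `&` phi @^-1` [set v]))) *: v).

Definition is_bochner_integral (R : realType) (b : scalar_kind)
    (d : measure_display) (T : measurableType d)
    (H : normedModType (scalar_field R b))
    (mu : {measure set T -> \bar R}) (D : set T) (f : T -> H) (v : H) : Prop :=
  exists phi : nat -> T -> H,
    [/\ forall n, integrable_simple mu D (phi n),
        forall x, D x -> phi n x @[n --> \oo] --> f x,
        (\int[mu]_(x in D) (rnorm (f x - phi n x))%:E)%E
          @[n --> \oo] --> 0%E
      & simple_integral mu D (phi n) @[n --> \oo] --> v].

(* 0 when [f] is not Bochner integrable on [D] *)
Definition bochner (R : realType) (b : scalar_kind)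
    (d : measure_display) (T : measurableType d)
    (H : normedModType (scalar_field R b))
    (mu : {measure set T -> \bar R}) (D : set T) (f : T -> H) : H :=
  xget 0 [set v | is_bochner_integral mu D f v].

(* [Complete] carries a point, which is what lets [g_sigma_algebraType]
   below be a [measurableType]; the point plays no other role. *)
#[short(type="completeMetricType")]
HB.structure Definition CompleteMetric (R : numFieldType) :=
  {M of Metric R M & Complete M}.

Notation borel M := (g_sigma_algebraType (@open M)).

Definition mball (R : realType) (M : metricType R) (z : M) (r : R) : set M :=
  [set x | mdist x z < r].

Definition shell (R : realType) (M : metricType R) (z : M) (k : nat) : set M :=
  [set x | k%:R <= mdist x z < k.+1%:R].

Definition proper_metric (R : realType) (M : metricType R) : Prop :=
  forall (z : M) (r : R), compact [set x | mdist x z <= r].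

Definition relatively_compact (T : topologicalType) (A : set T) : Prop :=
  compact (closure A).

Definition is_radon (R : realType) (M : completeMetricType R)
    (mu : {measure set (borel M) -> \bar R}) : Prop :=
  [/\ forall K : set M, compact K -> (mu K < +oo)%E,
      forall A : set (borel M), measurable A ->
        mu A = ereal_inf [set mu U | U in [set U : set M | open U /\ A `<=` U]]
    & forall U : set M, open U ->
        mu U =
        ereal_sup [set mu K | K in [set K : set M | compact K /\ K `<=` U]]].

Definition subexponential (R : realType) (F : R -> \bar R) : Prop :=
  forall a : R, 0 < a ->
    (F t * (expR (- (a * t)))%:E)%E @[t --> +oo%R] --> 0%E.

Definition subexponential_seq (R : realType) (F : nat -> R) : Prop :=
  forall a : R, 0 < a ->
    F k * expR (- (a * k%:R)) @[k --> \oo] --> (0 : R).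

(* Only the values of [L] and [U] on [0, +oo[ are constrained. The quotient
   may be a division by 0 for small [r] only, as [L] is bounded away from 0
   near infinity. *)
Definition controllable (R : realType) (L U : R -> R) : Prop :=
  [/\ {within `[0, +oo[, continuous L},
      {within `[0, +oo[, continuous U},
      forall r : R, 0 <= r -> 0 <= L r <= U r,
      (0 < limf_einf (fun r => (L r)%:E) (pinfty_nbhs R))%E
    & [/\ subexponential (fun r => (L r)%:E),
          subexponential (fun r => (U r)%:E)
        & subexponential (fun r =>
            ereal_sup (range (fun k : nat =>
              (U (k%:R * r) / L (k.+1%:R * r))%:E)))]].

Definition volume_growth (R : realType) (M : completeMetricType R)
    (mu : {measure set (borel M) -> \bar R}) (o : M) (h : R) : Prop :=
  0 < h /\
  exists L U : R -> R, controllable L U /\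
    forall r : R, 0 < r ->
      ((L r * expR (r * h))%:E <= mu (mball o r) <= (U r * expR (r * h))%:E)%E.

Definition weight_mass (R : realType) (M : completeMetricType R)
    (mu : {measure set (borel M) -> \bar R}) (o : M) (s : R) : \bar R :=
  (\int[mu]_x (expR (- (s * mdist (x : M) o)))%:E)%E.

Definition weight_energy (R : realType) (b : scalar_kind)
    (M : completeMetricType R) (H : normedModType (scalar_field R b))
    (mu : {measure set (borel M) -> \bar R}) (o : M) (f : M -> H)
    (s : R) : \bar R :=
  (\int[mu]_x
     (expR (- (2 * s * mdist (x : M) o)) * rnorm (f x) ^+ 2)%:E)%E.

Definition energy_ratio (R : realType) (b : scalar_kind)
    (M : completeMetricType R) (H : normedModType (scalar_field R b))
    (mu : {measure set (borel M) -> \bar R}) (o : M) (f : M -> H)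
    (s : R) : \bar R :=
  (weight_energy mu o f s / weight_mass mu o s ^+ 2)%E.

Definition locally_square_integrable (R : realType) (b : scalar_kind)
    (M : completeMetricType R) (H : normedModType (scalar_field R b))
    (mu : {measure set (borel M) -> \bar R}) (f : M -> H) : Prop :=
  strongly_measurable (f : borel M -> H) /\
  forall K : set M, compact K ->
    (\int[mu]_(x in K) (rnorm (f x) ^+ 2)%:E < +oo)%E.

Definition MVP (R : realType) (b : scalar_kind)
    (M : completeMetricType R) (H : normedModType (scalar_field R b))
    (mu : {measure set (borel M) -> \bar R}) (o : M) (h : R)
    (f : M -> H) : Prop :=
  [/\ locally_square_integrable mu f,
      forall (z : M) (r : R), 0 < r ->
        f z = of_real b (fine (mu (mball z r)))^-1 *:
              bochner mu (mball z r) (f : borel M -> H),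
      exists Lam : nat -> R,
        [/\ forall k, 0 <= Lam k,
            {homo Lam : j k / (j <= k)%N >-> j <= k},
            subexponential_seq Lam
          & forall k, (\int[mu]_(x in shell o k) (rnorm (f x) ^+ 2)%:E
                       <= (Lam k * expR (2 * k%:R * h))%:E)%E]
    & energy_ratio mu o f s @[s --> h^'+] --> 0%E].

(* a configuration is given by the multiplicities of its points *)
Record configuration (R : realType) (M : completeMetricType R) := Configuration {
  mult :> M -> nat ;
  locally_finite_mult : forall A : set M, relatively_compact A ->
    finite_set (A `&` [set x | mult x != 0%N])
}.

HB.instance Definition _ (R : realType) (M : completeMetricType R) :=
  gen_eqMixin (configuration M).
HB.instance Definition _ (R : realType) (M : completeMetricType R) :=
  gen_choiceMixin (configuration M).

Lemma empty_configuration_subproof (R : realType) (M : completeMetricType R)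
    (A : set M) : relatively_compact A ->
  finite_set (A `&` [set x : M | (fun=> 0%N : nat) x != 0%N]).
Proof.
by move=> _; rewrite (_ : _ `&` _ = set0) // -subset0 => x [_].
Qed.

Definition empty_configuration (R : realType) (M : completeMetricType R) :
    configuration M :=
  Configuration (@empty_configuration_subproof R M).

HB.instance Definition _ (R : realType) (M : completeMetricType R) :=
  isPointed.Build (configuration M) (empty_configuration M).

Definition npoints (R : realType) (M : completeMetricType R)
    (B : set M) (X : configuration M) : \bar R :=
  \esum_(x in B) ((X x)%:R)%:E.

Definition counting_events (R : realType) (M : completeMetricType R) :
    set (set (configuration M)) :=
  [set E | exists (B : set (borel M)) (n : nat),
     [/\ measurable B, relatively_compact (B : set M)
       & E = [set X | npoints B X = (n%:R)%:E]]].

Notation conf M := (g_sigma_algebraType (@counting_events _ M)).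

Definition first_intensity (R : realType) (M : completeMetricType R)
    (Pi : probability (conf M) R) (B : set M) : \bar R :=
  (\int[Pi]_X npoints B X)%E.

(* Meaningful only when [g] is absolutely summable over [X]. *)
Definition rsum (R : realType) (M : completeMetricType R)
    (g : M -> R) (X : configuration M) : R :=
  fine (\esum_(x in [set: M]) ((X x)%:R * Num.max (g x) 0)%:E) -
  fine (\esum_(x in [set: M]) ((X x)%:R * Num.max (- g x) 0)%:E).

Definition csum (R : realType) (M : completeMetricType R)
    (f : M -> R[i]) (X : configuration M) : R[i] :=
  Complex (rsum (fun x => complex.Re (f x)) X)
          (rsum (fun x => complex.Im (f x)) X).

Definition cabs (R : realType) (z : R[i]) : R := complex.Re `|z|.

Definition cexpectation (R : realType) (d : measure_display)
    (T : measurableType d) (P : probability T R) (S : T -> R[i]) : R[i] :=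
  Complex (fine 'E_P[fun w => complex.Re (S w)])
          (fine 'E_P[fun w => complex.Im (S w)]).

Definition cvariance (R : realType) (d : measure_display)
    (T : measurableType d) (P : probability T R) (S : T -> R[i]) : \bar R :=
  (\int[P]_w (cabs (S w - cexpectation P S) ^+ 2)%:E)%E.

Definition small_variance (R : realType) (M : completeMetricType R)
    (Pi : probability (conf M) R) : Prop :=
  exists2 C : R, 0 < C &
    forall f : M -> R[i],
      measurable_fun setT (fun x : borel M => complex.Re (f x)) ->
      measurable_fun setT (fun x : borel M => complex.Im (f x)) ->
      (\int[Pi]_X (\esum_(x in [set: M])
         ((X x)%:R * (cabs (f x) + cabs (f x) ^+ 2))%:E) < +oo)%E ->
      (cvariance Pi (csum f) <=
       C%:E * \int[Pi]_X (\esum_(x in [set: M])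
                ((X x)%:R * cabs (f x) ^+ 2)%:E))%E.

Definition conf_weight (R : realType) (M : completeMetricType R)
    (s : R) (z : M) (X : configuration M) : \bar R :=
  \esum_(x in [set: M]) ((X x)%:R * expR (- (s * mdist x z)))%:E.

(* a finite sum when [M] is proper, shells being then relatively compact *)
Definition shell_sum (R : realType) (b : scalar_kind)
    (M : completeMetricType R) (H : normedModType (scalar_field R b))
    (s : R) (z : M) (f : M -> H) (X : configuration M) (k : nat) : H :=
  \sum_(x \in shell z k)
    (of_real b ((X x)%:R * expR (- (s * mdist x z))) *: f x).

(* Main.v *)
Require Import Defs.
From HB Require Import structures.
From mathcomp Require Import all_boot all_order all_algebra.
From mathcomp Require Import complex.
From mathcomp Require Import all_classical all_reals all_analysis.
From mathcomp Require Import finmap measurable_realfun.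
From mathcomp Require Import ring lra.

Import Order.TTheory GRing.Theory Num.Theory.
Import numFieldNormedType.Exports.

Local Open Scope classical_set_scope.
Local Open Scope ring_scope.
Set Implicit Arguments.
Unset Strict Implicit.
Unset Printing Implicit Defensive.
Import HBNNSimple.

(** Write [w s x = expR (- (s * mdist x z))]. Let [S] be the sum over the random
    configuration of [w s] times [f], let [W] be the sum of [w s], and let [m] be the
    integral of [w s] against the intensity [mu]. The quotient in the theorem is
    [S / W], and it tends to [f z] as soon as [W / m] tends to [1] and
    [T = S - W * f z] satisfies [T / m --> 0] ([cvg_ratio]). Both hold almost surely
    along the given exponents, because second moments relative to [m ^+ 2] are
    summable.

    The statistic [T] has test function [w s x * (f x - f z)]. The mean value property
    says that [f x - f z] has integral zero over every ball around [z], hence over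
    every annulus around [z]; cutting into thin annuli, the same is true after
    multiplication by the radial weight ([integral_annulus_radial0],
    [annulus_mean0]). By Campbell's formula [T] is therefore centered, and small
    variance bounds its second moment by the energy of its test function. The
    assumption on the variance is scalar; expanding in an orthonormal family whose
    closed span contains the values of [f] and applying Parseval turns it into a
    bound for the vector-valued sum ([window_variance]).

    The energy of [w s x * (f x - f z)] is at most twice the energy of [w s * f] plus
    a constant ([centered_energy_le]). The first part is summable relative to
    [m ^+ 2] by hypothesis, once the base point has been moved from [o] to [z]
    ([radial_ratio_le]). The second part requires the summability of [m ^- 2]: the
    energy of a nonzero [f] is bounded below, so this too follows from the hypothesis
    ([summable_inverse_mass]); for [f = 0] there is nothing to prove. The same
    summability gives [W / m --> 1], as the variance of [W] is bounded
    ([ae_mass_ratio]). That [W] is positive at all means that the configuration is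
    nonempty, which holds almost surely because [mu] is infinite ([ae_nonempty]).

    The series defining [S] is only claimed to converge when grouped by shells. Hence all
    variance estimates are made on bounded windows, where sums are finite, and reach
    [T] through Fatou's lemma ([ae_centered_sums]). Convergence over the shells
    follows by comparing the exponent [s] with a smaller admissible one: this
    gains a geometric factor on the [k]-th shell ([ae_shells_summable]). *)

(** * Real scalars, real norms and real inner products *)

Section RealScalars.
Context {R : realType} (b : scalar_kind).

Lemma of_realK : cancel (of_real b) (@to_real R b).
Proof. by case: b. Qed.

Lemma of_realD (x y : R) : of_real b (x + y) = of_real b x + of_real b y.
Proof. by case: b => //=; apply/eqP; rewrite eq_complex /= addr0 !eqxx. Qed.

Lemma of_realM (x y : R) : of_real b (x * y) = of_real b x * of_real b y.
Proof.
case: b => //=; apply/eqP; rewrite eq_complex /=.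
by rewrite !mulr0 mul0r subr0 addr0 !eqxx.
Qed.

Lemma of_real1 : of_real b (1 : R) = 1.
Proof. by case: b. Qed.

Lemma of_real0 : of_real b (0 : R) = 0.
Proof. by case: b. Qed.

Lemma of_realN (x : R) : of_real b (- x) = - of_real b x.
Proof. by case: b => //=; apply/eqP; rewrite eq_complex /= oppr0 !eqxx. Qed.

Lemma of_real_ge0 (x : R) : 0 <= x -> 0 <= of_real b x.
Proof. by case: b => //= x0; rewrite lecE /= eqxx. Qed.

Lemma of_real_gt0 (x : R) : 0 < x -> 0 < of_real b x.
Proof. by case: b => //= x0; rewrite ltcE /= eqxx. Qed.

Lemma to_realD (x y : scalar_field R b) : to_real (x + y) = to_real x + to_real y.
Proof. by case: b x y => //= -[? ?] [? ?]. Qed.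

Lemma to_realZ (a : R) (x : scalar_field R b) :
  to_real (of_real b a * x) = a * to_real x.
Proof. by case: b x => //= -[? ?] /=; rewrite mul0r subr0. Qed.

Lemma to_real_conj (x : scalar_field R b) : to_real (scalar_conj x) = to_real x.
Proof. by case: b x => //= -[? ?]. Qed.

Lemma to_realK (x : scalar_field R b) : 0 <= x -> of_real b (to_real x) = x.
Proof.
case: b x => //= -[x y]; rewrite lecE /= => /andP[/eqP -> _]; reflexivity.
Qed.

Lemma ge0_to_real (x : scalar_field R b) : 0 <= x -> 0 <= to_real x.
Proof. by case: b x => //= -[x y]; rewrite lecE /= => /andP[]. Qed.

Lemma ler_to_real (x y : scalar_field R b) : x <= y -> to_real x <= to_real y.
Proof. by case: b x y => //= -[? ?] [? ?]; rewrite lecE /= => /andP[]. Qed.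

Lemma ltr_to_real (x y : scalar_field R b) : x < y -> to_real x < to_real y.
Proof. by case: b x y => //= -[? ?] [? ?]; rewrite ltcE /= => /andP[]. Qed.

Lemma to_real_gt0 (x : scalar_field R b) : 0 < x -> 0 < to_real x.
Proof. by case: b x => //= -[? ?]; rewrite ltcE /= => /andP[]. Qed.

Lemma ltr_of_real (x y : R) : x < y -> of_real b x < of_real b y.
Proof. by case: b => //=; rewrite ltcE /= eqxx. Qed.

Context (V : normedModType (scalar_field R b)).
Implicit Types (u v w : V) (a : R).

Lemma of_real_rnorm v : of_real b (rnorm v) = `|v|.
Proof. by rewrite to_realK. Qed.

Lemma rnorm_ge0 v : 0 <= rnorm v.
Proof. exact: ge0_to_real. Qed.

Lemma ler_rnormD u v : rnorm (u + v) <= rnorm u + rnorm v.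
Proof. by rewrite -to_realD; apply: ler_to_real; exact: ler_normD. Qed.

Lemma rnormN v : rnorm (- v) = rnorm v.
Proof. by rewrite /rnorm normrN. Qed.

Lemma ler_rnormB u v : rnorm (u - v) <= rnorm u + rnorm v.
Proof. by rewrite (le_trans (ler_rnormD _ _))// rnormN. Qed.

Lemma rnormZ a v : rnorm (of_real b a *: v) = `|a| * rnorm v.
Proof.
rewrite /rnorm normrZ -of_real_rnorm.
suff -> : `|of_real b a| = of_real b `|a| by rewrite to_realZ.
suff pos : forall c : R, 0 <= c -> `|of_real b c| = of_real b `|c|.
  have [/pos//|/ltW a0] := leP 0 a.
  by rewrite -normrN -of_realN -(normrN a) pos// oppr_ge0.
by move=> c c0; rewrite (ger0_norm c0) ger0_norm// of_real_ge0.
Qed.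

Lemma rnorm0 : rnorm (0 : V) = 0.
Proof. by rewrite /rnorm normr0 -of_real0 of_realK. Qed.

Lemma rnorm_eq0 v : rnorm v = 0 -> v = 0.
Proof. by move=> v0; apply/eqP; rewrite -normr_eq0 -of_real_rnorm v0 of_real0. Qed.

Lemma ler_dist_rnorm u v : `|rnorm u - rnorm v| <= rnorm (u - v).
Proof.
have h (x y : V) : rnorm x <= rnorm (x - y) + rnorm y.
  by rewrite (le_trans _ (ler_rnormD _ _))// subrK.
have := h u v; have := h v u; rewrite -(rnormN (v - u)) opprB ler_norml.
by move=> ? ?; apply/andP; split; lra.
Qed.

Lemma rnorm_cvgP T (F : set_system T) {FF : Filter F} (u : T -> V) (l : V) :
  u x @[x --> F] --> l <-> rnorm (u x - l) @[x --> F] --> (0 : R).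
Proof.
split.
- move=> ul; apply/cvgr0Pnorm_lt => e e0.
  have /cvgrPdist_lt /(_ _ (of_real_gt0 e0)) := ul.
  apply: filterS => x; rewrite distrC -of_real_rnorm.
  by rewrite (ger0_norm (rnorm_ge0 _)) => /ltr_to_real; rewrite !of_realK.
- move=> /cvgr0Pnorm_lt ul; apply/cvgrPdist_lt => e e0.
  have e0' : of_real b (to_real e) = e by apply/to_realK/ltW.
  have := ul _ (to_real_gt0 e0); apply: filterS => x.
  rewrite (ger0_norm (rnorm_ge0 _)) distrC -of_real_rnorm => ?.
  by rewrite -e0' ltr_of_real.
Qed.

End RealScalars.

(** Over either scalar field the real part of the Hilbert inner product is a real
    inner product with the same norm. The proof only ever scales by reals, so
    this form serves both cases at once. *)
Record real_inner_product {R : realType} (b : scalar_kind)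
    (V : normedModType (scalar_field R b)) (ip : V -> V -> R) : Prop :=
  RealInnerProduct {
    ipDl : forall u v w, ip (u + v) w = ip u w + ip v w ;
    ipZl : forall a u v, ip (of_real b a *: u) v = a * ip u v ;
    ipC : forall u v, ip u v = ip v u ;
    ip_self : forall v, ip v v = rnorm v ^+ 2 }.

Lemma is_hilbert_real_inner_product {R : realType} (b : scalar_kind)
    (H : completeNormedModType (scalar_field R b)) :
  is_hilbert H -> exists ip : H -> H -> R, real_inner_product ip.
Proof.
move=> [dot normE]; exists (fun u v => to_real (dot u v)); split.
- by move=> u v w; rewrite linearDl to_realD.
- by move=> a u v; rewrite linearZl_LR /= to_realZ.
- by move=> u v; rewrite (hermitian_subproof u v) /= expr0 mul1r to_real_conj.
- move=> v; rewrite -normE -of_real_rnorm expr2 -of_realM of_realK//.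
Qed.

Section InnerProduct.
Context {R : realType} (b : scalar_kind) (V : normedModType (scalar_field R b)).
Context (ip : V -> V -> R) (ipV : real_inner_product ip).
Implicit Types (u v w : V) (a : R).

Local Notation "a *r v" := (of_real b a *: v) (at level 40).

Lemma ipZr a u v : ip v (a *r u) = a * ip v u.
Proof. by rewrite !(ipC ipV v) (ipZl ipV). Qed.

Lemma ip0l v : ip 0 v = 0.
Proof. by rewrite -(scale0r 0) -(of_real0 b) (ipZl ipV) mul0r. Qed.

Lemma ip0r v : ip v 0 = 0. Proof. by rewrite (ipC ipV) ip0l. Qed.

Lemma ipNl u v : ip (- u) v = - ip u v.
Proof. by rewrite -scaleN1r -(of_real1 b) -of_realN (ipZl ipV) mulN1r. Qed.

Lemma ipBl u v w : ip (u - v) w = ip u w - ip v w.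
Proof. by rewrite (ipDl ipV) ipNl. Qed.

Lemma ipBr u v w : ip w (u - v) = ip w u - ip w v.
Proof. by rewrite !(ipC ipV w) ipBl. Qed.

Lemma ip_suml (I : Type) (r : seq I) (P : pred I) (F : I -> V) v :
  ip (\sum_(i <- r | P i) F i) v = \sum_(i <- r | P i) ip (F i) v.
Proof.
apply: (big_morph (fun u => ip u v)) => [? ?|]; first exact: ipDl.
exact: ip0l.
Qed.

Lemma sqr_rnormB u v : rnorm (u - v) ^+ 2 = rnorm u ^+ 2 - 2 * ip u v + rnorm v ^+ 2.
Proof.
rewrite -!(ip_self ipV) ipBl !ipBr (ipC ipV v u); ring.
Qed.

Lemma cauchy_schwarz u v : `|ip u v| <= rnorm u * rnorm v.
Proof.
have [/rnorm_eq0 -> |v0] := eqVneq (rnorm v) 0.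
  by rewrite ip0r normr0 rnorm0 mulr0.
rewrite -ler_sqr ?nnegrE ?mulr_ge0 ?rnorm_ge0// -normrX ger0_norm ?sqr_ge0//.
have v2 : 0 < rnorm v ^+ 2 by rewrite exprn_gt0// lt_neqAle eq_sym v0 rnorm_ge0.
have := sqr_ge0 (rnorm (u - (ip u v / rnorm v ^+ 2) *r v)).
rewrite sqr_rnormB ipZr rnormZ exprMn -normrX ger0_norm ?sqr_ge0//.
set x := ip u v; set y := rnorm v in v0 v2 *.
rewrite (_ : _ - _ + _ = rnorm u ^+ 2 - x ^+ 2 / y ^+ 2); last by field.
by rewrite subr_ge0 ler_pdivrMr// exprMn.
Qed.

(** Zero vectors are allowed in the family, so that a dependent sequence can be
    orthonormalized without discarding terms. *)
Definition orthonormal_or_zero (e : nat -> V) : Prop :=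
  (forall i j, i != j -> ip (e i) (e j) = 0) /\
  (forall i, e i = 0 \/ ip (e i) (e i) = 1).

(** For an orthonormal family, the component of [u] orthogonal to its first [n]
    vectors. *)
Definition residual (e : nat -> V) (n : nat) (u : V) : V :=
  u - \sum_(i < n) ip u (e i) *r e i.

Lemma residualD e n u v : residual e n (u + v) = residual e n u + residual e n v.
Proof.
rewrite /residual -addrACA -opprD -big_split/=; congr (_ - _).
by apply: eq_bigr => i _; rewrite (ipDl ipV) of_realD scalerDl.
Qed.

Lemma residualZ e n a u : residual e n (a *r u) = a *r residual e n u.
Proof.
rewrite /residual scalerBr scaler_sumr; congr (_ - _); apply: eq_bigr => i _.
by rewrite (ipZl ipV) of_realM scalerA.
Qed.

Section Bessel.
Context (e : nat -> V) (eON : orthonormal_or_zero e).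

Lemma orthonormal_norm_le1 i : rnorm (e i) <= 1.
Proof.
have [->|e1] := eON.2 i; first by rewrite rnorm0.
by rewrite -(@expr_le1 _ 2)// ?rnorm_ge0// -(ip_self ipV) e1.
Qed.

(** A zero [e i] contributes nothing, which is why the two cases of
    [orthonormal_or_zero] behave alike here. *)
Lemma residual_orthogonal n u i : (i < n)%N -> ip (residual e n u) (e i) = 0.
Proof.
move=> i_n; rewrite ipBl ip_suml (bigD1 (Ordinal i_n))//= big1 => [|j ji].
  rewrite addr0 (ipZl ipV); have [->|->] := eON.2 i; first by rewrite ip0r mul0r subrr.
  by rewrite mulr1 subrr.
rewrite (ipZl ipV) eON.1 ?mulr0//.
Qed.

Lemma sqr_rnorm_residual n u :
  rnorm (residual e n u) ^+ 2 = rnorm u ^+ 2 - \sum_(i < n) ip u (e i) ^+ 2.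
Proof.
have h : ip (residual e n u) (\sum_(i < n) ip u (e i) *r e i) = 0.
  rewrite (ipC ipV) ip_suml big1// => i _.
  by rewrite (ipZl ipV) (ipC ipV (e i)) residual_orthogonal// mulr0.
rewrite -(ip_self ipV) {2}/residual ipBr h subr0 ipBl (ip_self ipV) ip_suml.
congr (_ - _); apply: eq_bigr => i _; rewrite (ipZl ipV) (ipC ipV) expr2//.
Qed.

Lemma rnorm_residual_le n u : rnorm (residual e n u) <= rnorm u.
Proof.
rewrite -ler_sqr ?nnegrE ?rnorm_ge0// sqr_rnorm_residual gerBl sumr_ge0// => i _.
exact: sqr_ge0.
Qed.

(** The residual maps are contractions, so the vectors whose residuals vanish in
    the limit form a closed set. *)
Lemma residual_cvg0_closed u : (forall eps, 0 < eps ->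
    exists w, rnorm (u - w) < eps /\ rnorm (residual e n w) @[n --> \oo] --> (0 : R)) ->
  rnorm (residual e n u) @[n --> \oo] --> (0 : R).
Proof.
move=> h; apply/cvgr0Pnorm_lt => eps eps0.
have [w [uw /cvgr0Pnorm_lt/(_ _ (divr_gt0 eps0 (ltr0n _ 2)))]] := h _ (divr_gt0 eps0 (ltr0n _ 2)).
apply: filterS => n wn; rewrite ger0_norm ?rnorm_ge0//.
rewrite ger0_norm ?rnorm_ge0// in wn.
rewrite -(subrK w u) residualD (le_lt_trans (ler_rnormD _ _))//.
rewrite [eps]splitr ltrD// (le_lt_trans (rnorm_residual_le _ _))//.
Qed.

Lemma parseval u : rnorm (residual e n u) @[n --> \oo] --> (0 : R) ->
  (\sum_(i < n) ip u (e i) ^+ 2) @[n --> \oo] --> rnorm u ^+ 2.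
Proof.
move=> h; pose r n := rnorm (residual e n u).
rewrite (_ : (fun n => _) = (fun n => rnorm u ^+ 2 - r n * r n)).
  have := cvgB (cvg_cst (rnorm u ^+ 2)) (cvgM h h).
  by rewrite mulr0 subr0; apply.
by apply/funext => n; rewrite -expr2 sqr_rnorm_residual//; ring.
Qed.

End Bessel.

Section GramSchmidt.
Context (v : nat -> V).

Fixpoint gram_schmidt_seq (n : nat) : seq V :=
  if n is m.+1 then
    let r := v m - \sum_(e <- gram_schmidt_seq m) ip (v m) e *r e in
    rcons (gram_schmidt_seq m) ((rnorm r)^-1 *r r)
  else [::].

Definition gram_schmidt (n : nat) : V := last 0 (gram_schmidt_seq n.+1).

Lemma gram_schmidt_seqE n : gram_schmidt_seq n = [seq gram_schmidt i | i <- iota 0 n].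
Proof.
elim: n => // n IH; rewrite -[in iota 0 _]addn1 iotaD map_cat -IH/= -cats1.
by rewrite add0n /gram_schmidt /= last_rcons.
Qed.

Lemma gram_schmidtE n :
  gram_schmidt n = (rnorm (residual gram_schmidt n (v n)))^-1 *r
                     residual gram_schmidt n (v n).
Proof.
rewrite {1}/gram_schmidt /= last_rcons gram_schmidt_seqE big_map.
suff -> : \sum_(j <- iota 0 n) ip (v n) (gram_schmidt j) *r gram_schmidt j =
  \sum_(i < n) ip (v n) (gram_schmidt i) *r gram_schmidt i by [].
by rewrite -(big_mkord xpredT (fun j => ip (v n) (gram_schmidt j) *r gram_schmidt j)) /index_iota subn0.
Qed.

Lemma gram_schmidt_unit n : gram_schmidt n = 0 \/ ip (gram_schmidt n) (gram_schmidt n) = 1.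
Proof.
rewrite gram_schmidtE; set r := residual _ _ _.
have [/rnorm_eq0 ->|r0] := eqVneq (rnorm r) 0; first by left; rewrite scaler0.
by right; rewrite (ipZl ipV) ipZr (ip_self ipV) expr2 mulKf// mulVf.
Qed.

Lemma gram_schmidt_orthonormal : orthonormal_or_zero gram_schmidt.
Proof.
split; last exact: gram_schmidt_unit.
suff h n : forall i j, (i < n)%N -> (j < n)%N -> i != j -> ip (gram_schmidt i) (gram_schmidt j) = 0.
  by move=> i j ij; apply: (h (maxn i j).+1) => //; rewrite ltnS ?leq_maxl ?leq_maxr.
elim: n => // n IH.
have step i : (i < n)%N -> ip (gram_schmidt n) (gram_schmidt i) = 0.
  move=> i_n; rewrite gram_schmidtE (ipZl ipV) ipBl ip_suml (bigD1 (Ordinal i_n))//= big1 => [|j ji].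
    rewrite addr0 (ipZl ipV); have [->|->] := gram_schmidt_unit i.
      by rewrite ip0r mul0r subrr mulr0.
    by rewrite mulr1 subrr mulr0.
  by rewrite (ipZl ipV) IH ?mulr0.
move=> i j; rewrite !ltnS leq_eqVlt => /predU1P[->|i_n]; rewrite leq_eqVlt => /predU1P[->|j_n].
- by rewrite eqxx.
- by move=> _; exact: step.
- by move=> _; rewrite (ipC ipV); exact: step.
- exact: IH.
Qed.

(** The residual of [v m] after [m] steps is a multiple of [gram_schmidt m] and so
    is removed at the next step; later steps cannot lengthen it. *)
Lemma residual_gram_schmidt n m : (m < n)%N -> residual gram_schmidt n (v m) = 0.
Proof.
move=> mn; apply: rnorm_eq0; apply/eqP; rewrite -sqrf_eq0 eq_le sqr_ge0 andbT.
suff : rnorm (residual gram_schmidt m.+1 (v m)) ^+ 2 <= 0.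
  apply: le_trans; rewrite !sqr_rnorm_residual; try exact: gram_schmidt_orthonormal.
  rewrite lerB// -!(big_mkord xpredT (fun i => ip (v m) (gram_schmidt i) ^+ 2)).
  rewrite (big_cat_nat_idem _ _ mn)//=; last by rewrite addr0.
  by rewrite lerDl sumr_ge0// => i _; exact: sqr_ge0.
rewrite sqr_rnorm_residual; last exact: gram_schmidt_orthonormal.
rewrite big_ord_recr/= opprD addrA -sqr_rnorm_residual; last exact: gram_schmidt_orthonormal.
set r := residual _ _ _.
suff -> : ip (v m) (gram_schmidt m) = rnorm r by rewrite subrr.
transitivity (ip r (gram_schmidt m)).
  rewrite ipBl ip_suml big1 ?subr0// => i _.
  by rewrite (ipZl ipV) gram_schmidt_orthonormal.1 ?mulr0// ltn_eqF.
rewrite gram_schmidtE ipZr (ip_self ipV) -/r.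
have [->|r0] := eqVneq (rnorm r) 0; first by rewrite invr0 mul0r.
by rewrite expr2 mulKf.
Qed.

End GramSchmidt.

End InnerProduct.

(** * Bochner integrals, tested against vectors *)

Section IntegrableReal.
Context {R : realType} d (T : measurableType d) (mu : {measure set T -> \bar R}).
Context (D : set T) (mD : measurable D).
Implicit Types f g : T -> R.

Lemma integrable_EFinM (c : R) f : mu.-integrable D (EFin \o f) ->
  mu.-integrable D (EFin \o (fun x => c * f x)).
Proof.
by move=> /(integrableZl mD c); apply: eq_integrable => // x _; rewrite /= EFinM.
Qed.

Lemma integrable_EFinD f g : mu.-integrable D (EFin \o f) ->
  mu.-integrable D (EFin \o g) -> mu.-integrable D (EFin \o (fun x => f x + g x)).
Proof. by move=> fi gi; apply: eq_integrable (integrableD mD fi gi). Qed.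

Lemma integrable_EFinB f g : mu.-integrable D (EFin \o f) ->
  mu.-integrable D (EFin \o g) -> mu.-integrable D (EFin \o (fun x => f x - g x)).
Proof. by move=> fi gi; apply: eq_integrable (integrableB mD fi gi). Qed.

Lemma le_integrable_EFin f g : measurable_fun D f -> (forall x, D x -> `|f x| <= g x) ->
  mu.-integrable D (EFin \o g) -> mu.-integrable D (EFin \o f).
Proof.
move=> mf fg; apply: le_integrable => //; first exact/measurable_EFinP.
by move=> x Dx; rewrite /= lee_fin (le_trans (fg _ Dx))// ler_norm.
Qed.

End IntegrableReal.

Section SimpleFunctions.
Context {R : realType} (b : scalar_kind) (V : normedModType (scalar_field R b)).
Context d (T : measurableType d).

Lemma measurable_preimage_simple (phi : T -> V) (A : set V) :
  simple_function phi -> measurable (phi @^-1` A).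
Proof.
move=> [finphi mphi].
rewrite (_ : phi @^-1` A = \bigcup_(v in range phi `&` A) phi @^-1` [set v]).
  by apply: fin_bigcup_measurable => //; exact: finite_setIl.
apply/seteqP; split=> [x Ax|x [v [_ Av] /= ->//]].
by exists (phi x) => //; split => //; exists x.
Qed.

Lemma measurable_comp_simple (phi : T -> V) (g : V -> R) :
  simple_function phi -> measurable_fun setT (fun x => g (phi x)).
Proof.
move=> sphi _ Y mY; rewrite setTI -/(_ @^-1` _).
exact: (measurable_preimage_simple (g @^-1` Y)).
Qed.

Lemma simple_function_comp2 (phi psi : T -> V) (F : V -> V -> V) :
  simple_function phi -> simple_function psi ->
  simple_function (fun x => F (phi x) (psi x)).
Proof.
move=> sphi spsi; split.
  apply: (@sub_finite_set _ _ [set F v w | v in range phi & w in range psi]).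
    by move=> _ [x _ <-]; exists (phi x); [by exists x | exists (psi x) => //; exists x].
  by apply: finite_image2; [exact: sphi.1 | exact: spsi.1].
move=> u; rewrite (_ : _ @^-1` _ = \bigcup_(w in range psi)
    (psi @^-1` [set w] `&` phi @^-1` [set v | F v w = u])).
  apply: fin_bigcup_measurable => [|w _]; first exact: spsi.1.
  by apply: measurableI; [exact: spsi.2 | exact: measurable_preimage_simple].
apply/seteqP; split=> [x /= xu|x [w _ /= [<-]//]].
by exists (psi x) => //; exists x.
Qed.

Lemma strongly_measurable_simple (phi : T -> V) :
  simple_function phi -> strongly_measurable phi.
Proof. by move=> sphi; exists (fun=> phi); split => // x; exact: cvg_cst. Qed.

Lemma strongly_measurableB (f g : T -> V) : strongly_measurable f ->
  strongly_measurable g -> strongly_measurable (fun x => f x - g x).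
Proof.
move=> [phi [sphi phif]] [psi [spsi psig]].
exists (fun n x => phi n x - psi n x); split=> [n|x]; last exact: cvgB.
exact: (simple_function_comp2 (fun u v => u - v)).
Qed.

(** Lipschitz maps pass to the pointwise limit of simple functions; this yields
    measurability of norms and of inner products with a fixed vector. *)
Lemma measurable_comp_lipschitz (f : T -> V) (g : V -> R) (c : R) :
  (forall u v, `|g u - g v| <= c * rnorm (u - v)) ->
  strongly_measurable f -> measurable_fun setT (fun x => g (f x)).
Proof.
move=> glip [phi [sphi phif]].
apply: (@measurable_fun_cvg _ _ _ setT (fun n x => g (phi n x))).
  by move=> n; exact: measurable_comp_simple.
move=> x _; apply/cvgrPdist_le => eps eps0.
have /rnorm_cvgP/cvgr0Pnorm_lt : phi n x @[n --> \oo] --> f x by exact: phif.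
have c0 : 0 < `|c| + 1 by rewrite ltr_wpDl.
move=> /(_ _ (divr_gt0 eps0 c0)); apply: filterS => n.
rewrite ger0_norm ?rnorm_ge0// ltr_pdivlMr// mulrC => /ltW; apply: le_trans.
rewrite distrC (le_trans (glip _ _))// ler_wpM2r ?rnorm_ge0//.
by rewrite (le_trans (ler_norm _))// lerDl.
Qed.

Lemma measurable_rnormB (f : T -> V) (v : V) :
  strongly_measurable f -> measurable_fun setT (fun x => rnorm (f x - v)).
Proof.
apply: (@measurable_comp_lipschitz _ (fun u => rnorm (u - v)) 1) => u w.
by rewrite mul1r (le_trans (ler_dist_rnorm _ _))// opprB addrA subrK.
Qed.

Lemma measurable_rnorm (f : T -> V) :
  strongly_measurable f -> measurable_fun setT (fun x => rnorm (f x)).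
Proof.
by move=> /(measurable_rnormB 0); under eq_fun do rewrite subr0.
Qed.

End SimpleFunctions.

Section Bochner.
Context {R : realType} (b : scalar_kind).
Context (H : completeNormedModType (scalar_field R b)).
Context (ip : H -> H -> R) (ipH : real_inner_product ip).
Context d (T : measurableType d) (mu : {measure set T -> \bar R}).
Context (D : set T) (mD : measurable D) (muD : (mu D < +oo)%E).

Lemma measurable_ip (f : T -> H) (e : H) :
  strongly_measurable f -> measurable_fun setT (fun x => ip (f x) e).
Proof.
apply: (@measurable_comp_lipschitz _ _ _ _ _ _ (fun u => ip u e) (rnorm e)).
by move=> u v; rewrite -(ipBl ipH) mulrC cauchy_schwarz.
Qed.

Lemma comp_simpleE (phi : T -> H) (g : H -> R) x : simple_function phi ->
  g (phi x) = \sum_(v <- fset_set (range phi)) g v * \1_(phi @^-1` [set v]) x.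
Proof.
move=> [finphi _]; have rx : range phi (phi x) by exists x.
rewrite (bigD1_seq (phi x)) ?fset_uniq//=; last by rewrite in_fset_set// mem_set.
rewrite indicE mem_set// mulr1 big1 ?addr0// => v vx.
by rewrite indicE memNset ?mulr0// => /= xv; rewrite xv eqxx in vx.
Qed.

Lemma integrable_comp_simple (phi : T -> H) (g : H -> R) : simple_function phi ->
  mu.-integrable D (EFin \o (fun x => g (phi x))).
Proof.
move=> sphi.
apply: measurable_bounded_integrable => //.
  by apply: measurable_funTS; exact: measurable_comp_simple.
exists (\sum_(v <- fset_set (range phi)) `|g v|); split; first by rewrite realE sumr_ge0.
move=> y /ltW ly x _ /=; apply: le_trans ly.
have rx : range phi (phi x) by exists x.
rewrite (bigD1_seq (phi x)) ?fset_uniq//=; last by rewrite in_fset_set ?mem_set//; exact: sphi.1.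
by rewrite lerDl sumr_ge0.
Qed.

(** Simple integrals are only ever used through their inner products with fixed
    vectors, which are ordinary Lebesgue integrals. *)
Lemma ip_simple_integral (phi : T -> H) (e : H) : simple_function phi ->
  ip (simple_integral mu D phi) e = \int[mu]_(x in D) ip (phi x) e.
Proof.
move=> sphi; rewrite /simple_integral fsbig_finite/=; last exact: sphi.1.
rewrite (ip_suml ipH) /Rintegral.
under eq_integral => x _.
  rewrite (@comp_simpleE phi (fun u => ip u e) x sphi) -sumEFin.
  over.
have mphi v : measurable (phi @^-1` [set v]) by exact: sphi.2.
have iphi v : mu.-integrable D (EFin \o \1_(phi @^-1` [set v])).
  rewrite (_ : \1__ = (fun x => \1_[set v] (phi x))); last first.
    by apply/funext => x; rewrite !indicE.
  exact: integrable_comp_simple.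
rewrite (@integral_sum _ _ _ mu D mD _ (fun v x => (ip v e * \1_(phi @^-1` [set v]) x)%:E)); last first.
  by move=> v; exact: (integrable_EFinM mD (ip v e) (iphi v)).
under [in RHS]eq_bigr => v _.
  under eq_integral do rewrite EFinM.
  rewrite (integralZl mD (iphi v)) integral_indic//.
  rewrite setIC -[mu _]fineK; last first.
    by rewrite ge0_fin_numE// (le_lt_trans _ muD)// measureIl.
  over.
rewrite sumEFin /=; apply: eq_bigr => v _; by rewrite (ipZl ipH) mulrC.
Qed.

Lemma ip_bochner_integral (f : T -> H) (v e : H) : strongly_measurable f ->
  mu.-integrable D (EFin \o (fun x => rnorm (f x))) ->
  is_bochner_integral mu D f v -> ip v e = \int[mu]_(x in D) ip (f x) e.
Proof.
move=> mf intf [phi [iphi phif L1phi phiv]].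
have sphi n : simple_function (phi n) := (iphi n).1.
have ipf : mu.-integrable D (EFin \o (fun x => ip (f x) e)).
  apply: (@le_integrable _ _ _ mu D mD _ (fun x => (rnorm e)%:E * (rnorm (f x))%:E)%E).
  - by apply/measurable_EFinP/measurable_funTS; exact: measurable_ip.
  - move=> x Dx; rewrite /= lee_fin (@ger0_norm _ (_ * _)) ?mulr_ge0 ?rnorm_ge0// mulrC.
    exact: cauchy_schwarz.
  - exact: integrableZl.
apply/eqP; rewrite -subr_eq0 -normr_le0; apply/ler_addgt0Pl => eps eps0.
rewrite addr0.
have c0 : 0 < rnorm e + 1 by rewrite ltr_wpDl ?rnorm_ge0.
have [n [h1 h2]] : exists n, rnorm (v - simple_integral mu D (phi n)) < eps / 2 / (rnorm e + 1) /\
   (\int[mu]_(x in D) (rnorm (f x - phi n x))%:E < (eps / 2 / (rnorm e + 1))%:E)%E.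
  have e0 : 0 < eps / 2 / (rnorm e + 1) by rewrite !divr_gt0.
  have /rnorm_cvgP/cvgr0Pnorm_lt/(_ _ e0) A := phiv.
  have B : \forall n \near \oo, (\int[mu]_(x in D) (rnorm (f x - phi n x))%:E < (eps / 2 / (rnorm e + 1))%:E)%E.
    have := L1phi; move/fine_cvgP => [finI] /cvgr0Pnorm_lt/(_ _ e0).
    move: finI; apply: filterS2 => n fn /=.
    rewrite ger0_norm; last by rewrite fine_ge0// integral_ge0// => x _; rewrite lee_fin rnorm_ge0.
    by rewrite -lte_fin fineK.
  have [n _ /(_ n (leqnn n)) [? ?]] := filterI A B.
  exists n; split => //.
  rewrite -(rnormN (v - _)) opprB.
  by rewrite -[ltLHS]ger0_norm ?rnorm_ge0.
have -> : ip v e - \int[mu]_(x in D) ip (f x) e =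
   ip (v - simple_integral mu D (phi n)) e - \int[mu]_(x in D) (ip (f x) e - ip (phi n x) e).
  rewrite RintegralB//; last by exact: (integrable_comp_simple (fun u => ip u e) (sphi n)).
  rewrite (ipBl ipH) ip_simple_integral//; ring.
have idiff : mu.-integrable D (EFin \o (fun x => rnorm (f x - phi n x))).
  apply: (@le_integrable _ _ _ mu D mD _ (fun x => (rnorm (f x))%:E + (rnorm (phi n x))%:E)%E).
  - apply/measurable_EFinP/measurable_funTS.
    apply: measurable_rnorm; apply: strongly_measurableB => //.
    exact: strongly_measurable_simple.
  - move=> x Dx; rewrite /= lee_fin !ger0_norm ?addr_ge0 ?rnorm_ge0//.
    exact: ler_rnormB.
  - apply: integrableD => //; exact: (integrable_comp_simple (@rnorm _ _ _) (sphi n)).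
rewrite (le_trans (ler_normB _ _))// [eps]splitr lerD//.
  rewrite (le_trans (cauchy_schwarz ipH _ _))//.
  rewrite (@le_trans _ _ (rnorm (v - simple_integral mu D (phi n)) * (rnorm e + 1)))//.
    by rewrite ler_wpM2l ?rnorm_ge0// lerDl.
  by rewrite -ler_pdivlMr// ltW.
have ipdiff : mu.-integrable D (EFin \o (fun x => ip (f x) e - ip (phi n x) e)).
  have := integrableB mD ipf (integrable_comp_simple (fun u => ip u e) (sphi n)).
  by apply: eq_integrable.
rewrite (le_trans (le_normr_Rintegral _ _))//.
rewrite (@le_trans _ _ (\int[mu]_(x in D) (rnorm e * rnorm (f x - phi n x))))//.
  apply: le_Rintegral => //.
  - by apply: eq_integrable (integrable_norm ipdiff).
  - exact: (integrable_EFinM mD).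
  - by move=> x _; rewrite -(ipBl ipH) mulrC cauchy_schwarz.
rewrite RintegralZl// (@le_trans _ _ ((rnorm e + 1) * \int[mu]_(x in D) rnorm (f x - phi n x)))//.
  by rewrite ler_wpM2r ?lerDl// Rintegral_ge0// => x _; exact: rnorm_ge0.
rewrite mulrC -ler_pdivlMr// -lee_fin /Rintegral fineK ?(ltW h2)//.
exact: integrable_fin_num.
Qed.

(** Testing the difference [u] of the two integrals against itself bounds
    [rnorm u ^+ 2] by the integral of [ip (phi x - psi x) u], hence by [rnorm u]
    times the L1 distance of [phi] and [psi]. *)
Lemma rnorm_simple_integralB (f phi psi : T -> H) :
  simple_function phi -> simple_function psi -> strongly_measurable f ->
  mu.-integrable D (EFin \o (fun x => rnorm (f x - phi x))) ->
  mu.-integrable D (EFin \o (fun x => rnorm (f x - psi x))) ->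
  rnorm (simple_integral mu D phi - simple_integral mu D psi) <=
  \int[mu]_(x in D) rnorm (f x - phi x) + \int[mu]_(x in D) rnorm (f x - psi x).
Proof.
move=> sphi spsi mf iphi ipsi; set u := _ - _.
have [/eqP|u0] := eqVneq (rnorm u) 0.
  by move=> /eqP ->; rewrite addr_ge0// Rintegral_ge0// => x _; exact: rnorm_ge0.
have {}u0 : 0 < rnorm u by rewrite lt_neqAle eq_sym u0 rnorm_ge0.
rewrite -(ler_pM2r u0) -expr2 -(ip_self ipH) {1}/u (ipBl ipH) !ip_simple_integral//.
have ip1 := integrable_comp_simple (fun v => ip v u) sphi.
have ip2 := integrable_comp_simple (fun v => ip v u) spsi.
have i12 := integrable_EFinD mD iphi ipsi.
rewrite -RintegralB// -RintegralD// mulrC -RintegralZl//.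
apply: le_Rintegral => //.
- exact: integrable_EFinB.
- exact: integrable_EFinM.
- move=> x _; rewrite -(ipBl ipH) (le_trans (ler_norm _))// (le_trans (cauchy_schwarz ipH _ _))// mulrC.
  rewrite ler_wpM2l ?rnorm_ge0// (_ : phi x - psi x = (f x - psi x) - (f x - phi x)).
    by rewrite (le_trans (ler_rnormB _ _))// addrC.
  by rewrite opprB [f x - psi x]addrC addrACA subrr addr0 addrC.
Qed.

(** Truncating the approximating simple functions to norm at most
    [rnorm (f x) + 1] makes them dominated, hence convergent in L1; their
    integrals are then Cauchy. *)
Lemma bochner_integral_exists (f : T -> H) : strongly_measurable f ->
  mu.-integrable D (EFin \o (fun x => rnorm (f x))) ->
  exists v, is_bochner_integral mu D f v.
Proof.
move=> mf intf; have [phi [sphi phif]] := mf.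
pose psi n x := if rnorm (phi n x) <= rnorm (f x) + 1 then phi n x else 0.
have spsi n : simple_function (psi n).
  split.
    apply: (@sub_finite_set _ _ (range (phi n) `|` [set 0])).
      move=> _ [x _ <-]; rewrite /psi; case: ifP => _; [by left; exists x|by right].
    by rewrite finite_setU; split; [exact: (sphi n).1|exact: finite_set1].
  pose S := [set x | rnorm (phi n x) <= rnorm (f x) + 1].
  have mS : measurable S.
    rewrite -[S]setTI; apply: measurable_fun_le => //.
      exact: measurable_comp_simple.
    by apply: measurable_funD => //; exact: measurable_rnorm.
  move=> v; rewrite (_ : _ @^-1` _ = (S `&` phi n @^-1` [set v]) `|` (~` S `&` [set x | 0 = v])).
    apply: measurableU; apply: measurableI => //; first exact: (sphi n).2.
      exact: measurableC.
    have [->|v0] := eqVneq v 0; first by rewrite (_ : [set _ | _] = setT)//; apply/seteqP; split.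
    rewrite (_ : [set _ | _] = set0)//; apply/seteqP; split => // x /= /esym/eqP.
    by rewrite (negbTE v0).
  apply/seteqP; split => x; rewrite /psi /S /=.
    by case: ifPn => [? ?|/negP ? ?]; [left|right].
  by case: ifPn => [? [[]//|[]//]|/negP ? [[]//|[]//]].
have psif x : psi n x @[n --> \oo] --> f x.
  apply/rnorm_cvgP/cvgr0Pnorm_lt => eps eps0.
  have /rnorm_cvgP/cvgr0Pnorm_lt A := phif x.
  have m0 : 0 < Num.min eps 1 by rewrite lt_min eps0 ltr01.
  have := A _ m0; apply: filterS => n; rewrite !ger0_norm ?rnorm_ge0// lt_min /psi => /andP[h1 h2].
  have -> // : rnorm (phi n x) <= rnorm (f x) + 1.
  rewrite -lerBlDl (le_trans _ (ltW h2))// (le_trans (ler_norm _))//.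
  exact: ler_dist_rnorm.
have ipsi n : mu.-integrable D (EFin \o (fun x => rnorm (f x - psi n x))).
  apply: (@le_integrable _ _ _ mu D mD _ (fun x => (rnorm (f x))%:E + (rnorm (psi n x))%:E)%E).
  - apply/measurable_EFinP/measurable_funTS.
    apply: measurable_rnorm; apply: strongly_measurableB => //.
    exact: strongly_measurable_simple.
  - move=> x Dx; rewrite /= lee_fin !ger0_norm ?addr_ge0 ?rnorm_ge0//.
    exact: ler_rnormB.
  - apply: integrableD => //; exact: (integrable_comp_simple (@rnorm _ _ _) (spsi n)).
have L1 : (\int[mu]_(x in D) (rnorm (f x - psi n x))%:E)%E @[n --> \oo] --> 0%E.
  have i1 : mu.-integrable D (EFin \o (cst 1)).
    apply: measurable_bounded_integrable => //; exists 1; split => // y /ltW y1 x _.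
    by rewrite /= normr1.
  have [] := @dominated_convergence _ _ _ mu D mD (fun n x => (rnorm (f x - psi n x))%:E)
      (cst 0%E) (fun x => 2%:E * (rnorm (f x))%:E + 1)%E.
  - by move=> n; have /integrableP[] := ipsi n.
  - exact: measurable_cst.
  - apply: aeW => x _; apply/fine_cvgP; split; first exact: nearW.
    have /rnorm_cvgP := psif x; apply: cvg_trans; apply: near_eq_cvg.
    by apply: nearW => n /=; rewrite -rnormN opprB.
  - by apply: integrableD => //; exact: integrableZl.
  - apply: aeW => x n Dx; rewrite /= lee_fin ger0_norm ?rnorm_ge0//.
    rewrite (le_trans (ler_rnormB _ _))//.
    suff : rnorm (psi n x) <= rnorm (f x) + 1 by lra.
    by rewrite /psi; case: ifP => // _; rewrite rnorm0 addr_ge0// rnorm_ge0.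
  move=> _ _; rewrite integral0; exact.
have cauchy : cauchy_ex (simple_integral mu D (psi n) @[n --> \oo]).
  move=> eps eps0.
  have epsE : of_real b (to_real eps) = eps by apply/to_realK/ltW.
  have te0 := to_real_gt0 eps0.
  have /fine_cvgP[_ /cvgr0Pnorm_lt/(_ _ (divr_gt0 te0 (ltr0n _ 2)))[N _ hN]] := L1.
  exists (simple_integral mu D (psi N)); exists N => // n Nn /=.
  have I0 k : 0 <= \int[mu]_(x in D) rnorm (f x - psi k x).
    by rewrite Rintegral_ge0// => x _; exact: rnorm_ge0.
  have h1 := hN _ Nn; have h2 := hN N (leqnn N).
  rewrite /= ger0_norm ?I0// in h1; rewrite /= ger0_norm ?I0// in h2.
  rewrite -ball_normE/= -of_real_rnorm -epsE ltr_of_real//.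
  rewrite (le_lt_trans (rnorm_simple_integralB (spsi N) (spsi n) mf (ipsi N) (ipsi n)))//.
  by rewrite [ltRHS]splitr ltrD.
exists (lim (simple_integral mu D (psi n) @[n --> \oo])); exists psi; split => //.
  move=> n; split => // v _; rewrite (le_lt_trans _ muD)// measureIl//.
  exact: (spsi n).2.
apply/cauchy_cvgP; exact: cauchy_exP.
Qed.

End Bochner.

(** * Campbell's formula *)

Section MetricMeasurability.
Context {R : realType} (M : completeMetricType R).
Implicit Types (z o : M) (r : R).

Lemma mball_open z r : open (mball z r).
Proof.
rewrite openE => x /= xz; apply/nbhs_ballP; exists (r - mdist x z).
  by rewrite /= subr_gt0.
move=> y; rewrite ballEmdist /= => xy; rewrite /mball /=.
have := metric_triangle y x z; rewrite (metric_sym y x); lra.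
Qed.

Lemma measurable_mball z r : measurable (mball z r : set (borel M)).
Proof. by apply: sub_sigma_algebra; exact: mball_open. Qed.

Lemma measurable_mdist z : measurable_fun setT (fun x : borel M => mdist (x : M) z).
Proof.
move=> mT; apply: (measurability _ (RGenInftyO.measurableE R)) => //.
move=> _ [_ [r ->] <-]; rewrite setTI.
rewrite (_ : _ @^-1` _ = mball z r); first exact: measurable_mball.
by apply/seteqP; split => x /=; rewrite in_itv.
Qed.

Lemma measurable_closed_mball z r :
  measurable ([set x | mdist x z <= r] : set (borel M)).
Proof.
rewrite (_ : [set _ | _] = (fun x : borel M => mdist (x : M) z) @^-1` `]-oo, r]).
  by rewrite -[X in measurable X]setTI; apply: measurable_mdist.
by apply/seteqP; split => x /=; rewrite in_itv.
Qed.

Lemma measurable_shell z k : measurable (shell z k : set (borel M)).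
Proof.
rewrite (_ : shell z k = mball z k.+1%:R `\` mball z k%:R).
  by apply: measurableD; exact: measurable_mball.
apply/seteqP; split => x; rewrite /shell /mball /=.
  by move=> /andP[h1 h2]; split => //; apply/negP; rewrite -leNgt.
by move=> [h1 /negP]; rewrite -leNgt => h2; apply/andP.
Qed.

Lemma relatively_compact_mball z r : proper_metric M -> relatively_compact (mball z r).
Proof.
move=> pM; apply: (@subclosed_compact _ (closure (mball z r)) [set x | mdist x z <= r]).
- exact: closed_closure.
- exact: pM.
- rewrite [X in _ `<=` X](closure_id _).1; last by apply: compact_closed; [exact: metric_hausdorff|exact: pM].
  by apply: closureS => x /ltW.
Qed.

Lemma relatively_compactS (A B : set M) : A `<=` B -> relatively_compact B ->
  relatively_compact A.
Proof.
move=> AB cB; apply: subclosed_compact (closureS AB) => //; exact: closed_closure.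
Qed.

Lemma bounded_configuration (X : configuration M) z r : proper_metric M ->
  finite_set (mball z r `&` [set x | X x != 0%N]).
Proof. by move=> pM; apply: locally_finite_mult; exact: relatively_compact_mball. Qed.

End MetricMeasurability.

Section MonotoneEsum.
Context {R : realType} (T : choiceType).
Local Open Scope ereal_scope.

(** Every finite partial sum passes to the limit, so monotone convergence holds
    for sums over arbitrary index sets. *)
Lemma cvg_esum_nondecreasing (I : set T) (a : nat -> T -> \bar R) (b : T -> \bar R) :
  (forall n x, 0 <= a n x) ->
  (forall x, {homo a ^~ x : m n / (m <= n)%N >-> m <= n}) ->
  (forall x, a n x @[n --> \oo] --> b x) ->
  \esum_(x in I) a n x @[n --> \oo] --> \esum_(x in I) b x.
Proof.
move=> a0 nda ab.
have nds : {homo (fun n => \esum_(x in I) a n x) : m n / (m <= n)%N >-> m <= n}.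
  by move=> m n mn; apply: le_esum => x _; exact: nda.
have csum := ereal_nondecreasing_is_cvgn nds.
suff -> : \esum_(x in I) b x = limn (fun n => \esum_(x in I) a n x) by [].
have aleb n x : a n x <= b x.
  rewrite (cvg_unique _ (ab x) (ereal_nondecreasing_cvgn (nda x)))//.
  by apply: ereal_sup_ubound; exists n.
apply/eqP; rewrite eq_le; apply/andP; split; last first.
  apply: lime_le => //; apply: nearW => n; apply: le_esum => x _; exact: aleb.
apply: ge_ereal_sup => _ [F [finF FI] <-].
rewrite fsbig_finite//=.
have cF : (\sum_(x <- fset_set F) a n x) @[n --> \oo] --> \sum_(x <- fset_set F) b x.
  by apply: cvg_nnesum => x _; [exact: nearW | exact: ab].
rewrite -(cvg_lim _ cF)//; apply: lee_lim => //.
  by apply/cvg_ex; eexists; exact: cF.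
apply: nearW => n; apply: esum_ge; exists F; first by split.
by rewrite fsbig_finite.
Qed.

Lemma ge0_esumZl (I : set T) (c : R) (a : T -> \bar R) : (0 <= c)%R ->
  (forall x, 0 <= a x) ->
  \esum_(x in I) (c%:E * a x) = c%:E * \esum_(x in I) a x.
Proof.
have le (k : R) u : (0 <= k)%R -> (forall x, 0 <= u x) ->
    \esum_(x in I) (k%:E * u x) <= k%:E * \esum_(x in I) u x.
  move=> k0 u0; apply: ge_ereal_sup => _ [F [finF FI] <-].
  rewrite fsbig_finite//= -ge0_sume_distrr//.
  apply: lee_wpmul2l; first by rewrite lee_fin.
  apply: esum_ge; exists F; first by split.
  by rewrite fsbig_finite.
move=> c0 a0; apply/eqP; rewrite eq_le le//=.
have [->|cn0] := eqVneq c 0%R.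
  by rewrite mul0e esum_ge0// => x _; rewrite mul0e.
have {cn0}c0 : (0 < c)%R by rewrite lt_neqAle eq_sym cn0.
rewrite muleC -lee_pdivlMr// muleC.
rewrite (le_trans _ (le _ _ _ _))//.
- apply: le_esum => x _.
  by rewrite muleA -EFinM mulVf ?mul1e// gt_eqF.
- by rewrite invr_ge0 ltW.
- by move=> x; apply: mule_ge0 => //; rewrite lee_fin ltW.
Qed.

End MonotoneEsum.

Definition linear_statistic {R : realType} {M : completeMetricType R}
    (g : M -> R) (X : configuration M) : \bar R :=
  \esum_(x in [set: M]) ((X x)%:R * g x)%:E.

Section LinearStatistic.
Context {R : realType} (M : completeMetricType R).
Implicit Types (f g : M -> R) (X : configuration M).
Local Open Scope ereal_scope.

Lemma linear_statistic_ge0 g X : (forall x, 0 <= g x)%R -> 0 <= linear_statistic g X.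
Proof. by move=> g0; apply: esum_ge0 => x _; rewrite lee_fin mulr_ge0. Qed.

Lemma le_linear_statistic f g X : (forall x, f x <= g x)%R ->
  linear_statistic f X <= linear_statistic g X.
Proof. by move=> fg; apply: le_esum => x _; rewrite lee_fin ler_wpM2l. Qed.

Lemma linear_statisticD f g X : (forall x, 0 <= f x)%R -> (forall x, 0 <= g x)%R ->
  linear_statistic (fun x => f x + g x)%R X = linear_statistic f X + linear_statistic g X.
Proof.
move=> f0 g0; rewrite /linear_statistic -esumD; last 2 first.
- by move=> x _; rewrite lee_fin mulr_ge0.
- by move=> x _; rewrite lee_fin mulr_ge0.
by apply: eq_esum => x _; rewrite mulrDr.
Qed.

Lemma linear_statisticZ c g X : (0 <= c)%R -> (forall x, 0 <= g x)%R ->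
  linear_statistic (fun x => c * g x)%R X = c%:E * linear_statistic g X.
Proof.
move=> c0 g0; rewrite /linear_statistic -ge0_esumZl//; last first.
  by move=> x; rewrite lee_fin mulr_ge0.
by apply: eq_esum => x _; rewrite -EFinM mulrCA.
Qed.

Lemma linear_statistic0 X : linear_statistic (fun=> 0%R) X = 0.
Proof. by apply: esum1 => x _; rewrite mulr0. Qed.

Lemma linear_statistic_indic (B : set M) X : linear_statistic (\1_B) X = npoints B X.
Proof.
rewrite /npoints esum_mkcond; apply: eq_esum => x _.
by rewrite indicE; case: (x \in B); rewrite ?mulr1 ?mulr0.
Qed.

Lemma cvg_linear_statistic (g_ : nat -> M -> R) g X :
  (forall n x, 0 <= g_ n x)%R ->
  (forall x, {homo g_ ^~ x : m n / (m <= n)%N >-> (m <= n)%R}) ->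
  (forall x, g_ n x @[n --> \oo] --> g x) ->
  linear_statistic (g_ n) X @[n --> \oo] --> linear_statistic g X.
Proof.
move=> g0 ndg gg; apply: cvg_esum_nondecreasing.
- by move=> n x; rewrite lee_fin mulr_ge0.
- by move=> x m n mn; rewrite lee_fin ler_wpM2l// ndg.
- by move=> x; apply: cvg_EFin; [exact: nearW|apply: cvgMr; exact: gg].
Qed.

(** On a bounded window the count is a natural number, so its level sets are the
    generators of the sigma-algebra. *)
Lemma measurable_npoints_bounded (B : set (borel M)) : measurable B ->
  relatively_compact (B : set M) ->
  measurable_fun setT (fun X : conf M => npoints B X).
Proof.
move=> mB cB.
have npE (X : configuration M) : exists n : nat, npoints B X = n%:R%:E.
  have fin := locally_finite_mult X cB.
  exists (\sum_(x <- fset_set (B `&` [set x | X x != 0%N])) X x)%N.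
  transitivity (\esum_(x in B `&` [set x | X x != 0%N]) ((X x)%:R : R)%:E).
    rewrite esum_mkcondr; apply: eq_esum => x Bx.
    case: ifPn => //; rewrite notin_setE /= => /negP; rewrite negbK => /eqP ->//.
  rewrite esum_fset//.
  by rewrite fsbig_finite//= sumEFin natr_sum.
move=> _ Y mY; rewrite setTI.
rewrite (_ : _ @^-1` _ = \bigcup_(n in [set n : nat | Y (n%:R)%:E])
    [set X | npoints B X = (n%:R)%:E]).
  apply: bigcup_measurable => n _; apply: sub_sigma_algebra.
  by exists B, n.
apply/seteqP; split => X /=; last by move=> [n /= Yn ->].
by have [n E] := npE X; rewrite E => Yn; exists n.
Qed.

Lemma measurable_npoints (B : set (borel M)) : proper_metric M -> measurable B ->
  measurable_fun setT (fun X : conf M => npoints B X).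
Proof.
move=> pM mB; pose o : M := point.
pose Bn n := B `&` mball o n%:R.
apply: (@emeasurable_fun_cvg _ _ _ setT (fun n (X : conf M) => npoints (Bn n) X)).
  move=> n; apply: measurable_npoints_bounded.
    by apply: measurableI => //; exact: measurable_mball.
  by apply: relatively_compactS (@relatively_compact_mball _ _ o n%:R pM) => x [].
move=> X _.
have h n : npoints (Bn n) X = linear_statistic (\1_(Bn n)) X by rewrite linear_statistic_indic.
under eq_cvg do rewrite h.
rewrite -(linear_statistic_indic B); apply: cvg_linear_statistic => //.
- move=> x m n mn; rewrite !indicE ler_nat.
  case: (boolP (x \in Bn m)) => // /set_mem[Bx xm].
  rewrite mem_set//; split => //; apply: lt_le_trans xm _; by rewrite ler_nat.
- move=> x; apply: cvg_near_cst.
  have [N Nx] : exists N : nat, (mdist x o < N%:R)%R.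
    by exists (Num.bound (mdist x o)); exact/archi_boundP/mdist_ge0.
  exists N => // n /= Nn; rewrite /Bn !indicE in_setI andb_idr// => _.
  by rewrite mem_set// /mball /= (lt_le_trans Nx)// ler_nat.
Qed.

End LinearStatistic.

Definition has_intensity {R : realType} {M : completeMetricType R}
    (Pi : probability (conf M) R) (mu : {measure set (borel M) -> \bar R}) : Prop :=
  forall B : set (borel M), measurable B -> first_intensity Pi B = mu B.

Section Campbell.
Context {R : realType} (M : completeMetricType R).
Context (mu : {measure set (borel M) -> \bar R}) (Pi : probability (conf M) R).
Context (pM : proper_metric M) (intensity : has_intensity Pi mu).
Local Open Scope ereal_scope.

Let campbell_for (g : M -> R) : Prop :=
  measurable_fun setT (fun X : conf M => linear_statistic g X) /\
  \int[Pi]_X linear_statistic g X = \int[mu]_x (g x)%:E.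

Lemma campbell_indic (B : set (borel M)) : measurable B -> campbell_for (\1_B).
Proof.
move=> mB; split.
  by under eq_fun do rewrite linear_statistic_indic; exact: measurable_npoints.
under eq_integral do rewrite linear_statistic_indic.
by rewrite integral_indic// setIT -intensity.
Qed.

Lemma campbell_sum (I : eqType) (s : seq I) (g : I -> borel M -> R) :
  (forall i, measurable_fun setT (g i)) ->
  (forall i x, 0 <= g i x)%R -> {in s, forall i, campbell_for (g i)} ->
  campbell_for (fun x => \sum_(i <- s) g i x)%R.
Proof.
move=> mg g0; elim: s => [|i s IH] gs.
  split.
    under eq_fun do under [X in linear_statistic X _]eq_fun do rewrite big_nil.
    by under eq_fun do rewrite linear_statistic0; exact: measurable_cst.
  under eq_integral do under [X in linear_statistic X _]eq_fun do rewrite big_nil.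
  under eq_integral do rewrite linear_statistic0.
  rewrite integral0; under eq_integral do rewrite big_nil; by rewrite integral0.
have {}IH := IH (fun j js => gs j (@mem_behead _ (i :: s) j js)).
have {}gs := gs i (mem_head _ _).
have g0s x : (0 <= \sum_(i <- s) g i x)%R by exact: sumr_ge0.
have E X : linear_statistic (fun x => \sum_(i <- i :: s) g i x)%R X =
    linear_statistic (g i) X + linear_statistic (fun x => \sum_(i <- s) g i x)%R X.
  rewrite -linear_statisticD//; apply: eq_esum => x _.
  by rewrite big_cons.
split.
  by under eq_fun do rewrite E; apply: emeasurable_funD; [exact: gs.1|exact: IH.1].
under eq_integral do rewrite E.
rewrite ge0_integralD//; last 4 first.
- by move=> *; exact: linear_statistic_ge0.
- exact: gs.1.
- by move=> *; exact: linear_statistic_ge0.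
- exact: IH.1.
under [in RHS]eq_integral do rewrite big_cons EFinD.
rewrite ge0_integralD//; last 4 first.
- by move=> *; rewrite lee_fin.
- exact/measurable_EFinP.
- by move=> *; rewrite lee_fin.
- by apply/measurable_EFinP; exact: measurable_sum.
by rewrite gs.2 IH.2.
Qed.

Lemma campbellZ (c : R) (g : borel M -> R) : (0 <= c)%R -> measurable_fun setT g ->
  (forall x, 0 <= g x)%R -> campbell_for g -> campbell_for (fun x => c * g x)%R.
Proof.
move=> c0 mg g0 cg; split.
  under eq_fun do rewrite linear_statisticZ//.
  by apply: measurable_funeM; exact: cg.1.
under eq_integral do rewrite linear_statisticZ//.
rewrite ge0_integralZl ?lee_fin//; last 2 first.
- exact: cg.1.
- by move=> *; exact: linear_statistic_ge0.
under [in RHS]eq_integral do rewrite EFinM.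
rewrite ge0_integralZl ?lee_fin//; last 2 first.
- exact/measurable_EFinP.
- by move=> *; rewrite lee_fin.
by rewrite cg.2.
Qed.

Lemma campbell_nnsfun (phi : {nnsfun (borel M) >-> R}) : campbell_for phi.
Proof.
have -> : (phi : borel M -> R) = (fun x => \sum_(y <- fset_set (range phi)) (y * \1_(phi @^-1` [set y]) x))%R.
  by apply/funext => x; rewrite fimfunE fsbig_finite.
(* [campbell_sum] wants nonnegative summands for every index, so the values [y]
   of [phi], which are nonnegative, are replaced by [Num.max y 0] *)
have ge0 y : y \in fset_set (range phi) -> (0 <= y)%R.
  by rewrite in_fset_set// => /set_mem[x _ <-]; exact: fun_ge0.
have nE x y : y \in fset_set (range phi) ->
  (y * \1_(phi @^-1` [set y]) x = Num.max y 0 * \1_(phi @^-1` [set y]) x)%R.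
  by move=> /ge0 y0; rewrite (max_idPl y0).
under eq_fun do rewrite (eq_big_seq _ (nE _)).
apply: campbell_sum => [y|y x|y _].
- by apply: measurable_funM => //; exact: measurable_indic.
- by rewrite mulr_ge0// le_max lexx orbT.
- apply: campbellZ => //.
  + by rewrite le_max lexx orbT.
  + by apply: campbell_indic; exact: measurable_sfunP.
Qed.

(** The formula holds for indicators by definition of the intensity, then for
    simple functions by linearity and in general by monotone convergence on both
    sides. *)
Lemma campbell (g : borel M -> R) : measurable_fun setT g -> (forall x, 0 <= g x)%R ->
  measurable_fun setT (fun X : conf M => linear_statistic g X) /\
  \int[Pi]_X linear_statistic g X = \int[mu]_x (g x)%:E.
Proof.
move=> mg g0; have mg' : measurable_fun setT (EFin \o g) by exact/measurable_EFinP.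
pose phi := nnsfun_approx measurableT mg'.
have ndphi x : {homo (phi ^~ x : nat -> R) : m n / (m <= n)%N >-> (m <= n)%R}.
  by move=> m n mn; have /lefP := nd_nnsfun_approx measurableT mg' mn; apply.
have phig x : phi n x @[n --> \oo] --> g x.
  have : (EFin \o phi ^~ x) @ \oo --> (EFin \o g) x.
    by apply: cvg_nnsfun_approx => // y _; rewrite lee_fin.
  by move=> /fine_cvgP[].
have phi0 n x : (0 <= phi n x)%R by exact: fun_ge0.
have cS X : linear_statistic (phi n) X @[n --> \oo] --> linear_statistic g X.
  exact: cvg_linear_statistic.
have mS n := (campbell_nnsfun (phi n)).1.
split.
  by apply: (emeasurable_fun_cvg (fun n (X : conf M) => linear_statistic (phi n) X)).
have c1 : \int[Pi]_X linear_statistic (phi n) X @[n --> \oo] --> \int[Pi]_X linear_statistic g X.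
  under [X in _ --> X]eq_integral do rewrite -(cvg_lim _ (cS _))//.
  apply: cvg_monotone_convergence => //.
  - by move=> n X _; exact: linear_statistic_ge0.
  - by move=> X _ m n mn; apply: le_linear_statistic => x; exact: ndphi.
have c2 : \int[mu]_x (phi n x)%:E @[n --> \oo] --> \int[mu]_x (g x)%:E.
  have E x : (g x)%:E = limn (fun n => (phi n x)%:E).
    by apply/esym/cvg_lim => //; apply: cvg_EFin; [exact: nearW|exact: phig].
  under [X in _ --> X]eq_integral do rewrite E.
  apply: cvg_monotone_convergence => //.
  - by move=> n; apply/measurable_EFinP.
  - by move=> n x _; rewrite lee_fin.
  - by move=> x _ m n mn; rewrite lee_fin ndphi.
have E : (fun n => \int[Pi]_X linear_statistic (phi n) X) = (fun n => \int[mu]_x (phi n x)%:E).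
  by apply/funext => n; rewrite (campbell_nnsfun (phi n)).2.
by rewrite E in c1; apply: cvg_unique c1 c2.
Qed.

End Campbell.

(** * Variance of real linear statistics *)

Section IntegralFine.
Context {R : realType} d (T : measurableType d) (mu : {measure set T -> \bar R}).
Local Open Scope ereal_scope.

Lemma integral_fine (F : T -> \bar R) : measurable_fun setT F ->
  (forall x, 0 <= F x) -> \int[mu]_x F x < +oo ->
  mu.-integrable setT (EFin \o (fun x => fine (F x))) /\
  \int[mu]_x (fine (F x))%:E = \int[mu]_x F x.
Proof.
move=> mF F0 Foo.
have iF : mu.-integrable setT F.
  apply/integrableP; split => //.
  by under eq_integral do rewrite gee0_abs//.
have mfF : measurable_fun setT (fun x => fine (F x)).
  exact: (measurableT_comp (@fine_measurable R setT measurableT) mF).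
have E : \int[mu]_x (fine (F x))%:E = \int[mu]_x F x.
  apply: ge0_ae_eq_integral => //.
  - exact/measurable_EFinP.
  - by move=> x _; rewrite lee_fin fine_ge0.
  - have := integrable_ae measurableT iF; apply: filterS => x /(_ I) Fx _.
    by rewrite fineK.
split => //; apply/integrableP; split; first exact/measurable_EFinP.
under eq_integral do rewrite gee0_abs ?lee_fin ?fine_ge0//.
by rewrite E.
Qed.

End IntegralFine.

Definition linear_variance_bound {R : realType} {M : completeMetricType R}
    (Pi : probability (conf M) R) (mu : {measure set (borel M) -> \bar R}) (C : R) : Prop :=
  forall g : borel M -> R, measurable_fun setT g -> mu.-integrable setT (EFin \o g) ->
    (\int[mu]_x (g x ^+ 2)%:E < +oo)%E ->
    (\int[Pi]_X ((rsum g X - \int[mu]_x g x) ^+ 2)%:E <= C%:E * \int[mu]_x (g x ^+ 2)%:E)%E.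

Section SmallVariance.
Context {R : realType} (M : completeMetricType R).
Context (mu : {measure set (borel M) -> \bar R}) (Pi : probability (conf M) R).
Context (pM : proper_metric M) (intensity : has_intensity Pi mu).
Implicit Type g : borel M -> R.
Local Open Scope ereal_scope.

(** [rsum] is the difference of two finite parts of nonnegative statistics, so
    Campbell's formula applies to the positive and negative parts of [g]; both
    statistics are almost surely finite. *)
Lemma integral_rsum g : measurable_fun setT g -> mu.-integrable setT (EFin \o g) ->
  [/\ measurable_fun setT (fun X : conf M => rsum g X),
      Pi.-integrable setT (fun X => (rsum g X)%:E)
    & \int[Pi]_X (rsum g X)%:E = (\int[mu]_x g x)%:E].
Proof.
move=> mg ig.
have ip := integrable_funrpos measurableT ig.
have im := integrable_funrneg measurableT ig.
have main u : (forall x, 0 <= u x)%R -> mu.-integrable setT (EFin \o u) ->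
  [/\ measurable_fun setT (fun X : conf M => linear_statistic u X),
      Pi.-integrable setT (EFin \o (fun X => fine (linear_statistic u X)))
    & \int[Pi]_X (fine (linear_statistic u X))%:E = (\int[mu]_x u x)%:E].
  move=> u0 iu; have /measurable_EFinP mu_ := measurable_int _ iu.
  have [mS SE] := campbell pM intensity mu_ u0.
  have S0 (X : conf M) : 0 <= linear_statistic u X by exact: linear_statistic_ge0.
  have uoo : \int[mu]_x (u x)%:E < +oo by have := integrable_lty measurableT iu.
  rewrite -SE in uoo; have [iS E] := integral_fine mS S0 uoo.
  split => //; rewrite E SE /Rintegral fineK//.
  exact: (integrable_fin_num measurableT iu).
have [m1 i1 E1] := main _ (funrpos_ge0 g) ip.
have [m2 i2 E2] := main _ (funrneg_ge0 g) im.
have i12 := integrable_EFinB measurableT i1 i2.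
split.
- have /measurable_EFinP := measurable_int _ i12; exact.
- exact: i12.
- rewrite (_ : (fun X => _) = (fun X => (fine (linear_statistic (g^\+)%R X))%:E - (fine (linear_statistic (g^\-)%R X))%:E))//.
  rewrite integralB// E1 E2 -EFinB; congr EFin.
  rewrite -RintegralB//; apply: eq_Rintegral => x _.
  rewrite /funrpos /funrneg; have [gx|gx] := leP 0%R (g x).
    by rewrite (max_r (_ : - g x <= 0)%R) ?subr0// oppr_le0.
  by rewrite sub0r (max_l (_ : 0 <= - g x)%R) ?opprK// oppr_ge0 ltW.
Qed.

(** A real test function is a complex one with zero imaginary part; Campbell's
    formula rewrites both the integrability condition and the bound in terms of
    the intensity [mu]. *)
Lemma small_variance_real :
  small_variance Pi -> exists2 C : R, (0 < C)%R & linear_variance_bound Pi mu C.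
Proof.
move=> [C C0 HC]; exists C => // g mg ig g2.
pose f (x : M) : R[i] := Complex (g x) 0%R.
have cabsE (a : R) : cabs (Complex a 0%R) = `|a|%R.
  by rewrite /cabs normc_def /= expr0n /= addr0 sqrtr_sqr.
have cabs2 (a : R) : (cabs (Complex a 0%R) ^+ 2 = a ^+ 2)%R.
  by rewrite cabsE -normrX ger0_norm// sqr_ge0.
have mg2 : measurable_fun setT (fun x => g x ^+ 2)%R by exact: measurable_funX.
have [_ R2] := campbell pM intensity mg2 (fun x => sqr_ge0 (g x)).
have rsum0 (X : conf M) : rsum (fun=> 0%R : R) X = 0%R.
  by rewrite /rsum oppr0 maxxx subrr.
have mag : measurable_fun setT (fun x => `|g x|)%R by exact: measurableT_comp.
have m1 : measurable_fun setT (fun x => `|g x| + g x ^+ 2)%R by exact: measurable_funD.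
have n1 x : (0 <= `|g x| + g x ^+ 2)%R by rewrite addr_ge0// sqr_ge0.
have [_ R1] := campbell pM intensity m1 n1.
have := HC f mg (measurable_cst _).
have -> : \int[Pi]_X (\esum_(x in [set: M]) ((X x)%:R * cabs (f x) ^+ 2)%:E) =
    \int[mu]_x (g x ^+ 2)%:E.
  rewrite -R2; apply: eq_integral => X _; apply: eq_esum => x _.
  by rewrite cabs2.
have -> : \int[Pi]_X (\esum_(x in [set: M]) ((X x)%:R * (cabs (f x) + cabs (f x) ^+ 2))%:E) =
    \int[mu]_x (`|g x| + g x ^+ 2)%:E.
  rewrite -R1; apply: eq_integral => X _; apply: eq_esum => x _.
  by rewrite cabs2 cabsE.
have fin : \int[mu]_x (`|g x| + g x ^+ 2)%:E < +oo.
  under eq_integral do rewrite EFinD.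
  rewrite ge0_integralD//; last 3 first.
  - exact/measurable_EFinP.
  - by move=> x _; rewrite lee_fin sqr_ge0.
  - exact/measurable_EFinP.
  by rewrite lte_add_pinfty//; have /integrableP[] := ig.
move=> /(_ fin); apply: le_trans; rewrite le_eqVlt; apply/orP; left; apply/eqP.
have [_ _ Er] := integral_rsum mg ig.
rewrite /cvariance; apply: eq_integral => X _.
have -> : cexpectation Pi (csum f) = Complex (\int[mu]_x g x)%R 0%R.
  rewrite /cexpectation unlock /csum /=; congr (Complex _ _).
    by rewrite Er.
  by under eq_integral do rewrite rsum0; rewrite integral0.
rewrite -cabs2; congr (EFin (cabs _ ^+ 2)%R); rewrite /csum /=.
by apply/eqP; rewrite eq_complex /= rsum0 oppr0 addr0 !eqxx.
Qed.

End SmallVariance.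

(** * Variance of Hilbert-valued linear statistics *)

Section ClosedSpan.
Context {R : realType} (b : scalar_kind) (H : completeNormedModType (scalar_field R b)).
Context (ip : H -> H -> R) (ipH : real_inner_product ip).

Definition in_closed_span (e : nat -> H) (u : H) : Prop :=
  rnorm (residual ip e n u) @[n --> \oo] --> (0 : R).

Lemma in_closed_spanZ e a u : in_closed_span e u -> in_closed_span e (of_real b a *: u).
Proof.
move=> h; rewrite /in_closed_span.
have -> : (fun n => rnorm (residual ip e n (of_real b a *: u))) =
          (fun n => `|a| * rnorm (residual ip e n u)).
  by apply/funext => n; rewrite (residualZ ipH) rnormZ.
by rewrite -[X in _ --> X](mulr0 `|a|); apply: cvgMr.
Qed.

Lemma in_closed_spanD e u v : in_closed_span e u -> in_closed_span e v ->
  in_closed_span e (u + v).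
Proof.
move=> hu hv; apply: (@squeeze_cvgr _ _ _ _ (fun=> 0) (fun n => rnorm (residual ip e n u) + rnorm (residual ip e n v))).
- by apply: nearW => n; rewrite rnorm_ge0/= (residualD ipH) ler_rnormD.
- exact: cvg_cst.
- by rewrite -[X in _ --> X]addr0; apply: cvgD.
Qed.

Lemma in_closed_span_sum e (I : Type) (s : seq I) (F : I -> H) :
  (forall i, in_closed_span e (F i)) -> in_closed_span e (\sum_(i <- s) F i).
Proof.
move=> h; elim: s => [|i s IH]; last by rewrite big_cons; exact: in_closed_spanD.
rewrite big_nil -(scale0r 0) -(of_real0 b); apply: in_closed_spanZ.
rewrite /in_closed_span; under eq_fun do rewrite /residual.
have -> : (fun n => rnorm (0 - \sum_(i < n) of_real b (ip 0 (e i)) *: e i)) = fun=> 0.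
  apply/funext => n; rewrite big1 ?subr0 ?rnorm0// => i _.
  by rewrite (ip0l ipH) of_real0 scale0r.
exact: cvg_cst.
Qed.

(** Only countably many values occur in the approximating simple functions;
    orthonormalizing an enumeration of them gives a family whose closed span
    contains every value of [f]. *)
Lemma strongly_measurable_span d (T : measurableType d) (f : T -> H) :
  strongly_measurable f ->
  exists2 e, orthonormal_or_zero ip e & forall x, in_closed_span e (f x).
Proof.
move=> [phi [sphi phif]].
pose v k := if (choice.unpickle k : option (nat * nat)) is Some ij then
              nth 0 (fset_set (range (phi ij.1)) : seq H) ij.2 else 0.
pose e := gram_schmidt ip v.
have eON : orthonormal_or_zero ip e by exact: gram_schmidt_orthonormal.
exists e => // x; apply: residual_cvg0_closed => // eps eps0.
have /rnorm_cvgP/cvgr0Pnorm_lt/(_ _ eps0)[n _ /(_ n (leqnn n)) hn] := phif x.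
exists (phi n x); split.
  by move: hn; rewrite ger0_norm ?rnorm_ge0// -rnormN opprB.
have [k <-] : exists k, v k = phi n x.
  exists (choice.pickle (n, index (phi n x) (fset_set (range (phi n)) : seq H))).
  have finn := (sphi n).1; have rx : range (phi n) (phi n x) by exists x.
  by rewrite /v choice.pickleK nth_index// in_fset_set// mem_set.
apply: cvg_near_cst; exists k.+1 => // m /= km.
by rewrite residual_gram_schmidt// rnorm0.
Qed.

Lemma eseries_parseval e u : orthonormal_or_zero ip e -> in_closed_span e u ->
  (\sum_(0 <= i <oo) (ip u (e i) ^+ 2)%:E = (rnorm u ^+ 2)%:E)%E.
Proof.
move=> eON eu; apply/cvg_lim => //.
have h := parseval ipH eON eu.
have -> : (fun n => \sum_(0 <= i < n) (ip u (e i) ^+ 2)%:E)%E = EFin \o (fun n => \sum_(i < n) ip u (e i) ^+ 2).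
  by apply/funext => n; rewrite sumEFin big_mkord.
by apply: cvg_EFin => //; exact: nearW.
Qed.

End ClosedSpan.

Section WindowSum.
Context {R : realType} (M : completeMetricType R).
Context (b : scalar_kind) (H : completeNormedModType (scalar_field R b)).
Context (ip : H -> H -> R) (ipH : real_inner_product ip).
Context (pM : proper_metric M) (D : set M) (z : M) (r : R) (Dzr : D `<=` mball z r).
Implicit Types (X : configuration M) (w : M -> R) (u : M -> H).

(** The Hilbert-valued linear statistic of [w] times [u] over a window [A]; with
    [A] a shell and an exponential weight it is [shell_sum]. *)
Definition window_sum (A : set M) (w : M -> R) (u : M -> H) (X : configuration M) : H :=
  \sum_(x \in A) (of_real b ((X x)%:R * w x)) *: u x.

Lemma finite_window X : finite_set (D `&` [set x | X x != 0%N]).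
Proof.
apply: sub_finite_set (bounded_configuration X z r pM) => x [Dx Xx]; split => //.
exact: Dzr.
Qed.

Lemma window_sumE w u X : window_sum D w u X =
  \sum_(x <- fset_set (D `&` [set x | X x != 0%N])) (of_real b ((X x)%:R * w x)) *: u x.
Proof.
rewrite -fsbig_finite//; last exact: finite_window.
apply/esym/fsbig_widen; first by move=> x [].
move=> x [Dx /= /not_andP[//|/negP]]; rewrite negbK => /eqP ->.
by rewrite mul0r of_real0 scale0r.
Qed.

Lemma esum_window (a : M -> R) X : (forall x, 0 <= a x) -> (forall x, ~ D x -> a x = 0) ->
  \esum_(x in [set: M]) ((X x)%:R * a x)%:E =
  (\sum_(x <- fset_set (D `&` [set x | X x != 0%N])) (X x)%:R * a x)%:E.
Proof.
move=> a0 aD; transitivity (\esum_(x in D `&` [set x | X x != 0%N]) ((X x)%:R * a x)%:E).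
  rewrite [RHS]esum_mkcond; apply: eq_esum => x _.
  case: ifPn => //; rewrite notin_setE => /not_andP[/aD ->|/= /negP]; first by rewrite mulr0.
  by rewrite negbK => /eqP ->; rewrite mul0r.
rewrite esum_fset; last 2 first.
- exact: finite_window.
- by move=> x _; rewrite lee_fin mulr_ge0.
by rewrite fsbig_finite ?sumEFin//; exact: finite_window.
Qed.

Lemma rsum_window (g : M -> R) X : rsum (fun x => \1_D x * g x) X =
  \sum_(x <- fset_set (D `&` [set x | X x != 0%N])) (X x)%:R * g x.
Proof.
have off (h : M -> R) x : ~ D x -> \1_D x * h x = 0.
  by move=> Dx; rewrite indicE memNset// mul0r.
rewrite /rsum !esum_window; last 4 first.
- by move=> x; rewrite le_max lexx orbT.
- by move=> x Dx; rewrite off// oppr0 maxxx.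
- by move=> x; rewrite le_max lexx orbT.
- by move=> x Dx; rewrite off// maxxx.
rewrite /= -sumrB big_seq [RHS]big_seq; apply: eq_bigr => x.
rewrite in_fset_set; last exact: finite_window.
move=> /set_mem[Dx _]; rewrite indicE mem_set// !mul1r -mulrBr; congr (_ * _).
have [gx|gx] := leP 0 (g x).
  by rewrite (max_r (_ : - g x <= 0)) ?subr0// oppr_le0.
by rewrite sub0r (max_l (_ : 0 <= - g x)) ?opprK// oppr_ge0 ltW.
Qed.

Lemma ip_window_sum w u X e :
  ip (window_sum D w u X) e = rsum (fun x => \1_D x * (w x * ip (u x) e)) X.
Proof.
rewrite rsum_window window_sumE (ip_suml ipH); apply: eq_bigr => x _.
by rewrite (ipZl ipH) mulrA.
Qed.

Lemma in_closed_span_window e w u X : (forall x, in_closed_span ip e (u x)) ->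
  in_closed_span ip e (window_sum D w u X).
Proof.
move=> eu; rewrite window_sumE; apply: in_closed_span_sum => // x.
exact: in_closed_spanZ.
Qed.

End WindowSum.

Section WindowVariance.
Context {R : realType} (M : completeMetricType R).
Context (b : scalar_kind) (H : completeNormedModType (scalar_field R b)).
Context (ip : H -> H -> R) (ipH : real_inner_product ip).
Context (mu : {measure set (borel M) -> \bar R}) (Pi : probability (conf M) R).
Context (pM : proper_metric M) (intensity : has_intensity Pi mu).
Context (C : R) (C0 : 0 < C) (varC : linear_variance_bound Pi mu C).
Context (D : set M) (z : M) (r : R) (Dzr : D `<=` mball z r).
Context (mD : measurable (D : set (borel M))) (muD : (mu D < +oo)%E).
Local Open Scope ereal_scope.

(** Each coordinate of the window sum in an orthonormal family adapted to [u] is a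
    centered real linear statistic; summing the scalar variance bounds over the
    coordinates and applying Parseval on both sides gives the vector bound. *)
Lemma window_variance (w : M -> R) (u : M -> H) :
  measurable_fun setT (w : borel M -> R) ->
  (forall x, 0 <= w x <= 1)%R ->
  strongly_measurable (u : borel M -> H) ->
  \int[mu]_(x in D) (rnorm (u x) ^+ 2)%:E < +oo ->
  (forall e, \int[mu]_(x in D) (w x * ip (u x) e) = 0)%R ->
  measurable_fun setT (fun X : conf M => rnorm (window_sum D w u X)) /\
  \int[Pi]_X (rnorm (window_sum D w u X) ^+ 2)%:E <=
    C%:E * \int[mu]_(x in D) (w x ^+ 2 * rnorm (u x) ^+ 2)%:E.
Proof.
move=> mw w01 mu_ u2 mean0.
have [e eON eu] := strongly_measurable_span ipH mu_.
pose g i (x : borel M) := (\1_D x * (w x * ip (u x) (e i)))%R.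
have mip i : measurable_fun setT (fun x : borel M => ip (u x) (e i)) by exact: measurable_ip.
have mg i : measurable_fun setT (g i).
  by apply: measurable_funM; [exact: measurable_indic|exact: measurable_funM].
have mrn : measurable_fun setT (fun x : borel M => rnorm (u x)) by exact: measurable_rnorm.
have iD : mu.-integrable D (EFin \o (fun x => 1 + rnorm (u x) ^+ 2)%R).
  apply: integrable_EFinD => //.
    by apply: measurable_bounded_integrable => //; exists 1%R; split => // y /ltW y1 x _; rewrite normr1.
  apply/integrableP; split; first by apply/measurable_EFinP/measurable_funTS/measurable_funX.
  by under eq_integral do rewrite gee0_abs ?lee_fin ?sqr_ge0//.
have gle i x : D x -> (`|w x * ip (u x) (e i)| <= rnorm (u x))%R.
  move=> Dx; have /andP[w0 w1] := w01 x; rewrite normrM ger0_norm//.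
  rewrite (le_trans (ler_wpM2r _ w1))// mul1r (le_trans (cauchy_schwarz ipH _ _))//.
  by rewrite ler_piMr ?rnorm_ge0// (orthonormal_norm_le1 ipH eON).
have E1 i (F : R -> R) : F 0%R = 0%R -> \int[mu]_x (F (g i x))%:E = \int[mu]_(x in D) (F (w x * ip (u x) (e i)))%:E.
  move=> F0; rewrite [RHS]integral_mkcond; apply: eq_integral => x _.
  by rewrite /g patchE indicE; case: ifPn => xD; rewrite ?mul1r// mul0r F0.
have ig' i : mu.-integrable D (EFin \o (fun x => w x * ip (u x) (e i))%R).
  apply: le_integrable_EFin iD => //; first by apply: measurable_funTS; exact: measurable_funM.
  move=> x Dx; rewrite (le_trans (gle i x Dx))//.
  have := sqr_ge0 (rnorm (u x) - 1)%R; rewrite sqrrB1; have := rnorm_ge0 (u x); nra.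
have ig i : mu.-integrable setT (EFin \o g i).
  apply/integrableP; split; first exact/measurable_EFinP.
  rewrite (E1 i (fun y => `|y|%R)) ?normr0//.
  by have /integrableP[] := ig' i.
have g2le i : \int[mu]_x (g i x ^+ 2)%:E < +oo.
  rewrite (E1 i (fun y => y ^+ 2)%R) ?expr0n//.
  apply: le_lt_trans u2; apply: ge0_le_integral => //.
  - by move=> x _; rewrite lee_fin sqr_ge0.
  - by apply/measurable_EFinP/measurable_funTS/measurable_funX; exact: measurable_funM.
  - by apply/measurable_EFinP/measurable_funTS/measurable_funX.
  - move=> x Dx; rewrite lee_fin -[X in (X <= _)%R]real_normK ?num_real// ler_sqr ?nnegrE ?rnorm_ge0//.
    exact: gle.
have g0 i : (\int[mu]_x g i x = 0)%R.
  by rewrite /Rintegral (E1 i id)// -/(Rintegral _ _ _) mean0.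
have mr i : measurable_fun setT (fun X : conf M => rsum (g i) X).
  by have [] := integral_rsum pM intensity (mg i) (ig i).
have SE (X : conf M) : (rnorm (window_sum D w u X) ^+ 2)%:E = \sum_(0 <= i <oo) (rsum (g i) X ^+ 2)%:E.
  rewrite -(eseries_parseval ipH eON (in_closed_span_window ipH pM Dzr w X eu)).
  by apply: eq_eseriesr => i _; rewrite (ip_window_sum ipH pM Dzr).
have mS2 : measurable_fun setT (fun X : conf M => (rnorm (window_sum D w u X) ^+ 2)%:E).
  under eq_fun do rewrite SE.
  apply: ge0_emeasurable_sum => //.
    by move=> i X _ _; rewrite lee_fin sqr_ge0.
  by move=> i _; apply/measurable_EFinP; exact: measurable_funX.
split.
  have -> : (fun X : conf M => rnorm (window_sum D w u X)) =
      (fun X => Num.sqrt (rnorm (window_sum D w u X) ^+ 2)).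
    by apply/funext => X; rewrite sqrtr_sqr ger0_norm// rnorm_ge0.
  apply: measurableT_comp.
    by apply: continuous_measurable_fun; exact: sqrt_continuous.
  exact/measurable_EFinP.
under eq_integral do rewrite SE.
rewrite integral_nneseries//; last 2 first.
- by move=> i; apply/measurable_EFinP; exact: measurable_funX.
- by move=> i X _; rewrite lee_fin sqr_ge0.
have -> : \int[mu]_(x in D) (w x ^+ 2 * rnorm (u x) ^+ 2)%:E =
    \sum_(0 <= i <oo) \int[mu]_x (g i x ^+ 2)%:E.
  rewrite (eq_eseriesr (fun i _ => E1 i (fun y => y ^+ 2)%R (expr0n _ _))).
  rewrite -integral_nneseries//; last 2 first.
  - by move=> i; apply/measurable_EFinP/measurable_funTS/measurable_funX; exact: measurable_funM.
  - by move=> i x _; rewrite lee_fin sqr_ge0.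
  apply: eq_integral => x _.
  rewrite EFinM -(eseries_parseval ipH eON (eu x)) -nneseriesZl//.
    by apply: eq_eseriesr => i _; rewrite -EFinM exprMn.
  by move=> i _; rewrite lee_fin sqr_ge0.
rewrite -nneseriesZl//; last by move=> i _; apply: integral_ge0 => x _; rewrite lee_fin sqr_ge0.
apply: lee_nneseries.
- by move=> i _ _; apply: integral_ge0 => x _; rewrite lee_fin sqr_ge0.
- move=> i _; have := varC (mg i) (ig i) (g2le i); rewrite g0.
  rewrite (eq_integral (fun X : conf M => (rsum (g i) X ^+ 2)%:E)); first exact.
  by move=> X _; rewrite subr0.
Qed.

End WindowVariance.

(** * Radial averages of functions with the mean value property *)

Section RadialWeight.
Context {R : realType} (M : completeMetricType R).

Definition radial_weight (s : R) (z : M) (x : borel M) : R := expR (- (s * mdist (x : M) z)).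

Lemma measurable_radial_weight s z : measurable_fun setT (radial_weight s z).
Proof.
apply: measurableT_comp => //; apply: measurableT_comp => //.
by apply: measurable_funM => //; exact: measurable_mdist.
Qed.

Lemma radial_weight_ge0 s z x : 0 <= radial_weight s z x.
Proof. exact: expR_ge0. Qed.

Lemma radial_weight_le1 s z x : 0 <= s -> radial_weight s z x <= 1.
Proof. by move=> s0; rewrite expR_le1 oppr_le0 mulr_ge0// mdist_ge0. Qed.

Lemma sqr_radial_weight s z x : radial_weight s z x ^+ 2 = radial_weight (2 * s) z x.
Proof. by rewrite /radial_weight -expRM_natl; congr expR; ring. Qed.

Lemma le_radial_weight s t z x : s <= t -> radial_weight t z x <= radial_weight s z x.
Proof. by move=> st; rewrite ler_expR lerN2 ler_wpM2r// mdist_ge0. Qed.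

Lemma radial_weight_base s (o z : M) x : 0 <= s ->
  radial_weight s z x <= expR (s * mdist o z) * radial_weight s o x.
Proof.
move=> s0; rewrite /radial_weight -expRD ler_expR -mulrBr.
rewrite -mulrN ler_wpM2l//.
by have := metric_triangle (x : M) z o; rewrite (metric_sym z o); lra.
Qed.

End RadialWeight.

Definition annulus {R : realType} {M : metricType R} (z : M) (a b : R) : set M :=
  [set x | a <= mdist x z < b].

Section RadialMean.
Context {R : realType} (M : completeMetricType R).
Context (mu : {measure set (borel M) -> \bar R}) (z : M).
Implicit Types (a b c r s : R).

Lemma annulus_sub_mball a b : annulus z a b `<=` mball z b.
Proof. by move=> x /andP[]. Qed.

Lemma annulusE a b : annulus z a b = mball z b `\` mball z a.
Proof.
apply/seteqP; split => x; rewrite /annulus /mball /=.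
  by move=> /andP[h1 h2]; split => //; apply/negP; rewrite -leNgt.
by move=> [h1 /negP]; rewrite -leNgt => h2; apply/andP.
Qed.

Lemma measurable_annulus a b : measurable (annulus z a b : set (borel M)).
Proof. by rewrite annulusE; apply: measurableD; exact: measurable_mball. Qed.

Lemma annulus_cat a b c : a <= b -> b <= c ->
  annulus z a c = annulus z a b `|` annulus z b c.
Proof.
move=> ab bc; apply/seteqP; split => x; rewrite /annulus /=.
  by move=> /andP[h1 h2]; have [h|h] := ltP (mdist x z) b; [left|right]; apply/andP.
by move=> [|] /andP[h1 h2]; apply/andP; split => //; lra.
Qed.

Lemma annulus_disjoint a b c : [disjoint annulus z a b & annulus z b c].
Proof.
apply/disj_setPS => x [/andP[_ h1] /andP[h2 _]] /=; lra.
Qed.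

Lemma annulus_id a : annulus z a a = set0.
Proof. by apply/seteqP; split => x //= /andP[h1 h2]; lra. Qed.

Context (u : borel M -> R) (iu : forall r, mu.-integrable (mball z r) (EFin \o u)).
Context (u0 : forall r, \int[mu]_(x in mball z r) u x = 0).

Lemma integral_annulus0 a b : a <= b -> \int[mu]_(x in annulus z a b) u x = 0.
Proof.
move=> ab; have := u0 b; have E : mball z b = mball z a `|` annulus z a b.
  apply/seteqP; split => x; rewrite annulusE /mball /=.
    by move=> h; have [xa|xa] := ltP (mdist x z) a; [left|right; split => //; apply/negP; rewrite -leNgt].
  by move=> [h|[]//]; lra.
rewrite E Rintegral_setU.
- by rewrite u0 add0r.
- exact: measurable_mball.
- exact: measurable_annulus.
- by rewrite -E.
- by apply/disj_setPS => x [/= h1 /andP[h2 _]]; move: h1; rewrite /mball/=; lra.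
Qed.

Local Notation wt s := (radial_weight s z).

Lemma integrable_radial_weight s a b : 0 <= s ->
  mu.-integrable (annulus z a b) (EFin \o (fun x => wt s x * u x)).
Proof.
move=> s0; have mA := measurable_annulus a b.
have iA : mu.-integrable (annulus z a b) (EFin \o u).
  apply: integrableS (iu b) => //; first exact: measurable_mball.
  exact: annulus_sub_mball.
apply: (@le_integrable_EFin _ _ _ _ _ mA _ (fun x => `|u x|)) => //.
- apply: measurable_funM; first by apply: measurable_funTS; exact: measurable_radial_weight.
  by have /measurable_EFinP := measurable_int _ iA.
- move=> x _; rewrite normrM ger0_norm ?expR_ge0// ler_piMl//.
  exact: radial_weight_le1.
- exact: integrable_norm.
Qed.

Lemma expRN_lipschitz (x y : R) : 0 <= x -> x <= y -> `|expR (- y) - expR (- x)| <= y - x.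
Proof.
move=> x0 xy; rewrite ler0_norm; last by rewrite subr_le0 ler_expR lerN2.
rewrite opprB (_ : - y = - x + - (y - x)); last by ring.
rewrite expRD -[X in X - _]mulr1 -mulrBr.
have h1 := expR_ge1Dx (- (y - x)).
have h2 : expR (- x) <= 1 by rewrite expR_le1 oppr_le0.
have h3 := expR_gt0 (- x).
have h4 : 1 - expR (- (y - x)) <= y - x by lra.
have h5 : expR (- (y - x)) <= 1 by rewrite expR_le1; lra.
by rewrite (le_trans _ h4)// ler_piMl// subr_ge0.
Qed.

Lemma integral_annulus_radial_le s c d : 0 <= s -> 0 <= c -> 0 <= d ->
  `|\int[mu]_(x in annulus z c (c + d)) (wt s x * u x)| <=
  s * d * \int[mu]_(x in annulus z c (c + d)) `|u x|.
Proof.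
move=> s0 c0 d0; set A := annulus _ _ _.
have mA : measurable (A : set (borel M)) by exact: measurable_annulus.
have iA : mu.-integrable A (EFin \o u).
  apply: integrableS (iu (c + d)) => //; first exact: measurable_mball.
  exact: annulus_sub_mball.
have iw : mu.-integrable A (EFin \o (fun x => wt s x * u x)) by exact: integrable_radial_weight.
have ic := integrable_EFinM mA (expR (- (s * c))) iA.
have iB := integrable_EFinB mA iw ic.
have -> : \int[mu]_(x in A) (wt s x * u x) =
    \int[mu]_(x in A) (wt s x * u x - expR (- (s * c)) * u x).
  rewrite RintegralB// RintegralZl// /A integral_annulus0 ?lerDl//.
  by rewrite mulr0 subr0.
rewrite (le_trans (le_normr_Rintegral _ _))// -RintegralZl//; last exact: integrable_norm.
apply: le_Rintegral => //.
- by have := integrable_norm iB; exact.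
- apply: (integrable_EFinM mA); exact: integrable_norm.
- move=> x /andP[h1 h2]; rewrite -mulrBl normrM ler_wpM2r// /radial_weight.
  rewrite (le_trans (expRN_lipschitz _ _)) ?mulr_ge0// ?ler_wpM2l// -mulrBr ler_wpM2l//.
  by rewrite lerBlDl ltW.
Qed.

Lemma integral_annulus_radial_iter s a d n : 0 <= s -> 0 <= a -> 0 <= d ->
  `|\int[mu]_(x in annulus z a (a + n%:R * d)) (wt s x * u x)| <=
  s * d * \int[mu]_(x in annulus z a (a + n%:R * d)) `|u x|.
Proof.
move=> s0 a0 d0; elim: n => [|n IH].
  by rewrite mul0r addr0 annulus_id !Rintegral_set0 normr0 mulr0.
have h1 : a <= a + n%:R * d by rewrite lerDl mulr_ge0.
have h2 : a + n%:R * d <= a + n.+1%:R * d by rewrite lerD2l ler_wpM2r// ler_nat.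
have h3 : a + n.+1%:R * d = a + n%:R * d + d by rewrite -natr1; ring.
rewrite (annulus_cat h1 h2) !Rintegral_setU; try exact: measurable_annulus; try exact: annulus_disjoint.
- rewrite (le_trans (ler_normD _ _))// mulrDr lerD// h3.
  by apply: integral_annulus_radial_le => //; rewrite (le_trans a0).
- rewrite -annulus_cat//; apply: (@integrable_norm _ _ _ mu).
  apply: integrableS (iu (a + n.+1%:R * d)) => //; try exact: measurable_mball; try exact: measurable_annulus.
  exact: annulus_sub_mball.
- by rewrite -annulus_cat//; exact: integrable_radial_weight.
Qed.

(** Cutting the annulus into thin annuli of width [d], on each of which [u] has
    integral zero and the weight is constant up to [s * d], leaves an error of
    [s * d] times the L1 norm of [u]; let [d] tend to [0]. *)
Lemma integral_annulus_radial0 s a b : 0 <= s -> 0 <= a -> a <= b ->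
  \int[mu]_(x in annulus z a b) (wt s x * u x) = 0.
Proof.
move=> s0 a0 ab; apply/eqP; rewrite -normr_le0; apply/ler_addgt0Pl => e e0; rewrite addr0.
set I := `| _ |; set J := \int[mu]_(x in annulus z a b) `|u x|.
have J0 : 0 <= J by apply: Rintegral_ge0.
have h n : I <= s * ((b - a) / n.+1%:R) * J.
  have := @integral_annulus_radial_iter s a ((b - a) / n.+1%:R) n.+1 s0 a0.
  rewrite (_ : a + _ * _ = b); last by field; rewrite addrC natr1 pnatr_eq0.
  by apply; rewrite divr_ge0// subr_ge0.
pose n := Num.bound (s * (b - a) * J / e).
have hn : s * (b - a) * J / e < n%:R.
  by apply: archi_boundP; rewrite divr_ge0 ?mulr_ge0 ?subr_ge0// ltW.
rewrite (le_trans (h n))//.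
rewrite (_ : _ * _ * J = s * (b - a) * J / n.+1%:R); last by ring.
move: hn; rewrite ltr_pdivrMr// => hn.
rewrite ler_pdivrMr// (le_trans (ltW hn))// mulrC; apply: ler_wpM2l; first exact: ltW.
by rewrite ler_nat.
Qed.

End RadialMean.

Definition finite_on_compacts {R : realType} {M : completeMetricType R}
    (mu : {measure set (borel M) -> \bar R}) : Prop :=
  forall K : set M, compact K -> (mu K < +oo)%E.

Definition mean_value_property {R : realType} {M : completeMetricType R}
    (b : scalar_kind) (H : normedModType (scalar_field R b))
    (mu : {measure set (borel M) -> \bar R}) (f : M -> H) : Prop :=
  forall (z : M) (r : R), 0 < r ->
    f z = of_real b (fine (mu (mball z r)))^-1 *:
          bochner mu (mball z r) (f : borel M -> H).

Section MeanValue.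
Context {R : realType} (M : completeMetricType R).
Context (b : scalar_kind) (H : completeNormedModType (scalar_field R b)).
Context (ip : H -> H -> R) (ipH : real_inner_product ip).
Context (mu : {measure set (borel M) -> \bar R}) (pM : proper_metric M)
  (muK : finite_on_compacts mu).

Lemma mball_lty z r : (mu (mball z r) < +oo)%E.
Proof.
apply: (le_lt_trans _ (muK (@pM z r))).
apply: le_measure; rewrite ?mem_set//.
- exact: measurable_mball.
- exact: measurable_closed_mball.
- by move=> x /ltW.
Qed.

Context (f : M -> H) (fL2 : locally_square_integrable mu f).

Let mf : strongly_measurable (f : borel M -> H) := fL2.1.

Lemma square_mball_lty z r : (\int[mu]_(x in mball z r) (rnorm (f x) ^+ 2)%:E < +oo)%E.
Proof.
apply: (le_lt_trans _ (fL2.2 _ (@pM z r))).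
apply: ge0_subset_integral => //.
- exact: measurable_mball.
- exact: measurable_closed_mball.
- by apply/measurable_EFinP/measurable_funTS/measurable_funX/measurable_rnorm.
- by move=> x _; rewrite lee_fin sqr_ge0.
- by move=> x /ltW.
Qed.

Lemma integrable_rnorm_mball z r :
  mu.-integrable (mball z r) (EFin \o (fun x : borel M => rnorm (f x))).
Proof.
have mB := measurable_mball z r.
have iD : mu.-integrable (mball z r) (EFin \o (fun x : borel M => 1 + rnorm (f x) ^+ 2)).
  apply: integrable_EFinD => //.
    apply: measurable_bounded_integrable => //; first exact: mball_lty.
    by exists 1; split => // y /ltW y1 x _; rewrite normr1.
  apply/integrableP; split.
    by apply/measurable_EFinP/measurable_funTS/measurable_funX/measurable_rnorm.
  by under eq_integral do rewrite gee0_abs ?lee_fin ?sqr_ge0//; exact: square_mball_lty.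
apply: le_integrable_EFin iD => //; first by apply: measurable_funTS; exact: measurable_rnorm.
move=> x Dx; rewrite ger0_norm ?rnorm_ge0//.
have := sqr_ge0 (rnorm (f x) - 1); rewrite sqrrB1; have := rnorm_ge0 (f x); nra.
Qed.

Lemma integrable_ip_mball z r e :
  mu.-integrable (mball z r) (EFin \o (fun x : borel M => ip (f x) e)).
Proof.
have mB := measurable_mball z r.
apply: le_integrable_EFin (integrable_EFinM mB (rnorm e) (integrable_rnorm_mball z r)) => //.
- by apply: measurable_funTS; exact: measurable_ip.
- by move=> x _; rewrite mulrC cauchy_schwarz.
Qed.

Context (mvp : mean_value_property mu f).

(** Inner products commute with the Bochner integral, whose existence has to be
    known first: [bochner] defaults to [0] otherwise. When the ball is null both
    sides vanish. *)
Lemma mean_value_ip z r e :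
  \int[mu]_(x in mball z r) ip (f x) e = ip (f z) e * fine (mu (mball z r)).
Proof.
have [r0|r0] := leP r 0.
  rewrite (_ : mball z r = set0) ?Rintegral_set0 ?measure0 ?mulr0//.
  apply/seteqP; split => x //; rewrite /mball/= => h.
  by have := mdist_ge0 x z; lra.
have mB := measurable_mball z r.
have [m0|m0] := eqVneq (mu (mball z r)) 0%E.
  rewrite m0 mulr0 /Rintegral null_set_integral//.
  by apply/measurable_EFinP/measurable_funTS; exact: measurable_ip.
have hex := bochner_integral_exists ipH mB (mball_lty z r) mf (integrable_rnorm_mball z r).
have hb : is_bochner_integral mu (mball z r) (f : borel M -> H) (bochner mu (mball z r) (f : borel M -> H)).
  by have [v hv] := hex; exact: (xgetPex 0 hex).
rewrite -(ip_bochner_integral ipH mB (mball_lty z r) e mf (integrable_rnorm_mball z r) hb).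
rewrite [in RHS](mvp z r0) (ipZl ipH) mulrAC mulVf ?mul1r//.
by rewrite fine_eq0// ge0_fin_numE// mball_lty.
Qed.

Let integrable_cst_mball z r (k : R) : mu.-integrable (mball z r) (EFin \o cst k).
Proof.
apply: measurable_bounded_integrable => //; [exact: measurable_mball|exact: mball_lty|].
by exists `|k|; split => // y /ltW y1 x _.
Qed.

Lemma mean_value_centered z r e :
  \int[mu]_(x in mball z r) ip (f x - f z) e = 0.
Proof.
have mB := measurable_mball z r.
have ic := integrable_cst_mball z r (ip (f z) e).
under eq_Rintegral do rewrite (ipBl ipH).
rewrite RintegralB//; last exact: integrable_ip_mball.
by rewrite mean_value_ip Rintegral_cst// subrr.
Qed.

Lemma annulus_mean0 z s x y e : 0 <= s -> 0 <= x -> x <= y ->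
  \int[mu]_(t in annulus z x y) (radial_weight s z t * ip (f t - f z) e) = 0.
Proof.
move=> s0 x0 xy.
apply: (@integral_annulus_radial0 _ _ mu z (fun t : borel M => ip (f t - f z) e)) => //.
  move=> r; have mB := measurable_mball z r.
  have := integrable_EFinB mB (integrable_ip_mball z r e)
    (integrable_cst_mball z r (ip (f z) e)).
  by apply: eq_integrable => // t _; rewrite /= (ipBl ipH).
move=> r; exact: mean_value_centered.
Qed.

(** If [f] vanishes almost everywhere near [z], testing the mean value identity
    against [f z] gives [0 = rnorm (f z) ^+ 2 * mu (mball z 1)]. Thus a nonzero [f]
    has positive energy on some ball. *)
Lemma mean_value_eq0 z : (\int[mu]_(x in mball z 1) (rnorm (f x) ^+ 2)%:E = 0)%E -> f z = 0.
Proof.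
move=> I0; have mB := measurable_mball z 1.
have [m0|m0] := eqVneq (mu (mball z 1)) 0%E.
  by rewrite (mvp z ltr01) m0 /= invr0 of_real0 scale0r.
have m1 : fine (mu (mball z 1)) != 0 by rewrite fine_eq0// ge0_fin_numE// mball_lty.
have ae0 : (\int[mu]_(x in mball z 1) (ip (f x) (f z))%:E = 0)%E.
  have mn2 : measurable_fun (mball z 1 : set (borel M)) (fun x => (rnorm (f x) ^+ 2)%:E).
    by apply/measurable_EFinP/measurable_funTS/measurable_funX/measurable_rnorm.
  have /(ae_eq_integral_abs _ mB mn2).1 : (\int[mu]_(x in mball z 1) `|(rnorm (f x) ^+ 2)%:E| = 0)%E.
    by under eq_integral do rewrite gee0_abs ?lee_fin ?sqr_ge0//.
  move=> h; rewrite (ae_eq_integral (cst 0%E)) ?integral0//.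
    by apply/measurable_EFinP/measurable_funTS; exact: measurable_ip.
  apply: filterS h => x hx Dx; have := hx Dx => /= -[/eqP].
  by rewrite sqrf_eq0 => /eqP/rnorm_eq0 ->; rewrite (ip0l ipH).
have := mean_value_ip z 1 (f z); rewrite /Rintegral ae0 /= => /esym/eqP.
by rewrite mulf_eq0 (negbTE m1) orbF (ip_self ipH) sqrf_eq0 => /eqP/rnorm_eq0.
Qed.

End MeanValue.

(** * Nonnegative series and volume growth *)

Section NonnegSeries.
Context {R : realType}.
Local Open Scope ereal_scope.

Lemma ae_nneseries_lty d (T : measurableType d) (P : {measure set T -> \bar R})
    (F : nat -> T -> \bar R) :
  (forall n, measurable_fun setT (F n)) -> (forall n x, 0 <= F n x) ->
  \sum_(0 <= n <oo) \int[P]_x F n x < +oo ->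
  {ae P, forall x, \sum_(0 <= n <oo) F n x < +oo}.
Proof.
move=> mF F0; rewrite -integral_nneseries// => Foo.
have mS : measurable_fun setT (fun x => \sum_(0 <= n <oo) F n x).
  exact: ge0_emeasurable_sum.
have iF : P.-integrable setT (fun x => \sum_(0 <= n <oo) F n x).
  apply/integrableP; split => //.
  by under eq_integral do rewrite gee0_abs ?nneseries_ge0//.
have := integrable_ae measurableT iF; apply: filterS => x /(_ I).
by rewrite ge0_fin_numE// nneseries_ge0.
Qed.

Lemma summable_cvg0 (a : nat -> R) : (forall n, 0 <= a n)%R ->
  \sum_(0 <= n <oo) (a n)%:E < +oo -> a n @[n --> \oo] --> (0 : R)%R.
Proof.
move=> a0 aoo; apply: cvg_series_cvg_0.
apply: nondecreasing_is_cvgn.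
  by apply/nondecreasing_series => n _ _.
exists (fine (\sum_(0 <= n <oo) (a n)%:E)) => _ [n _ <-].
rewrite -lee_fin fineK; last by rewrite ge0_fin_numE// nneseries_ge0// => *; rewrite lee_fin.
by rewrite /series/= -sumEFin; apply: nneseries_lim_ge => i _ _; rewrite lee_fin.
Qed.

Lemma nneseries_geometric_lty (c q : R) : (0 <= c)%R -> (0 < q < 1)%R ->
  \sum_(0 <= k <oo) (c * q ^+ k)%:E < +oo.
Proof.
move=> c0 /andP[q0 q1].
apply: (@le_lt_trans _ _ (c / (1 - q))%:E); last exact: ltry.
apply: lime_le; first by apply: is_cvg_nneseries => n _ _; rewrite lee_fin mulr_ge0// exprn_ge0// ltW.
apply: nearW => n; rewrite sumEFin lee_fin.
by apply: (@geometric_le_lim _ n c q) => //; rewrite ger0_norm// ltW.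
Qed.

Lemma le_nneseries_lty (a b : nat -> \bar R) : (forall n, 0 <= a n <= b n) ->
  \sum_(0 <= n <oo) b n < +oo -> \sum_(0 <= n <oo) a n < +oo.
Proof.
move=> ab; apply: le_lt_trans; apply: lee_nneseries => n _; first by move=> _; case/andP: (ab n).
by case/andP: (ab n).
Qed.

Lemma nneseries_term_lty (a : nat -> \bar R) n : (forall n, 0 <= a n) ->
  \sum_(0 <= n <oo) a n < +oo -> a n < +oo.
Proof.
move=> a0; apply: le_lt_trans; apply: (@le_trans _ _ (\sum_(0 <= i < n.+1) a i)).
  by rewrite big_nat_recr//= leeDr// sume_ge0.
exact: nneseries_lim_ge.
Qed.

End NonnegSeries.

Section Shells.
Context {R : realType} (M : completeMetricType R) (z : M).

Lemma bigcup_shell : \bigcup_k shell z k = [set: M].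
Proof.
apply/seteqP; split => // x _; exists (Num.trunc (mdist x z)) => //.
by rewrite /shell/=; apply: Num.Theory.trunc_itv; exact: mdist_ge0.
Qed.

Lemma trivIset_shell : trivIset setT (shell z).
Proof.
apply/trivIsetP => i j _ _ ij; apply/seteqP; split => // x [].
rewrite /shell /= => /andP[h1 h2] /andP[h3 h4].
move: ij; rewrite neq_lt => /orP[] ij.
  have : (i.+1%:R : R) <= j%:R by rewrite ler_nat.
  lra.
have : (j.+1%:R : R) <= i%:R by rewrite ler_nat.
lra.
Qed.

Lemma integral_shells (mu : {measure set (borel M) -> \bar R}) (g : borel M -> R) :
  measurable_fun setT g -> (forall x, 0 <= g x) ->
  (\int[mu]_x (g x)%:E = \sum_(0 <= k <oo) \int[mu]_(x in shell z k) (g x)%:E)%E.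
Proof.
move=> mg g0; rewrite -(bigcup_shell) ge0_integral_bigcup//.
- by move=> k; exact: measurable_shell.
- by apply/measurable_EFinP/measurable_funTS.
- by move=> x _; rewrite lee_fin.
- exact: trivIset_shell.
Qed.

End Shells.

Section Growth.
Context {R : realType} (M : completeMetricType R).
Context (mu : {measure set (borel M) -> \bar R}) (pM : proper_metric M)
  (muK : finite_on_compacts mu).
Context (o : M) (h : R) (vol : volume_growth mu o h).

(** A subexponential factor is absorbed by an arbitrarily small excess [alpha] in
    the exponent; finitely many small radii only affect the constant. *)
Lemma ball_growth (alpha : R) : 0 < alpha -> exists2 A : R, 0 <= A &
  forall k : nat, (mu (mball o k.+1%:R) <= (A * expR ((alpha + h) * k.+1%:R))%:E)%E.
Proof.
move=> a0; have [h0 [L [U [[_ _ _ _ [_ subU _]] LU]]]] := vol.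
have := subU _ a0 => /fine_cvgP[_] /cvgr0Pnorm_lt/(_ _ ltr01)[T [_ hT]].
pose N := Num.bound `|T|.
have NT : T < N%:R.
  by rewrite (le_lt_trans (ler_norm T))//; apply: archi_boundP.
have finN := mball_lty pM muK o N.+1%:R.
exists (Num.max 1 (fine (mu (mball o N.+1%:R)))); first by rewrite le_max ler01.
move=> k; have [kN|Nk] := ltP k.+1 N.+1.
  apply: (@le_trans _ _ (mu (mball o N.+1%:R))).
    apply: le_measure; rewrite ?mem_set//; try exact: measurable_mball.
    by move=> x; rewrite /mball/= => /lt_le_trans; apply; rewrite ler_nat ltnW.
  rewrite -[leLHS]fineK ?ge0_fin_numE// lee_fin.
  rewrite (@le_trans _ _ (Num.max 1 (fine (mu (mball o N.+1%:R)))))//.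
    by rewrite le_max lexx orbT.
  rewrite ler_peMr ?le_max ?ler01// -expR0 ler_expR mulr_ge0// addr_ge0// ltW//.
have /andP[_ muU] := LU k.+1%:R (ltr0Sn _ k).
rewrite (le_trans muU)// lee_fin.
have kT : T < k.+1%:R by rewrite (lt_le_trans NT)// ler_nat ltnW.
have := hT _ kT; rewrite /= => Ubnd.
have U1 : U k.+1%:R <= expR (alpha * k.+1%:R).
  rewrite -[leRHS]mul1r -ler_pdivrMr ?expR_gt0// -expRN.
  by rewrite (le_trans (ler_norm _))// ltW.
rewrite mulrDl expRD [h * _]mulrC mulrA ler_wpM2r ?expR_ge0//.
rewrite (le_trans U1)// ler_peMl ?expR_ge0// le_max lexx//.
Qed.

(** Half of the gap between [s] and [h] pays for the subexponential factor, the
    other half makes the series over shells geometric. *)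
Lemma weight_mass_lty s : h < s -> (\int[mu]_x (radial_weight s o x)%:E < +oo)%E.
Proof.
move=> hs; pose alpha := (s - h) / 2; have a0 : 0 < alpha by rewrite /alpha; lra.
have h0 : 0 < h by case: vol.
have [A A0 hA] := ball_growth a0.
rewrite (integral_shells o); [|exact: measurable_radial_weight|move=> x; exact: radial_weight_ge0].
apply: (@le_nneseries_lty _ _ (fun k => (A * expR (alpha + h) * expR (- alpha) ^+ k)%:E)); last first.
  apply: nneseries_geometric_lty; first by rewrite mulr_ge0// expR_ge0.
  by rewrite expR_gt0 expR_lt1 oppr_lt0.
move=> k; apply/andP; split.
  by apply: integral_ge0 => x _; rewrite lee_fin expR_ge0.
have mk := measurable_shell o k.
apply: (@le_trans _ _ (\int[mu]_(x in shell o k) (expR (- (s * k%:R)))%:E)%E).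
  apply: ge0_le_integral => //.
  - by move=> x _; rewrite lee_fin expR_ge0.
  - by apply/measurable_EFinP/measurable_funTS; exact: measurable_radial_weight.
  - move=> x /andP[kx _]; rewrite lee_fin ler_expR lerN2 ler_wpM2l//; lra.
rewrite integral_cst//.
apply: (@le_trans _ _ ((expR (- (s * k%:R)))%:E * (A * expR ((alpha + h) * k.+1%:R))%:E)%E).
  apply: lee_wpmul2l; first by rewrite lee_fin expR_ge0.
  rewrite (le_trans _ (hA k))// le_measure ?mem_set//; first exact: measurable_mball.
  by move=> x /andP[].
rewrite -EFinM lee_fin mulrCA -!mulrA ler_wpM2l// -expRM_natl -!expRD ler_expR.
rewrite -natr1 /alpha; lra.
Qed.

(** Near infinity [L] stays above a positive constant, and [r * h <= expR (r * h)]
    already makes the lower bound on the volume exceed [A]. *)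
Lemma ball_unbounded (A : R) : exists2 r, 0 < r & (A%:E <= mu (mball o r))%E.
Proof.
have [h0 [L [U [[_ _ _ + _] LU]]]] := vol.
rewrite limf_einfE => /ereal_sup_gt[_ [V FV <-] V0].
have [c c0 cV] : exists2 c : R, 0 < c & forall r, V r -> c <= L r.
  have Vinf r : V r -> (ereal_inf [set (L x)%:E | x in V] <= (L r)%:E)%E.
    by move=> Vr; apply: ereal_inf_lbound; exists r.
  move: V0 Vinf; case: (ereal_inf _) => [c|_|//].
    by rewrite lte_fin => c0 hc; exists c => // r /hc; rewrite lee_fin.
  by move=> hc; exists 1 => // r /hc.
have [T [_ hT]] : pinfty_nbhs R V by [].
pose r := Num.max (T + 1) (Num.max 1 (`|A| / (c * h))).
have r0 : 0 < r by rewrite /r !lt_max ltr01 orbT.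
exists r => //; have /andP[+ _] := LU r r0; apply: le_trans; rewrite lee_fin.
have cL : c <= L r by apply: cV; apply: hT; rewrite /r lt_max ltrDl ltr01.
rewrite (le_trans (ler_norm A))// (@le_trans _ _ (c * (r * h)))//.
  have : `|A| / (c * h) <= r by rewrite /r !le_max lexx !orbT.
  by rewrite ler_pdivrMr ?mulr_gt0// mulrCA.
apply: ler_pM => //; [exact: ltW|by rewrite mulr_ge0// ltW|].
by rewrite (le_trans _ (expR_ge1Dx _))// lerDr.
Qed.

End Growth.

(** * Almost sure statements *)

Section WindowAlgebra.
Context {R : realType} (M : completeMetricType R).
Context (b : scalar_kind) (H : completeNormedModType (scalar_field R b)).
Context (pM : proper_metric M) (z : M).
Implicit Types (X : configuration M) (w : M -> R) (u : M -> H).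

Definition window_mass (A : set M) (w : M -> R) (X : configuration M) : R :=
  \sum_(x <- fset_set (A `&` [set x | X x != 0%N])) (X x)%:R * w x.

Lemma window_sum_annulus_cat w u X (x y t : R) : x <= y -> y <= t ->
  window_sum (annulus z x t) w u X =
  window_sum (annulus z x y) w u X + window_sum (annulus z y t) w u X.
Proof.
move=> xy yt.
rewrite !(window_sumE pM (@annulus_sub_mball _ _ z _ _)) (annulus_cat z xy yt) setIUl.
have f1 := finite_window pM (@annulus_sub_mball _ _ z x y) X.
have f2 := finite_window pM (@annulus_sub_mball _ _ z y t) X.
rewrite -!fsbig_finite//; last by rewrite finite_setU.
rewrite fsbigU//; last by move=> p [[[/andP[_ h1] _] [/andP[h2 _] _]]]; lra.
Qed.

Lemma window_sum_annulus w u X (K : nat) :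
  window_sum (annulus z 0 K%:R) w u X =
  \sum_(0 <= k < K) window_sum (shell z k) w u X.
Proof.
elim: K => [|K IH].
  by rewrite big_nil annulus_id /window_sum fsbig_set0.
rewrite big_nat_recr//= -IH; apply: window_sum_annulus_cat => //.
by rewrite ler_nat.
Qed.

Lemma window_sum_center (D : set M) (r : R) w u c X : D `<=` mball z r ->
  window_sum D w (fun x => u x - c) X =
  window_sum D w u X - of_real b (window_mass D w X) *: c.
Proof.
move=> Dzr; rewrite !(window_sumE pM Dzr) /window_mass.
have -> : of_real b (\sum_(x <- fset_set (D `&` [set x | X x != 0%N])) (X x)%:R * w x) =
   \sum_(x <- fset_set (D `&` [set x | X x != 0%N])) of_real b ((X x)%:R * w x).
  by apply: (big_morph (of_real b)); [exact: of_realD | exact: of_real0].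
rewrite scaler_suml -sumrB; apply: eq_bigr => x _; exact: scalerBr.
Qed.

Lemma window_massE (D : set M) (r : R) w X : D `<=` mball z r -> (forall x, 0 <= w x) ->
  (window_mass D w X)%:E = linear_statistic (fun x => \1_D x * w x) X.
Proof.
move=> Dzr w0; rewrite /linear_statistic (esum_window pM Dzr).
- congr EFin; rewrite /window_mass big_seq [RHS]big_seq; apply: eq_bigr => x.
  rewrite in_fset_set; last exact: finite_window Dzr X.
  by move=> /set_mem[Dx _]; rewrite indicE mem_set// mul1r.
- by move=> x; rewrite mulr_ge0.
- by move=> x Dx; rewrite indicE memNset// mul0r.
Qed.

Lemma cvg_window_mass_annulus w X : (forall x, 0 <= w x) ->
  ((window_mass (annulus z 0 K%:R) w X)%:E @[K --> \oo] --> linear_statistic w X)%E.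
Proof.
move=> w0.
have -> : (fun K : nat => (window_mass (annulus z 0 K%:R) w X)%:E) =
  (fun K : nat => linear_statistic (fun x => \1_(annulus z 0 K%:R) x * w x) X).
  by apply/funext => K; apply: window_massE => //; exact: annulus_sub_mball.
apply: cvg_linear_statistic.
- by move=> n x; rewrite mulr_ge0.
- move=> x m n mn; rewrite ler_wpM2r// !indicE ler_nat.
  case: (boolP (x \in annulus z 0 m%:R)) => // /set_mem/andP[h1 h2].
  by rewrite mem_set//; apply/andP; split => //; rewrite (lt_le_trans h2)// ler_nat.
- move=> x; apply: cvg_near_cst; exists (Num.bound (mdist x z)) => // n /= hn.
  rewrite indicE mem_set ?mul1r//; apply/andP; split; first exact: mdist_ge0.
  by rewrite (lt_le_trans (archi_boundP (mdist_ge0 _ _)))// ler_nat.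
Qed.

Lemma nneseries_window_mass w X : (forall x, 0 <= w x) ->
  (\sum_(0 <= k <oo) (window_mass (shell z k) w X)%:E = linear_statistic w X)%E.
Proof.
move=> w0.
apply/cvg_lim => //.
have -> : (fun n => \sum_(0 <= k < n) (window_mass (shell z k) w X)%:E)%E =
   (fun K : nat => (window_mass (annulus z 0 K%:R) w X)%:E).
  apply/funext; elim => [|K IH].
    by rewrite big_nil annulus_id /window_mass set0I fset_set0 big_nil.
  rewrite big_nat_recr//= IH -EFinD; congr EFin; rewrite /window_mass.
  have K1 : K%:R <= K.+1%:R :> R by rewrite ler_nat.
  rewrite (annulus_cat z (ler0n _ K) K1) setIUl.
  have f1 := finite_window pM (@annulus_sub_mball _ _ z 0 K%:R) X.
  have f2 := finite_window pM (@annulus_sub_mball _ _ z K%:R K.+1%:R) X.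
  rewrite -!fsbig_finite//; last by rewrite finite_setU.
  by rewrite fsbigU// => p [[[/andP[_ h1] _] [/andP[h2 _] _]]]; move: h1; rewrite ltNge h2.
exact: cvg_window_mass_annulus.
Qed.

End WindowAlgebra.

Section AlmostSure.
Context {R : realType} (M : completeMetricType R).
Context (mu : {measure set (borel M) -> \bar R}) (Pi : probability (conf M) R).
Context (pM : proper_metric M) (intensity : has_intensity Pi mu)
  (muK : finite_on_compacts mu).
Context (C : R) (C0 : 0 < C) (varC : linear_variance_bound Pi mu C).
Local Open Scope ereal_scope.

Lemma ae_linear_statistic_lty (g : borel M -> R) : measurable_fun setT g ->
  (forall x, 0 <= g x)%R -> \int[mu]_x (g x)%:E < +oo ->
  {ae Pi, forall X : conf M, linear_statistic g X < +oo}.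
Proof.
move=> mg g0 goo; have [mS SE] := campbell pM intensity mg g0.
have iS : Pi.-integrable setT (fun X : conf M => linear_statistic g X).
  apply/integrableP; split => //.
  by under eq_integral do rewrite gee0_abs ?linear_statistic_ge0//; rewrite SE.
have := integrable_ae measurableT iS; apply: filterS => X /(_ I).
by rewrite ge0_fin_numE// linear_statistic_ge0.
Qed.

Lemma rsum_ge0E (g : M -> R) (X : configuration M) : (forall x, 0 <= g x)%R ->
  rsum g X = fine (linear_statistic g X).
Proof.
move=> g0; rewrite /rsum.
have -> : \esum_(x in [set: M]) ((X x)%:R * Num.max (- g x) 0)%:E = 0.
  by apply: esum1 => x _; rewrite max_r ?mulr0// oppr_le0.
rewrite subr0; congr fine; apply: eq_esum => x _; by rewrite max_l.
Qed.

(** Chebyshev's inequality: the count in a ball of measure [m] has variance at most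
    [C * m], so it vanishes with probability at most [C / m], and [m] can be taken
    arbitrarily large. *)
Lemma ae_nonempty (o : M) : (forall A : R, exists2 r, (0 < r)%R & A%:E <= mu (mball o r)) ->
  {ae Pi, forall X : conf M, exists x, X x != 0%N}.
Proof.
move=> big.
pose E (r : R) := [set X : conf M | npoints (mball o r) X = 0].
have mE r : measurable (E r).
  have := measurable_npoints pM (measurable_mball o r).
  move=> /(_ measurableT [set 0]) /=; rewrite setTI; apply; exact: emeasurable_set1.
have PE r : Pi (E r) * (fine (mu (mball o r)))%:E <= C%:E.
  have mB := measurable_mball o r.
  have mfin := mball_lty pM muK o r.
  have fin : mu (mball o r) \is a fin_num by rewrite ge0_fin_numE.
  set m := fine _; have m0 : (0 <= m)%R by rewrite fine_ge0.
  have mg : measurable_fun setT (\1_(mball o r) : borel M -> R) by exact: measurable_indic.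
  have I1 : \int[mu]_x (\1_(mball o r) x)%:E = m%:E by rewrite integral_indic// setIT /m fineK.
  have ig : mu.-integrable setT (EFin \o (\1_(mball o r) : borel M -> R)).
    apply/integrableP; split; first exact/measurable_EFinP.
    by under eq_integral do rewrite gee0_abs ?lee_fin//; rewrite I1 ltry.
  have sq x : ((\1_(mball o r) : borel M -> R) x ^+ 2)%:E = (\1_(mball o r) x)%:E.
    by rewrite indicE; case: (_ \in _); rewrite ?expr1n ?expr0n.
  have I2 : \int[mu]_x ((\1_(mball o r) : borel M -> R) x ^+ 2)%:E = m%:E.
    by under eq_integral do rewrite sq.
  have := varC mg ig; rewrite I2 => /(_ (ltry _)).
  rewrite /Rintegral I1 /= => V.
  have [->|mn0] := eqVneq m 0%R; first by rewrite mule0 lee_fin ltW.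
  have {mn0}m0 : (0 < m)%R by rewrite lt_neqAle eq_sym mn0.
  have [mr _ _] := integral_rsum pM intensity mg ig.
  have mV : measurable_fun setT (fun X : conf M => ((rsum (\1_(mball o r)) X - m) ^+ 2)%:E).
    by apply/measurable_EFinP/measurable_funX/measurable_funB.
  have {}V : (m ^+ 2)%:E * Pi (E r) <= C%:E * m%:E.
    apply: le_trans V; rewrite -(integral_cst Pi (mE r)).
    apply: (@le_trans _ _ (\int[Pi]_(X in E r) ((rsum (\1_(mball o r)) X - m) ^+ 2)%:E)); last first.
      by apply: ge0_subset_integral => // X _; rewrite lee_fin sqr_ge0.
    rewrite le_eqVlt; apply/orP; left; apply/eqP; apply: eq_integral => X /set_mem XE.
    by rewrite rsum_ge0E// linear_statistic_indic XE /= sub0r sqrrN.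
  have pf : Pi (E r) \is a fin_num by exact: fin_num_measure.
  rewrite -(fineK pf) -!EFinM !lee_fin in V *.
  by rewrite -(ler_pM2r m0) (le_trans _ V)//; nra.
pose r n := sval (cid2 (big n%:R)).
have rP n : (n%:R)%:E <= mu (mball o (r n)) by rewrite /r; case: cid2.
have mcap : measurable (\bigcap_n E (r n)) by apply: bigcapT_measurable => n; exact: mE.
exists (\bigcap_n E (r n)); split => //.
- have pf : Pi (\bigcap_n E (r n)) \is a fin_num by exact: fin_num_measure.
  set p := fine (Pi (\bigcap_n E (r n))).
  have p0 : (0 <= p)%R by rewrite fine_ge0.
  have pn n : (p * n%:R <= C)%R.
    rewrite -lee_fin EFinM /p fineK//; apply: le_trans (PE (r n)).
    apply: lee_pmul => //.
      apply: le_measure; [by apply: mem_set|by apply: mem_set; exact: mE|].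
      by move=> X; exact.
    by rewrite fineK ?rP// ge0_fin_numE// mball_lty.
  rewrite -(fineK pf) -/p; congr EFin; apply/eqP; rewrite eq_le p0 andbT leNgt.
  apply/negP => p_gt0; have := pn (Num.bound (C / p)).
  rewrite leNgt => /negP; apply; rewrite mulrC -ltr_pdivrMr//.
  by apply: archi_boundP; rewrite divr_ge0// ltW.
- move=> X /= Xn n _; apply: esum1 => x _.
  apply: contrapT => Xx; apply: Xn; exists x; apply/eqP => X0; apply: Xx.
  by rewrite X0.
Qed.

(** The relative deviations from the mean have summable second moments, so almost
    surely their squares form a convergent series. *)
Lemma ae_mass_ratio (g : nat -> borel M -> R) (m : nat -> R) (K : R) :
  (forall n, measurable_fun setT (g n)) -> (forall n x, 0 <= g n x)%R ->
  (forall n, \int[mu]_x (g n x)%:E = (m n)%:E) -> (forall n, 0 < m n)%R ->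
  (forall n, \int[mu]_x (g n x ^+ 2)%:E <= K%:E) ->
  \sum_(0 <= n <oo) ((m n)^-2)%:E < +oo ->
  {ae Pi, forall X : conf M, (fine (linear_statistic (g n) X) / m n)%R @[n --> \oo] --> (1 : R)%R}.
Proof.
move=> mg g0 gm m0 gK moo.
have ig n : mu.-integrable setT (EFin \o g n).
  apply/integrableP; split; first exact/measurable_EFinP.
  by under eq_integral do rewrite gee0_abs ?lee_fin//; rewrite gm ltry.
have mr n : measurable_fun setT (fun X : conf M => rsum (g n) X).
  by have [] := integral_rsum pM intensity (mg n) (ig n).
pose F n (X : conf M) := (((rsum (g n) X - m n) / m n) ^+ 2)%:E.
have mF n : measurable_fun setT (F n).
  apply/measurable_EFinP/measurable_funX/measurable_funM => //.
  exact: measurable_funB.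
have K0 : (0 <= K)%R.
  by rewrite -lee_fin (le_trans _ (gK 0%N))// integral_ge0// => x _; rewrite lee_fin sqr_ge0.
have Foo : \sum_(0 <= n <oo) \int[Pi]_X F n X < +oo.
  apply: (@le_nneseries_lty _ _ (fun n => (C * K)%:E * ((m n)^-2)%:E)); last first.
    rewrite nneseriesZl; last by move=> n _; rewrite lee_fin invr_ge0 sqr_ge0.
    by apply: lte_mul_pinfty => //; rewrite lee_fin mulr_ge0// ltW.
  move=> n; apply/andP; split; first by apply: integral_ge0 => X _; rewrite lee_fin sqr_ge0.
  have -> : \int[Pi]_X F n X = ((m n)^-2)%:E * \int[Pi]_X ((rsum (g n) X - m n) ^+ 2)%:E.
    rewrite -ge0_integralZl//.
    - by apply: eq_integral => X _; rewrite /F exprMn mulrC EFinM exprVn.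
    - by apply/measurable_EFinP/measurable_funX/measurable_funB.
    - by move=> X _; rewrite lee_fin sqr_ge0.
    - by rewrite lee_fin invr_ge0 sqr_ge0.
  rewrite muleC; apply: lee_wpmul2r; first by rewrite lee_fin invr_ge0 sqr_ge0.
  have := varC (mg n) (ig n) (le_lt_trans (gK n) (ltry _)).
  rewrite /Rintegral gm /= => /le_trans; apply.
  by rewrite EFinM; apply: lee_wpmul2l => //; rewrite lee_fin ltW.
have F0 n X : 0 <= F n X by rewrite lee_fin sqr_ge0.
have := ae_nneseries_lty mF F0 Foo; apply: filterS => X XF.
have := summable_cvg0 (fun n => sqr_ge0 _) XF => c0.
apply/cvgrPdist_lt => eps eps0.
have /cvgr0Pnorm_lt/(_ _ (exprn_gt0 2 eps0)) := c0.
apply: filterS => n; rewrite ger0_norm ?sqr_ge0// rsum_ge0E//.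
rewrite mulrBl divff ?gt_eqF// -[X in (X < _)%R -> _]real_normK ?num_real// distrC.
by rewrite ltr_pXn2r ?nnegrE// ltW.
Qed.

End AlmostSure.

Section FatouBound.
Context {R : realType} d (T : measurableType d) (P : {measure set T -> \bar R}).
Local Open Scope ereal_scope.

(** Fatou's lemma for a sequence that need not converge everywhere. The lower limit
    [Y] is measurable, inherits the bound on the integrals, and is the limit at the
    points where there is one. *)
Lemma fatou_bound (F : nat -> T -> \bar R) (B : \bar R) :
  (forall n, measurable_fun setT (F n)) -> (forall n x, 0 <= F n x) ->
  (forall n, \int[P]_x F n x <= B) ->
  exists Y : T -> \bar R, [/\ measurable_fun setT Y, forall x, 0 <= Y x,
    \int[P]_x Y x <= B & forall x l, F n x @[n --> \oo] --> l -> Y x = l].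
Proof.
move=> mF F0 FB; exists (fun x => limn_einf (F ^~ x)); split.
- rewrite /limn_einf; apply: measurableT_comp => //.
  apply: measurable_fun_limn_esup => n; exact: measurableT_comp.
- move=> x; rewrite limn_einf_lim; apply: lime_ge; first exact: is_cvg_einfs.
  by apply: nearW => n; apply: le_ereal_inf_tmp => _ [k _ <-].
- apply: le_trans (fatou P measurableT mF (fun n x _ => F0 n x)) _.
  rewrite limn_einf_lim; apply: lime_le; first exact: is_cvg_einfs.
  apply: nearW => n; apply: le_trans (FB n); apply: ereal_inf_lbound.
  by exists n => /=.
- by move=> x l /cvg_limn_einf_sup[].
Qed.

End FatouBound.

Section CenteredWindows.
Context {R : realType} (M : completeMetricType R).
Context (mu : {measure set (borel M) -> \bar R}) (Pi : probability (conf M) R).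
Context (pM : proper_metric M) (intensity : has_intensity Pi mu)
  (muK : finite_on_compacts mu).
Context (C : R) (C0 : 0 < C) (varC : linear_variance_bound Pi mu C).
Context (b : scalar_kind) (H : completeNormedModType (scalar_field R b)).
Context (ip : H -> H -> R) (ipH : real_inner_product ip).
Context (f : M -> H) (fL2 : locally_square_integrable mu f).
Context (mvp : mean_value_property mu f).
Context (z : M).
Local Open Scope ereal_scope.

Let u (x : M) : H := (f x - f z)%R.

Lemma strongly_measurable_center : strongly_measurable (u : borel M -> H).
Proof.
apply: strongly_measurableB; first exact: fL2.1.
apply: strongly_measurable_simple; split.
  exact: finite_image_cst.
move=> v; have [->|vf] := eqVneq v (f z).
  by rewrite (_ : _ @^-1` _ = setT)//; apply/seteqP; split.
rewrite (_ : _ @^-1` _ = set0)//; apply/seteqP; split => // x /= fv.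
by rewrite fv eqxx in vf.
Qed.

Let mu2 : measurable_fun setT (fun x : borel M => rnorm (u x) ^+ 2)%R.
Proof. by apply: measurable_funX; apply: measurable_rnorm; exact: strongly_measurable_center. Qed.

Lemma sqr_rnorm_center_le x :
  (rnorm (u x) ^+ 2 <= 2 * rnorm (f x) ^+ 2 + 2 * rnorm (f z) ^+ 2)%R.
Proof.
have h := ler_rnormB (f x) (f z).
have h0 := rnorm_ge0 (u x); rewrite -/(u x) in h.
have : (rnorm (u x) ^+ 2 <= (rnorm (f x) + rnorm (f z)) ^+ 2)%R.
  by rewrite ler_sqr ?nnegrE// ?addr_ge0 ?rnorm_ge0.
move/le_trans; apply; have := sqr_ge0 (rnorm (f x) - rnorm (f z))%R; nra.
Qed.

Definition centered_energy (A : set M) (s : R) : \bar R :=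
  \int[mu]_(x in A) (radial_weight (2 * s) z x * rnorm (u x) ^+ 2)%:E.

Lemma centered_energy_ge0 A s : 0 <= centered_energy A s.
Proof.
by apply: integral_ge0 => x _; rewrite lee_fin mulr_ge0// ?sqr_ge0// radial_weight_ge0.
Qed.

Let mce s : measurable_fun setT (fun x : borel M => radial_weight (2 * s) z x * rnorm (u x) ^+ 2)%R.
Proof. by apply: measurable_funM => //; exact: measurable_radial_weight. Qed.

Lemma centered_energyS A s : measurable (A : set (borel M)) ->
  centered_energy A s <= centered_energy setT s.
Proof.
move=> mA; apply: ge0_subset_integral => //; first exact/measurable_EFinP.
by move=> x _; rewrite lee_fin mulr_ge0// ?sqr_ge0// radial_weight_ge0.
Qed.

(** The mean of the centered window sum vanishes by [annulus_mean0], so its second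
    moment is its variance. *)
Lemma window_energy s x y : (0 <= s)%R -> (0 <= x)%R -> (x <= y)%R ->
  measurable_fun setT (fun X : conf M => rnorm (window_sum (annulus z x y) (radial_weight s z) u X)) /\
  \int[Pi]_X (rnorm (window_sum (annulus z x y) (radial_weight s z) u X) ^+ 2)%:E
    <= C%:E * centered_energy (annulus z x y) s.
Proof.
move=> s0 x0 xy; have mA := measurable_annulus z x y.
have mB := measurable_mball z y.
have AB := @annulus_sub_mball _ _ z x y.
have Bfin := mball_lty pM muK z y.
have Afin : mu (annulus z x y) < +oo.
  by apply: le_lt_trans Bfin; apply: le_measure; rewrite ?mem_set.
have [] := window_variance ipH pM intensity varC AB mA Afin (measurable_radial_weight s z) _
  strongly_measurable_center.
- by move=> t; rewrite radial_weight_ge0 radial_weight_le1.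
- apply: (@le_lt_trans _ _ (\int[mu]_(t in mball z y) (2 * rnorm (f t) ^+ 2 + 2 * rnorm (f z) ^+ 2)%:E)).
    apply: (@le_trans _ _ (\int[mu]_(t in mball z y) (rnorm (u t) ^+ 2)%:E)).
      apply: ge0_subset_integral => //; first exact/measurable_EFinP/measurable_funTS.
      by move=> t _; rewrite lee_fin sqr_ge0.
    apply: ge0_le_integral => //.
    + by move=> t _; rewrite lee_fin sqr_ge0.
    + exact/measurable_EFinP/measurable_funTS.
    + apply/measurable_EFinP/measurable_funTS/measurable_funD => //.
      apply: measurable_funM => //; apply: measurable_funX; apply: measurable_rnorm; exact: fL2.1.
    + by move=> t _; rewrite lee_fin sqr_rnorm_center_le.
  under eq_integral do rewrite EFinD EFinM.
  have mf2 : measurable_fun (mball z y : set (borel M)) (fun t => (rnorm (f t) ^+ 2)%:E).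
    apply/measurable_EFinP/measurable_funTS/measurable_funX; apply: measurable_rnorm; exact: fL2.1.
  rewrite ge0_integralD//; last 3 first.
  + by move=> t _; rewrite -EFinM lee_fin mulr_ge0// sqr_ge0.
  + exact: measurable_funeM.
  + by move=> t _; rewrite lee_fin mulr_ge0// sqr_ge0.
  rewrite ge0_integralZl_EFin//; last by move=> t _; rewrite lee_fin sqr_ge0.
  rewrite integral_cst// lte_add_pinfty// lte_mul_pinfty// ?lee_fin ?mulr_ge0 ?rnorm_ge0//.
  exact: square_mball_lty.
- by move=> e; exact: (annulus_mean0 ipH pM muK fL2 mvp z e s0 x0 xy).
move=> mW EW; split => //; apply: le_trans EW _.
rewrite /centered_energy; apply: lee_wpmul2l; first by rewrite lee_fin ltW.
rewrite le_eqVlt; apply/orP; left; apply/eqP; apply: eq_integral => t _.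
by rewrite sqr_radial_weight.
Qed.

(** On the shell of index [k] the squared weight at [s] is at most [q ^+ (2 * k)]
    times the one at [s'], where [q = expR (- (s - s'))]. Dividing the second
    moment of the shell sum by [q ^+ k] therefore still leaves a geometric series,
    and [G <= G ^+ 2 / q ^+ k + q ^+ k] returns from squares to norms. *)
Lemma ae_shells_summable s s' : (0 <= s')%R -> (s' < s)%R -> centered_energy setT s' < +oo ->
  {ae Pi, forall X : conf M,
    \sum_(0 <= k <oo) (rnorm (window_sum (shell z k) (radial_weight s z) u X))%:E < +oo}.
Proof.
move=> s'0 s's Vfin; have s0 : (0 <= s)%R by rewrite (le_trans s'0)// ltW.
pose q := expR (- (s - s')); have q01 : (0 < q < 1)%R.
  by rewrite expR_gt0/= expR_lt1 oppr_lt0 subr_gt0.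
have /andP[q0 q1] := q01.
pose G k (X : conf M) := rnorm (window_sum (shell z k) (radial_weight s z) u X).
pose F k (X : conf M) := (q ^- k * G k X ^+ 2)%:E.
have kk (k : nat) : (k%:R <= k.+1%:R :> R)%R by rewrite ler_nat.
have WE k := window_energy s0 (ler0n R k) (kk k).
have mG k : measurable_fun setT (G k) := (WE k).1.
have mF k : measurable_fun setT (F k).
  by apply/measurable_EFinP/measurable_funM => //; exact: measurable_funX.
have qk0 k : (0 <= q ^- k)%R by rewrite invr_ge0 exprn_ge0// ltW.
have F0 k X : 0 <= F k X by rewrite lee_fin mulr_ge0// sqr_ge0.
have V0 := centered_energy_ge0 setT s'.
pose v := fine (centered_energy setT s').
have vE : centered_energy setT s' = v%:E by rewrite fineK// ge0_fin_numE.
have v0 : (0 <= v)%R by rewrite fine_ge0.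
have Fk k : \int[Pi]_X F k X <= (C * v * q ^+ k)%:E.
  rewrite /F; under eq_integral do rewrite EFinM.
  rewrite ge0_integralZl ?lee_fin//; last 2 first.
  - by apply/measurable_EFinP; exact: measurable_funX.
  - by move=> X _; rewrite lee_fin sqr_ge0.
  apply: (@le_trans _ _ ((q ^- k)%:E * (C%:E * (q ^+ (2 * k) * v)%:E))).
    apply: lee_wpmul2l; first by rewrite lee_fin.
    apply: le_trans (WE k).2 _; apply: lee_wpmul2l; first by rewrite lee_fin ltW.
    rewrite EFinM -vE; apply: le_trans; last first.
      apply: lee_wpmul2l; first by rewrite lee_fin exprn_ge0// ltW.
      exact: (centered_energyS s' (measurable_shell z k)).
    rewrite -ge0_integralZl_EFin//.
    - apply: ge0_le_integral => //.
      + exact: measurable_shell.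
      + by move=> x _; rewrite lee_fin mulr_ge0// ?sqr_ge0// radial_weight_ge0.
      + exact/measurable_EFinP/measurable_funTS.
      + apply: measurable_funeM; exact/measurable_EFinP/measurable_funTS.
      + move=> x /andP[kx _]; rewrite -EFinM lee_fin [leRHS]mulrA.
        apply: ler_wpM2r; first exact: sqr_ge0.
        rewrite /radial_weight /q -expRM_natl -expRD ler_expR natrM.
        have := mulr_ge0 (ltW (_ : 0 < s - s')%R) (_ : 0 <= mdist x z - k%:R)%R.
        rewrite subr_gt0 subr_ge0 => /(_ s's kx); lra.
    - exact: measurable_shell.
    - by move=> x _; rewrite lee_fin mulr_ge0// ?sqr_ge0// radial_weight_ge0.
    - exact/measurable_EFinP/measurable_funTS.
    - by rewrite exprn_ge0// ltW.
  rewrite -!EFinM lee_fin mul2n -addnn exprD.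
  have qk : (q ^+ k != 0)%R by rewrite expf_neq0// gt_eqF.
  by rewrite le_eqVlt; apply/orP; left; apply/eqP; field.
have Foo : \sum_(0 <= k <oo) \int[Pi]_X F k X < +oo.
  apply: (@le_nneseries_lty _ _ (fun k => (C * v * q ^+ k)%:E)).
    by move=> k; rewrite Fk andbT; apply: integral_ge0 => X _; exact: F0.
  by apply: nneseries_geometric_lty => //; rewrite mulr_ge0// ltW.
have := ae_nneseries_lty mF F0 Foo; apply: filterS => X FX.
apply: (@le_nneseries_lty _ _ (fun k => F k X + (1 * q ^+ k)%:E)); last first.
  rewrite nneseriesD//; last by move=> k _ _; rewrite lee_fin mul1r exprn_ge0// ltW.
  by rewrite lte_add_pinfty// nneseries_geometric_lty.
move=> k; rewrite lee_fin rnorm_ge0/= -EFinD lee_fin mul1r -/(G k X).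
have qk : (0 < q ^+ k)%R by rewrite exprn_gt0.
have G0 : (0 <= G k X)%R by exact: rnorm_ge0.
rewrite -(ler_pM2l qk) mulrDr mulrA mulfV ?gt_eqF// mul1r -expr2.
have := sqr_ge0 (G k X - q ^+ k)%R; rewrite sqrrB; nra.
Qed.

(** The bound on second moments is uniform in the window, so it survives the limit
    [K --> oo] by Fatou's lemma; summability over [n] then gives almost sure
    convergence. *)
Lemma ae_centered_sums (t m : nat -> R) : (forall n, 0 <= t n)%R -> (forall n, 0 < m n)%R ->
  \sum_(0 <= n <oo) centered_energy setT (t n) * ((m n)^-2)%:E < +oo ->
  {ae Pi, forall X : conf M, forall T : nat -> R,
    (forall n, rnorm (window_sum (annulus z 0 K%:R) (radial_weight (t n) z) u X)
       @[K --> \oo] --> T n) ->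
    (T n / m n)%R @[n --> \oo] --> (0 : R)%R}.
Proof.
move=> t0 m0 Voo.
pose F n (K : nat) (X : conf M) :=
  ((rnorm (window_sum (annulus z 0 K%:R) (radial_weight (t n) z) u X) / m n) ^+ 2)%:E.
have WE n (K : nat) := window_energy (t0 n) (lexx 0%R) (ler0n R K).
have mF n K : measurable_fun setT (F n K).
  by apply/measurable_EFinP/measurable_funX/measurable_funM => //; exact: (WE n K).1.
have F0 n K X : 0 <= F n K X by rewrite lee_fin sqr_ge0.
have FB n K : \int[Pi]_X F n K X <= C%:E * (centered_energy setT (t n) * ((m n)^-2)%:E).
  rewrite /F; under eq_integral do rewrite exprMn mulrC EFinM.
  rewrite ge0_integralZl ?lee_fin//; last 3 first.
  - by apply/measurable_EFinP; apply: measurable_funX; exact: (WE n K).1.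
  - by move=> X _; rewrite lee_fin sqr_ge0.
  - by rewrite sqr_ge0.
  rewrite muleA [leRHS]muleC exprVn; apply: lee_wpmul2l; first by rewrite lee_fin invr_ge0 sqr_ge0.
  apply: le_trans (WE n K).2 _; apply: lee_wpmul2l; first by rewrite lee_fin ltW.
  by apply: centered_energyS; exact: measurable_annulus.
have [Y YP] := choice (fun n => fatou_bound (mF n) (F0 n) (FB n)).
have mY n : measurable_fun setT (Y n) by case: (YP n).
have Y0 n X : 0 <= Y n X by case: (YP n).
have Yoo : \sum_(0 <= n <oo) \int[Pi]_X Y n X < +oo.
  apply: (@le_nneseries_lty _ _ (fun n => C%:E * (centered_energy setT (t n) * ((m n)^-2)%:E))).
    by move=> n; rewrite integral_ge0/=; case: (YP n).
  rewrite nneseriesZl; last first.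
    by move=> n _; rewrite mule_ge0 ?centered_energy_ge0// lee_fin invr_ge0 sqr_ge0.
  by rewrite lte_mul_pinfty// lee_fin ltW.
have := ae_nneseries_lty mY Y0 Yoo; apply: filterS => X YX T TX.
have YE n : Y n X = ((T n / m n) ^+ 2)%:E.
  have [_ _ _] := YP n; apply; apply: cvg_EFin; first exact: nearW.
  by rewrite !expr2; apply: cvgM; apply: cvgMl; exact: TX.
have c0 : ((T n / m n) ^+ 2)%R @[n --> \oo] --> (0 : R)%R.
  by apply: summable_cvg0 => [n|]; [exact: sqr_ge0|under eq_eseriesr do rewrite -YE].
apply/cvgr0Pnorm_lt => eps eps0.
have /cvgr0Pnorm_lt/(_ _ (exprn_gt0 2 eps0)) := c0.
apply: filterS => n; rewrite ger0_norm ?sqr_ge0// -[X in (X < _)%R -> _]real_normK ?num_real//.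
by rewrite ltr_pXn2r ?nnegrE// ltW.
Qed.

End CenteredWindows.

(** * Comparison of energies and masses, and the limit *)

Section RnormSeries.
Context {R : realType} (b : scalar_kind).

Lemma cvg_rnorm (V : normedModType (scalar_field R b)) (u : nat -> V) l :
  u n @[n --> \oo] --> l -> rnorm (u n) @[n --> \oo] --> rnorm l.
Proof.
move=> /rnorm_cvgP/cvgr0Pnorm_lt ul; apply/cvgrPdist_lt => eps /ul; apply: filterS => n.
rewrite (ger0_norm (rnorm_ge0 _)); apply: le_lt_trans.
by rewrite distrC ler_dist_rnorm.
Qed.

Lemma cvg_of_realZ (V : normedModType (scalar_field R b)) (c : nat -> R) (l : R) (v : V) :
  c n @[n --> \oo] --> l -> of_real b (c n) *: v @[n --> \oo] --> of_real b l *: v.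
Proof.
move=> cl; apply/rnorm_cvgP.
have -> : (fun n => rnorm (of_real b (c n) *: v - of_real b l *: v)) =
    (fun n => `|c n - l| * rnorm v).
  by apply/funext => n; rewrite -scalerBl -of_realN -of_realD rnormZ.
rewrite -[X in _ --> X](mul0r (rnorm v)); apply: cvgMl.
by rewrite -(normr0 R) -(subrr l); apply: cvg_norm; apply: cvgB => //; exact: cvg_cst.
Qed.

Lemma rnorm_sum_le (V : normedModType (scalar_field R b)) (u : nat -> V) m n :
  rnorm (\sum_(m <= k < n) u k) <= \sum_(m <= k < n) rnorm (u k).
Proof.
elim/big_ind2 : _ => [|x x' y y' h1 h2|//]; first by rewrite rnorm0.
by rewrite (le_trans (ler_rnormD _ _))// lerD.
Qed.

Lemma cvg_series_rnorm (H : completeNormedModType (scalar_field R b)) (u : nat -> H) :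
  (\sum_(0 <= k <oo) (rnorm (u k))%:E < +oo)%E -> cvgn (series u).
Proof.
move=> uoo; apply/cauchy_cvgP; apply: cauchy_exP => eps eps0.
have epsE : of_real b (to_real eps) = eps by apply/to_realK/ltW.
have te0 := to_real_gt0 eps0.
have r0 k : (0 <= (rnorm (u k))%:E)%E by rewrite lee_fin rnorm_ge0.
have := nneseries_tail_cvg uoo (fun k _ => r0 k).
move=> /fine_cvgP[finT /cvgr0Pnorm_lt/(_ _ te0)].
move=> hT; have [N _ hN] := filterI finT hT; have [fN /= lN] := hN N (leqnn N).
exists (series u N); exists N => // n /= Nn.
rewrite -ball_normE /= -of_real_rnorm -epsE; apply: ltr_of_real.
rewrite -rnormN opprB sub_series_geq//.
apply: le_lt_trans (rnorm_sum_le _ _ _) _.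
apply: le_lt_trans lN; rewrite ger0_norm; last by rewrite fine_ge0// nneseries_ge0.
rewrite -lee_fin fineK// -sumEFin; exact: nneseries_lim_ge.
Qed.

End RnormSeries.

Section Comparison.
Context {R : realType} (M : completeMetricType R).
Context (mu : {measure set (borel M) -> \bar R}).
Local Open Scope ereal_scope.

Lemma integral_radial_weight_base (o z : M) (s : R) (g : borel M -> R) : (0 <= s)%R ->
  measurable_fun setT g -> (forall x, 0 <= g x)%R ->
  \int[mu]_x (radial_weight s z x * g x)%:E <=
  (expR (s * mdist o z))%:E * \int[mu]_x (radial_weight s o x * g x)%:E.
Proof.
move=> s0 mg g0.
have mw a : measurable_fun setT (fun x => radial_weight s a x * g x)%R.
  by apply: measurable_funM => //; exact: measurable_radial_weight.
rewrite -ge0_integralZl_EFin//; last 2 first.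
- by move=> x _; rewrite lee_fin mulr_ge0// radial_weight_ge0.
- exact/measurable_EFinP.
apply: ge0_le_integral => //.
- by move=> x _; rewrite lee_fin mulr_ge0// radial_weight_ge0.
- exact/measurable_EFinP.
- by apply: measurable_funeM; exact/measurable_EFinP.
- move=> x _; rewrite -EFinM lee_fin [leRHS]mulrA ler_wpM2r//.
  exact: radial_weight_base.
Qed.

Lemma integral_radial_weight_base1 (o z : M) (s : R) : (0 <= s)%R ->
  \int[mu]_x (radial_weight s z x)%:E <=
  (expR (s * mdist o z))%:E * \int[mu]_x (radial_weight s o x)%:E.
Proof.
move=> s0; have E a : \int[mu]_x (radial_weight s a x)%:E =
    \int[mu]_x (radial_weight s a x * (cst 1 : borel M -> R) x)%:E.
  by apply: eq_integral => x _; rewrite mulr1.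
by rewrite !E; exact: integral_radial_weight_base.
Qed.

Lemma integral_radial_weight_gt0 (z : M) (s r : R) : (0 <= s)%R ->
  0 < mu (mball z r) -> 0 < \int[mu]_x (radial_weight s z x)%:E.
Proof.
move=> s0 mur; have mB := measurable_mball z r.
apply: (@lt_le_trans _ _ ((expR (- (s * r)))%:E * mu (mball z r))).
  by rewrite mule_gt0// lte_fin expR_gt0.
rewrite -(integral_cst mu mB).
apply: (@le_trans _ _ (\int[mu]_(x in mball z r) (radial_weight s z x)%:E)).
  apply: ge0_le_integral => //.
  - by move=> x _; rewrite lee_fin expR_ge0.
  - by apply/measurable_EFinP/measurable_funTS; exact: measurable_radial_weight.
  - by move=> x xr; rewrite lee_fin ler_expR lerN2 ler_wpM2l// ltW.
apply: ge0_subset_integral => //; first by apply/measurable_EFinP; exact: measurable_radial_weight.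
by move=> x _; rewrite lee_fin radial_weight_ge0.
Qed.

End Comparison.

Section Deterministic.
Context {R : realType} (M : completeMetricType R) (b : scalar_kind).
Context (H : completeNormedModType (scalar_field R b)) (pM : proper_metric M).
Context (f : M -> H) (z : M) (X : configuration M) (s : R).
Local Open Scope ereal_scope.

Let w : M -> R := radial_weight s z.
Let w0 x : (0 <= w x)%R. Proof. exact: radial_weight_ge0. Qed.

Lemma shell_sumE k : shell_sum s z f X k = window_sum (shell z k) w f X.
Proof. by []. Qed.

Lemma conf_weightE : conf_weight s z X = linear_statistic w X.
Proof. by []. Qed.

Lemma conf_weight_gt0 x : X x != 0%N -> 0 < conf_weight s z X.
Proof.
move=> Xx; apply: (@lt_le_trans _ _ ((X x)%:R * w x)%:E).
  by rewrite lte_fin mulr_gt0 ?expR_gt0// ltr0n lt0n.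
by apply: esum_ge; exists [set x]; [split|rewrite fsbig_set1].
Qed.

Context (Wfin : conf_weight s z X < +oo)
  (Gfin : \sum_(0 <= k <oo)
    (rnorm (window_sum (shell z k) w (fun x => f x - f z)%R X))%:E < +oo).

Let mass0 (A : set M) : (0 <= window_mass A w X)%R.
Proof. by apply: sumr_ge0 => x _; rewrite mulr_ge0. Qed.

(** On each shell the sum of [f] is the centered sum plus [f z] times the mass of the
    shell, and the masses of the shells add up to the total weight. *)
Lemma shell_sum_summable : \sum_(0 <= k <oo) (rnorm (shell_sum s z f X k))%:E < +oo.
Proof.
apply: (@le_nneseries_lty _ _ (fun k =>
  (rnorm (window_sum (shell z k) w (fun x => f x - f z)%R X))%:E +
  (rnorm (f z))%:E * (window_mass (shell z k) w X)%:E)).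
  move=> k; rewrite lee_fin rnorm_ge0/= -EFinM -EFinD lee_fin shell_sumE.
  rewrite (window_sum_center pM w f (f z) X (@annulus_sub_mball _ _ z k%:R k.+1%:R)).
  rewrite mulrC -[X in (_ <= _ + X * _)%R]ger0_norm// -rnormZ.
  by apply: le_trans (ler_rnormD _ _); rewrite subrK.
rewrite nneseriesD; last 2 first.
- by move=> k _ _; rewrite lee_fin rnorm_ge0.
- by move=> k _ _; rewrite mule_ge0// lee_fin ?rnorm_ge0.
rewrite nneseriesZl; last by move=> k _; rewrite lee_fin.
rewrite lte_add_pinfty// lte_mul_pinfty// ?lee_fin ?rnorm_ge0//.
by rewrite (nneseries_window_mass pM).
Qed.

Lemma cvg_centered_window :
  rnorm (window_sum (annulus z 0 K%:R) w (fun x => f x - f z)%R X) @[K --> \oo] -->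
  rnorm (limn (series (shell_sum s z f X)) -
         of_real b (fine (conf_weight s z X)) *: f z)%R.
Proof.
apply: cvg_rnorm.
have -> : (fun K : nat => window_sum (annulus z 0 K%:R) w (fun x => f x - f z)%R X) =
   (fun K : nat => series (shell_sum s z f X) K -
      of_real b (window_mass (annulus z 0 K%:R) w X) *: f z)%R.
  apply/funext => K.
  rewrite (window_sum_center pM w f (f z) X (@annulus_sub_mball _ _ z 0%R K%:R)).
  by rewrite (window_sum_annulus pM).
apply: cvgB; first exact/cvg_series_rnorm/shell_sum_summable.
apply: cvg_of_realZ.
have := @cvg_window_mass_annulus R M pM z w X w0; rewrite -conf_weightE.
rewrite -(@fineK _ (conf_weight s z X)); last first.
  by rewrite ge0_fin_numE//; exact: linear_statistic_ge0.
by move=> /fine_cvgP[_].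
Qed.

End Deterministic.

(** The quotient differs from [v] by [(S - W v) / W], that is by a null sequence
    divided by [W / m]. *)
Lemma cvg_ratio (R : realType) (b : scalar_kind) (V : normedModType (scalar_field R b))
    (W m : nat -> R) (S : nat -> V) (v : V) :
  (forall n, 0 < W n) -> (forall n, 0 < m n) ->
  W n / m n @[n --> \oo] --> (1 : R) ->
  rnorm (S n - of_real b (W n) *: v) / m n @[n --> \oo] --> (0 : R) ->
  of_real b (W n)^-1 *: S n @[n --> \oo] --> v.
Proof.
move=> W0 m0 Wm Tm; apply/rnorm_cvgP.
have -> : (fun n => rnorm (of_real b (W n)^-1 *: S n - v)) =
  (fun n => rnorm (S n - of_real b (W n) *: v) / m n * (W n / m n)^-1).
  apply/funext => n; have Wn := W0 n; have mn := m0 n.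
  rewrite -[in LHS](scale1r v) -(of_real1 b) -(mulVf (lt0r_neq0 Wn)) of_realM -scalerA -scalerBr rnormZ.
  rewrite ger0_norm ?invr_ge0 1?ltW//; field.
  by rewrite !gt_eqF.
rewrite -[X in _ --> X](mul0r (1^-1)); apply: cvgM => //.
by apply: cvgV => //; exact: oner_neq0.
Qed.

Section Energy.
Context {R : realType} (M : completeMetricType R).
Context (mu : {measure set (borel M) -> \bar R}) (pM : proper_metric M)
  (muK : finite_on_compacts mu).
Context (b : scalar_kind) (H : completeNormedModType (scalar_field R b)).
Context (f : M -> H) (fL2 : locally_square_integrable mu f).
Local Open Scope ereal_scope.

Definition radial_energy (z : M) (s : R) : \bar R :=
  \int[mu]_x (radial_weight (2 * s) z x * rnorm (f x) ^+ 2)%:E.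

Lemma radial_energy_ge0 z s : 0 <= radial_energy z s.
Proof.
by apply: integral_ge0 => x _; rewrite lee_fin mulr_ge0// ?radial_weight_ge0// sqr_ge0.
Qed.

Let mf2 : measurable_fun setT (fun x : borel M => rnorm (f x) ^+ 2)%R.
Proof. by apply: measurable_funX; apply: measurable_rnorm; exact: fL2.1. Qed.

Let f20 (x : M) : (0 <= rnorm (f x) ^+ 2)%R. Proof. exact: sqr_ge0. Qed.

Let mwf2 z s : measurable_fun setT
  (fun x : borel M => radial_weight s z x * rnorm (f x) ^+ 2)%R.
Proof. by apply: measurable_funM => //; exact: measurable_radial_weight. Qed.

(** Splitting [f x - f z] leaves the energy of [f] and the total mass of the squared
    weight, which the weight at any smaller exponent [s'] dominates. *)
Lemma centered_energy_le z s s' : (s' <= s)%R ->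
  centered_energy mu f z setT s <= 2%:E * radial_energy z s +
    (2 * rnorm (f z) ^+ 2)%:E * \int[mu]_x (radial_weight (2 * s') z x)%:E.
Proof.
move=> s's; have mw := measurable_radial_weight (2 * s') z.
have fz0 : (0 <= 2 * rnorm (f z) ^+ 2)%R by rewrite mulr_ge0.
have w0 := radial_weight_ge0 (2 * s') z.
have wf0 x : (0 <= radial_weight (2 * s) z x * rnorm (f x) ^+ 2)%R.
  by rewrite mulr_ge0// radial_weight_ge0.
rewrite -ge0_integralZl_EFin//; last 2 first.
- by move=> x _; rewrite lee_fin.
- exact/measurable_EFinP.
rewrite -ge0_integralZl_EFin//; last 2 first.
- by move=> x _; rewrite lee_fin.
- exact/measurable_EFinP.
rewrite -ge0_integralD//; last 4 first.
- by move=> x _; rewrite mule_ge0// lee_fin.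
- by apply: measurable_funeM; exact/measurable_EFinP.
- by move=> x _; rewrite mule_ge0// lee_fin.
- by apply: measurable_funeM; exact/measurable_EFinP.
apply: ge0_le_integral => //.
- by move=> x _; rewrite lee_fin mulr_ge0// ?radial_weight_ge0// sqr_ge0.
- apply/measurable_EFinP; apply: measurable_funM; first exact: measurable_radial_weight.
  by apply: measurable_funX; apply: measurable_rnorm; exact: (strongly_measurable_center fL2).
- by apply: emeasurable_funD; apply: measurable_funeM; exact/measurable_EFinP.
- move=> x _; rewrite -!EFinM -EFinD lee_fin.
  have k1 := sqr_rnorm_center_le f z x.
  have k3 : (radial_weight (2 * s) z x <= radial_weight (2 * s') z x)%R.
    by apply: le_radial_weight; rewrite ler_pM2l.
  apply: le_trans (ler_wpM2l (radial_weight_ge0 (2 * s) z x) k1) _.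
  have := ler_wpM2l fz0 k3; lra.
Qed.

Lemma radial_energy_base (o z : M) (s : R) : (0 <= s)%R ->
  radial_energy z s <= (expR (2 * s * mdist o z))%:E * radial_energy o s.
Proof. by move=> s0; apply: integral_radial_weight_base => //; rewrite mulr_ge0. Qed.

(** The unit ball around [y] stays within distance [1 + mdist y z] of [z], which
    bounds the weight below on it, uniformly for exponents up to [tau]. *)
Lemma radial_energy_lower (y z : M) (tau : R) :
  0 < \int[mu]_(x in mball y 1%R) (rnorm (f x) ^+ 2)%:E ->
  exists2 c : R, (0 < c)%R & forall s, (0 <= s <= tau)%R -> c%:E <= radial_energy z s.
Proof.
move=> Iy0; have Iyfin := square_mball_lty pM fL2 y 1.
set Iy := \int[mu]_(x in _) _ in Iy0 Iyfin.
pose rho := (1 + mdist y z)%R.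
have rho0 : (0 <= rho)%R by rewrite addr_ge0// mdist_ge0.
exists (expR (- (2 * tau * rho)) * fine Iy)%R.
  by rewrite mulr_gt0 ?expR_gt0// fine_gt0// Iy0.
move=> s /andP[s0 stau]; have mB := measurable_mball y 1.
rewrite EFinM fineK; last by rewrite ge0_fin_numE// ltW.
rewrite -ge0_integralZl_EFin//; last 2 first.
- by move=> x _; rewrite lee_fin.
- exact/measurable_EFinP/measurable_funTS.
apply: (@le_trans _ _ (\int[mu]_(x in mball y 1%R) (radial_weight (2 * s) z x * rnorm (f x) ^+ 2)%:E)).
  apply: ge0_le_integral => //.
  - by move=> x _; rewrite mule_ge0// lee_fin ?expR_ge0.
  - by apply: measurable_funeM; exact/measurable_EFinP/measurable_funTS.
  - by apply/measurable_EFinP/measurable_funTS.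
  - move=> x xy; rewrite -EFinM lee_fin ler_wpM2r// ler_expR lerN2.
    rewrite -!mulrA ler_wpM2l// ler_pM// ?mdist_ge0//.
    have k1 := metric_triangle x y z; have k2 : (mdist x y < 1)%R := xy.
    by rewrite /rho (le_trans k1)// lerD2r ltW.
apply: ge0_subset_integral => //; first exact/measurable_EFinP.
by move=> x _; rewrite lee_fin mulr_ge0// radial_weight_ge0.
Qed.

End Energy.

Section Masses.
Context {R : realType} (M : completeMetricType R).
Context (mu : {measure set (borel M) -> \bar R}) (pM : proper_metric M)
  (muK : finite_on_compacts mu).
Context (o : M) (h : R) (vol : volume_growth mu o h).
Context (b : scalar_kind) (H : completeNormedModType (scalar_field R b)) (f : M -> H).
Implicit Types (a z : M) (s : R).

Let h0 : 0 < h. Proof. by case: vol. Qed.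

Lemma growth_gt0 s : h < s -> 0 < s.
Proof. exact: lt_trans. Qed.

Definition radial_mass z s : R := fine (\int[mu]_x (radial_weight s z x)%:E)%E.

Lemma radial_mass_lty z s : h < s -> (\int[mu]_x (radial_weight s z x)%:E < +oo)%E.
Proof.
move=> hs; apply: le_lt_trans (integral_radial_weight_base1 mu o z _) _.
  exact/ltW/growth_gt0.
by rewrite lte_mul_pinfty ?lee_fin ?expR_ge0// (weight_mass_lty pM muK vol).
Qed.

Lemma radial_massE z s : h < s ->
  (\int[mu]_x (radial_weight s z x)%:E = (radial_mass z s)%:E)%E.
Proof.
move=> hs; rewrite fineK// ge0_fin_numE ?radial_mass_lty//.
by apply: integral_ge0 => x _; rewrite lee_fin radial_weight_ge0.
Qed.

Lemma radial_mass_gt0 z s : h < s -> 0 < radial_mass z s.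
Proof.
move=> hs; rewrite -lte_fin -radial_massE//.
have [r r0 mur] := ball_unbounded vol 1.
apply: (@integral_radial_weight_gt0 _ _ _ _ _ (r + mdist o z)); first exact/ltW/growth_gt0.
apply: (@lt_le_trans _ _ (mu (mball o r))); first exact: lt_le_trans mur.
apply: le_measure; try by apply: mem_set; exact: measurable_mball.
by move=> x; rewrite /mball/= => xo; have := metric_triangle x o z; lra.
Qed.

Lemma radial_mass_base a z s : h < s ->
  radial_mass a s <= expR (s * mdist z a) * radial_mass z s.
Proof.
move=> hs; rewrite -lee_fin EFinM -!radial_massE//.
exact/integral_radial_weight_base1/ltW/growth_gt0.
Qed.

Lemma energy_ratioE s : h < s ->
  energy_ratio mu o f s = (radial_energy mu f o s * ((radial_mass o s)^-2)%:E)%E.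
Proof.
move=> hs; rewrite /energy_ratio /weight_mass -/(radial_weight s o _) radial_massE//.
by rewrite -EFin_expe inver expf_eq0/= gt_eqF// radial_mass_gt0.
Qed.

Lemma radial_ratio_ge0 z s : (0 <= radial_energy mu f z s * ((radial_mass z s)^-2)%:E)%E.
Proof. by rewrite mule_ge0 ?radial_energy_ge0// lee_fin invr_ge0 sqr_ge0. Qed.

Context (fL2 : locally_square_integrable mu f).

(** Moving the base point from [o] to [z] changes the weight at [s] by a factor of at
    most [expR (s * mdist o z)]. Such a factor enters twice through the energy, where
    the weight is squared, and twice through the squared mass. *)
Lemma radial_ratio_le z s : h < s ->
  (radial_energy mu f z s * ((radial_mass z s)^-2)%:E <=
   (expR (4 * s * mdist o z))%:E * energy_ratio mu o f s)%E.
Proof.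
move=> hs; have s0 := growth_gt0 hs; set d := mdist o z.
have mz0 := radial_mass_gt0 z hs; have mo0 := radial_mass_gt0 o hs.
have h3 : (radial_mass z s)^-2 <= expR (2 * s * d) * (radial_mass o s)^-2.
  rewrite -ler_pdivrMr ?invr_gt0 ?exprn_gt0// invrK mulrC -ler_pdivlMr ?invr_gt0 ?exprn_gt0//.
  rewrite invrK (_ : 2 * s * d = (s * d) *+ 2); last by rewrite mulr2n; ring.
  rewrite mulr2n expRD -expr2 -exprMn ler_sqr ?nnegrE.
  - by rewrite /d metric_sym radial_mass_base.
  - exact: ltW.
  - by rewrite mulr_ge0 ?expR_ge0// ltW.
apply: (@le_trans _ _ ((expR (2 * s * d))%:E * radial_energy mu f o s *
    (expR (2 * s * d) * (radial_mass o s)^-2)%:E)%E).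
  apply: lee_pmul => //.
  - exact: radial_energy_ge0.
  - by rewrite lee_fin invr_ge0 sqr_ge0.
  - exact: (radial_energy_base fL2 o z (ltW s0)).
rewrite EFinM muleACA -EFinM -expRD energy_ratioE//.
rewrite (_ : 2 * s * d + 2 * s * d = 4 * s * d)//; ring.
Qed.

Context (t : nat -> R) (tau : R) (ht : forall n, h < t n) (ttau : forall n, t n <= tau).
Context (ratio_sum : (\sum_(0 <= n <oo) energy_ratio mu o f (t n) < +oo)%E).
Context (z : M).

Let m n := radial_mass z (t n).
Let im0 n : (0 <= ((m n)^-2)%:E)%E. Proof. by rewrite lee_fin invr_ge0 sqr_ge0. Qed.

Lemma summable_radial_ratio :
  (\sum_(0 <= n <oo) radial_energy mu f z (t n) * ((m n)^-2)%:E < +oo)%E.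
Proof.
have ratio0 n : (0 <= energy_ratio mu o f (t n))%E.
  by rewrite energy_ratioE ?radial_ratio_ge0.
apply: (@le_nneseries_lty _ _
    (fun n => (expR (4 * tau * mdist o z))%:E * energy_ratio mu o f (t n))%E); last first.
  by rewrite nneseriesZl// lte_mul_pinfty// lee_fin expR_ge0.
move=> n; rewrite radial_ratio_ge0/= (le_trans (radial_ratio_le z (ht n)))//.
by apply: lee_wpmul2r => //; rewrite lee_fin ler_expR ler_wpM2r ?mdist_ge0// ler_wpM2l.
Qed.

(** The energy of a nonzero [f] is bounded below along the exponents, so the
    summability of the energy ratios forces that of the inverse squared masses. *)
Lemma summable_inverse_mass (y : M) :
  (0 < \int[mu]_(x in mball y 1) (rnorm (f x) ^+ 2)%:E)%E ->
  (\sum_(0 <= n <oo) ((m n)^-2)%:E < +oo)%E.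
Proof.
move=> fy; have [c c0 clow] := radial_energy_lower pM fL2 z tau fy.
apply: (@le_nneseries_lty _ _
    (fun n => (c^-1)%:E * (radial_energy mu f z (t n) * ((m n)^-2)%:E))%E); last first.
  rewrite nneseriesZl; last by move=> n _; exact: radial_ratio_ge0.
  by rewrite lte_mul_pinfty ?summable_radial_ratio// lee_fin invr_ge0 ltW.
move=> n; rewrite im0/= muleA -[leLHS]mul1e; apply: lee_wpmul2r => //.
rewrite -(mulVf (lt0r_neq0 c0)) EFinM; apply: lee_wpmul2l.
  by rewrite lee_fin invr_ge0 ltW.
by apply: clow; rewrite (ltW (growth_gt0 (ht n))) ttau.
Qed.

(** By [centered_energy_le] the part of the centered energy due to the constant [f z]
    is at most a multiple of the mass at [2 * h], since the squared weight at [s] is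
    the weight at [2 * s] and [s > h]. Hence the summability of the inverse squared
    masses takes care of it. *)
Lemma summable_centered_ratio : (\sum_(0 <= n <oo) ((m n)^-2)%:E < +oo)%E ->
  (\sum_(0 <= n <oo) centered_energy mu f z setT (t n) * ((m n)^-2)%:E < +oo)%E.
Proof.
move=> msum.
pose k := 2 * rnorm (f z) ^+ 2 * radial_mass z (2 * h).
have h2 : h < 2 * h by rewrite ltr_pMl// ltr1n.
have k0 : 0 <= k by rewrite !mulr_ge0 ?rnorm_ge0// ltW// radial_mass_gt0.
apply: (@le_nneseries_lty _ _ (fun n =>
    2%:E * (radial_energy mu f z (t n) * ((m n)^-2)%:E) + k%:E * ((m n)^-2)%:E)%E).
  move=> n; rewrite mule_ge0 ?centered_energy_ge0//= muleA -ge0_muleDl; last 2 first.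
  - by rewrite mule_ge0// radial_energy_ge0.
  - by rewrite lee_fin.
  apply: lee_wpmul2r => //.
  rewrite /k EFinM -radial_massE//; exact/(centered_energy_le fL2)/ltW.
rewrite nneseriesD; last 2 first.
- by move=> n _ _; rewrite mule_ge0// radial_ratio_ge0.
- by move=> n _ _; rewrite mule_ge0// lee_fin.
rewrite nneseriesZl; last by move=> n _; exact: radial_ratio_ge0.
by rewrite nneseriesZl// lte_add_pinfty// lte_mul_pinfty// ?lee_fin// summable_radial_ratio.
Qed.

Lemma centered_energy_lty n : (\sum_(0 <= n <oo) ((m n)^-2)%:E < +oo)%E ->
  (centered_energy mu f z setT (t n) < +oo)%E.
Proof.
move=> /summable_centered_ratio.
move=> /(nneseries_term_lty n (fun k => mule_ge0 (centered_energy_ge0 mu f z setT (t k)) (im0 k))).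
have := centered_energy_ge0 mu f z setT (t n).
case: (centered_energy _ _ _ _ _) => [v _ _|_|//]; first exact: ltry.
by rewrite gt0_mulye// lte_fin invr_gt0 exprn_gt0// radial_mass_gt0.
Qed.

End Masses.

Theorem theorem4p2 (R : realType) (M : completeMetricType R)
    (mu : {measure set (borel M) -> \bar R}) (o : M) (h : R)
    (Pi : probability (conf M) R)
    (b : scalar_kind) (H : completeNormedModType (scalar_field R b))
    (f : M -> H) (z : M) (s : nat -> R) :
  proper_metric M ->
  is_radon mu ->
  volume_growth mu o h ->
  small_variance Pi ->
  (forall B : set (borel M), measurable B -> first_intensity Pi B = mu B) ->
  is_hilbert H ->
  MVP mu o h f ->
  (forall n, (1 <= n)%N -> h < s n) ->
  s n @[n --> \oo] --> h ->
  (\sum_(1 <= n <oo) energy_ratio mu o f (s n) < +oo)%E ->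
  {ae Pi, forall X : conf M,
    (forall n, (1 <= n)%N ->
      (\sum_(0 <= k <oo) (rnorm (shell_sum (s n) z f X k))%:E < +oo)%E) /\
    ((forall n, (1 <= n)%N -> (0 < conf_weight (s n) z X < +oo)%E) /\
     of_real b (fine (conf_weight (s n) z X))^-1 *:
       limn (series (shell_sum (s n) z f X)) @[n --> \oo] --> f z)}.
Proof.
move=> pM radon vol sv int hilb mvpf hs scvg hsum.
have muK : finite_on_compacts mu by case: radon.
have [C C0 varC] := small_variance_real pM int sv.
have [ip ipH] := is_hilbert_real_inner_product hilb.
have [fL2 mvp _ _] := mvpf.
have h0 : 0 < h by case: vol.
pose t n := s n.+1; have ht n : h < t n by exact: hs.
have t0 n : 0 <= t n by rewrite ltW// (lt_trans h0).
have tcvg : t n @[n --> \oo] --> h by rewrite cvg_shiftS.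
(* an upper bound on the exponents makes the comparison of base points and the lower
   bound on the energy uniform *)
have [tau ttau] : exists tau, forall n, t n <= tau.
  have /cvg_seq_bounded[B [_ hB]] : cvgn t by apply/cvg_ex; exists h.
  exists (`|B| + 1) => n; rewrite (le_trans (ler_norm _))// hB//.
  by rewrite ltr_pwDr// ler_norm.
have ratio_sum : (\sum_(0 <= n <oo) energy_ratio mu o f (t n) < +oo)%E.
  (* [e] vanishes at the unconstrained index 0 *)
  pose e n := if n is k.+1 then energy_ratio mu o f (t k) else 0%E.
  have e0 n : (0 <= e n)%E.
    by case: n => // n; rewrite /= (energy_ratioE pM muK vol f (ht n)) radial_ratio_ge0.
  have -> : (\sum_(0 <= n <oo) energy_ratio mu o f (t n) = \sum_(0 <= n <oo) e (n + 1)%N)%E.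
    by apply: eq_eseriesr => n _; rewrite addn1.
  rewrite nneseries_addn//; apply: le_lt_trans hsum.
  rewrite le_eqVlt; apply/orP; left; apply/eqP.
  by apply/congr_lim/funext => n; apply: eq_big_nat => -[|k].
have nonempty := ae_nonempty pM int muK C0 varC (ball_unbounded vol).
have Wfin : {ae Pi, forall X : conf M, forall n, (conf_weight (t n) z X < +oo)%E}.
  apply: ae_foralln => n.
  apply: (ae_linear_statistic_lty pM int (measurable_radial_weight (t n) z)).
    by move=> x; exact: radial_weight_ge0.
  exact: (radial_mass_lty pM muK vol z (ht n)).
have [[y fy]|f0] := pselect (exists y, f y != 0); last first.
  (* for [f = 0] the energy ratios vanish and say nothing about the masses, but
     then every shell sum is zero *)
  have f0x x : f x = 0 by apply: contrapT => /eqP fx; apply: f0; exists x.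
  have sh0 r (X : conf M) : shell_sum r z f X = fun=> 0.
    by apply/funext => k; rewrite /shell_sum fsbig1// => x _; rewrite f0x scaler0.
  apply: filterS2 nonempty Wfin => X [x Xx] WX; split.
    move=> n _; under eq_eseriesr do rewrite sh0 rnorm0.
    by rewrite eseries0.
  split; first by case=> // n _; rewrite (conf_weight_gt0 _ _ Xx) WX.
  have -> : (fun n => of_real b (fine (conf_weight (s n) z X))^-1 *:
      limn (series (shell_sum (s n) z f X))) = fun=> f z.
    apply/funext => n; rewrite sh0 f0x.
    have -> : series (fun=> 0 : H) = fun=> 0.
      by apply/funext => k; rewrite /series/= big1.
    by rewrite lim_cst// scaler0.
  exact: cvg_cst.
have Iy0 : (0 < \int[mu]_(x in mball y 1) (rnorm (f x) ^+ 2)%:E)%E.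
  rewrite lt0e integral_ge0 ?andbT; last by move=> x _; rewrite lee_fin sqr_ge0.
  by apply/eqP => /(mean_value_eq0 ipH pM muK fL2 mvp) fy0; rewrite fy0 eqxx in fy.
have msum := summable_inverse_mass pM muK vol fL2 ht ttau ratio_sum z Iy0.
have Vsum := summable_centered_ratio pM muK vol fL2 ht ttau ratio_sum msum.
have Vfin n := centered_energy_lty pM muK vol fL2 ht ttau ratio_sum n msum.
have m0 n := radial_mass_gt0 pM muK vol z (ht n).
have h2 : h < 2 * h by rewrite ltr_pMl// ltr1n.
have second_moment n :
    (\int[mu]_x (radial_weight (t n) z x ^+ 2)%:E <= (radial_mass mu z (2 * h))%:E)%E.
  rewrite -(radial_massE pM muK vol z h2); apply: ge0_le_integral => //.
  - by move=> x _; rewrite lee_fin sqr_ge0.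
  - by apply/measurable_EFinP/measurable_funX; exact: measurable_radial_weight.
  - by apply/measurable_EFinP; exact: measurable_radial_weight.
  - move=> x _; rewrite lee_fin sqr_radial_weight; apply: le_radial_weight.
    by rewrite ler_pM2l// ltW.
have ratio1 := ae_mass_ratio pM int C0 varC (fun n => measurable_radial_weight (t n) z)
  (fun n x => radial_weight_ge0 (t n) z x) (fun n => radial_massE pM muK vol z (ht n))
  m0 second_moment msum.
have centered := ae_centered_sums pM int muK C0 varC ipH fL2 mvp t0 m0 Vsum.
have shells : {ae Pi, forall X : conf M, forall n, (\sum_(0 <= k <oo)
    (rnorm (window_sum (shell z k) (radial_weight (t n) z)
      (fun x => f x - f z)%R X))%:E < +oo)%E}.
  apply: ae_foralln => n.
  (* since [h < t n], some exponent of the sequence is strictly smaller *)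
  have [k tk] : exists k, t k < t n.
    have /cvgrPdist_lt/(_ (t n - h)) := tcvg; rewrite subr_gt0.
    move=> /(_ (ht n))[k _ /(_ k (leqnn k))] /=; rewrite distrC => k1; exists k.
    by rewrite -(ltrD2r (- h)) (le_lt_trans (ler_norm _)).
  exact: (ae_shells_summable pM int muK C0 varC ipH fL2 mvp (t0 k) tk (Vfin k)).
apply: filterS2 (filterI nonempty Wfin) (filterI ratio1 (filterI shells centered)).
move=> X [[x Xx] WX] [X3 [X4 X5]].
have W0 n : 0 < fine (conf_weight (t n) z X).
  by rewrite fine_gt0// (conf_weight_gt0 _ _ Xx) WX.
split.
  by case=> // n _; exact: (shell_sum_summable pM (WX n) (X4 n)).
split; first by case=> // n _; rewrite (conf_weight_gt0 _ _ Xx) WX.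
rewrite -cvg_shiftS; apply: (cvg_ratio W0 m0 X3).
by apply: X5 => n; exact: (cvg_centered_window pM (WX n) (X4 n)).
Qed.
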